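(* Let $p$ be an odd prime and let $\theta$ be a non-trivial even Dirichlet character of the first kind. Write $\theta=\chi\omega^{\delta+1}$ with $\chi$ of conductor $d$, $d\ge 1$, $p\nmid d$, and $\delta\in\mathbb Z/(p-1)\mathbb Z$. Let $K=\mathbb Q_p(\chi)$, $O_K$ its valuation ring, $\pi$ a uniformizer, $\mathbb F_q=O_K/\pi O_K$, and let $f(T,\theta)\in O_K[[T]]$ be the Iwasawa power series of $\theta$. Then: 1) the reduction $\overline{f(T,\theta)}\in\mathbb F_q[[T]]$ of $f(T,\theta)$ modulo $\pi$ is not a pseudo-rational function, i.e. there are no pseudo-polynomials $P,Q\in\mathbb F_q[[T]]$ with $Q\neq 0$ and $\overline{f(T,\theta)}=P/Q$; 2) $\lambda(f(T,\theta))<\left(\frac{p-1}{2}\,\phi(d)\right)^{\phi(p-1)}$, where $\phi$ is Euler's totient function.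
   Context: ''First kind'' means the conductor of $\theta$ is not divisible by $p^2$; $\omega$ is the Teichmüller character. $L_p(s,\theta)$ is the Kubota–Leopoldt $p$-adic $L$-function. With $\kappa=1+pd$, the Iwasawa power series $f(T,\theta)\in O_K[[T]]$ is the power series with $L_p(s,\theta)=f(\kappa^s-1,\theta)$ for all $s\in\mathbb Z_p$. For $a\in\mathbb Z_p$, $(1+T)^a=\sum_{k\ge0}\binom{a}{k}T^k$, and in $\mathbb F_q[[T]]$ one uses the reduced binomial coefficients. A pseudo-polynomial in $\mathbb F_q[[T]]$ is a finite sum $\sum_i c_i(1+T)^{a_i}$ with $c_i\in\mathbb F_q$, $a_i\in\mathbb Z_p$. For nonzero $F\in O_K[[T]]$, the Weierstrass preparation theorem gives a unique factorization $F=\pi^{\mu(F)}P(T)U(T)$ with $U$ a unit of $O_K[[T]]$, $\mu(F)\in\mathbb N$, and $P\in O_K[T]$ monic with $P\equiv T^{\lambda(F)}\pmod{\pi}$; this defines $\lambda(F)\in\mathbb N$. *)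

(* Defs.v *)
From HB Require Import structures.
From mathcomp Require Import all_boot all_order all_algebra all_field.
From mathcomp Require cyclic.
From mathcomp Require Import ring.
From mathcomp Require Import boolp classical_sets.

Set Implicit Arguments.
Unset Strict Implicit.
Unset Printing Implicit Defensive.
Import GRing.Theory.

Local Open Scope ring_scope.

(* Z_p is the inverse limit of the rings Z/p^n: an element is the sequence of
   its residues mod p^n, each taken in [0, p^n[. *)
Definition coherent (p : nat) (x : nat -> nat) : Prop :=
  forall n, (x n < p ^ n)%N /\ x n.+1 = x n %[mod p ^ n].

(* The primality proof is a parameter because the integral domain instance
   needs it. *)
Record padic_int (p : nat) (p_pr : prime p) := PadicInt {
  digits :> nat -> nat;
  digits_coherent : `[< coherent p digits >] }.

HB.instance Definition _ p (p_pr : prime p) := [isSub for @digits p p_pr].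
HB.instance Definition _ p (p_pr : prime p) :=
  [Choice of padic_int p_pr by <:].

Section PadicRing.
Variables (p : nat) (p_pr : prime p).
Local Notation Zp := (padic_int p_pr).
Implicit Types x y z : Zp.

Let p_gt0 : (0 < p)%N := prime_gt0 p_pr.
Let pX_gt0 n : (0 < p ^ n)%N. Proof. by rewrite expn_gt0 p_gt0. Qed.

Lemma digits_lt x n : (x n < p ^ n)%N.
Proof. by case: x => x /= /asboolP /(_ n) []. Qed.

Lemma digits_modS x n : x n.+1 = x n %[mod p ^ n].
Proof. by case: x => x /= /asboolP /(_ n) []. Qed.

Lemma padicP x y : (forall n, x n = y n) -> x = y.
Proof. by move=> xy; apply: val_inj; apply: funext. Qed.

Lemma digits_small x n : (x n %% p ^ n)%N = x n.
Proof. by rewrite modn_small ?digits_lt. Qed.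

Lemma digits_small_mod x j i : (j <= i)%N -> x i = x j %[mod p ^ j].
Proof.
move=> /subnK <-; elim: (i - j)%N => [//|n IH].
rewrite addSn -IH -(modn_dvdm (x (n + j).+1) (dvdn_exp2l p (leq_addl n j))).
by rewrite digits_modS modn_dvdm ?dvdn_exp2l ?leq_addl.
Qed.

Definition padic_mod (u : nat -> nat)
    (hu : forall n, u n.+1 = u n %[mod p ^ n]) : Zp.
Proof.
exists (fun n => u n %% p ^ n)%N; apply/asboolP => n /=.
by rewrite ltn_mod pX_gt0 modn_mod expnS modn_dvdm ?dvdn_mull ?hu.
Defined.

Lemma padic_add_subproof x y n :
  (x n.+1 + y n.+1)%N = (x n + y n)%N %[mod p ^ n].
Proof. by rewrite -modnDm !digits_modS modnDm. Qed.

Lemma padic_mul_subproof x y n :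
  (x n.+1 * y n.+1)%N = (x n * y n)%N %[mod p ^ n].
Proof. by rewrite -modnMm !digits_modS modnMm. Qed.

Lemma padic_opp_subproof x n :
  (p ^ n.+1 - x n.+1)%N = (p ^ n - x n)%N %[mod p ^ n].
Proof.
apply/eqP; rewrite -(eqn_modDr (x n)) subnK ?(ltnW (digits_lt _ _)) //.
rewrite -modnDmr -(digits_modS x) modnDmr subnK ?(ltnW (digits_lt _ _)) //.
by rewrite expnS modnMl modnn.
Qed.

Definition padic_nat (m : nat) : Zp := @padic_mod (fun=> m) (fun=> erefl).
Definition padic_add x y := padic_mod (padic_add_subproof x y).
Definition padic_mul x y := padic_mod (padic_mul_subproof x y).
Definition padic_opp x := padic_mod (padic_opp_subproof x).

Fact padic_addA : associative padic_add.
Proof. by move=> x y z; apply: padicP => n /=; rewrite modnDml modnDmr addnA. Qed.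
Fact padic_addC : commutative padic_add.
Proof. by move=> x y; apply: padicP => n /=; rewrite addnC. Qed.
Fact padic_add0 : left_id (padic_nat 0) padic_add.
Proof. by move=> x; apply: padicP => n /=; rewrite mod0n digits_small. Qed.
Fact padic_addN : left_inverse (padic_nat 0) padic_opp padic_add.
Proof.
move=> x; apply: padicP => n /=.
by rewrite modnDml subnK ?modnn ?mod0n // ltnW ?digits_lt.
Qed.

HB.instance Definition _ :=
  GRing.isZmodule.Build Zp padic_addA padic_addC padic_add0 padic_addN.

Fact padic_mulA : associative padic_mul.
Proof. by move=> x y z; apply: padicP => n /=; rewrite modnMml modnMmr mulnA. Qed.
Fact padic_mulC : commutative padic_mul.
Proof. by move=> x y; apply: padicP => n /=; rewrite mulnC. Qed.
Fact padic_mul1 : left_id (padic_nat 1) padic_mul.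
Proof.
by move=> x; apply: padicP => n /=; rewrite modnMml mul1n digits_small.
Qed.
Fact padic_mulDl : left_distributive padic_mul padic_add.
Proof.
by move=> x y z; apply: padicP => n /=; rewrite modnMml modnDm mulnDl.
Qed.
Fact padic_1neq0 : padic_nat 1 != 0.
Proof.
apply/eqP => /(congr1 (fun x : Zp => x 1%N)) /=.
by rewrite expn1 modn_small ?prime_gt1 // mod0n.
Qed.

HB.instance Definition _ := GRing.Zmodule_isComNzRing.Build Zp
  padic_mulA padic_mulC padic_mul1 padic_mulDl padic_1neq0.

Lemma digitsD x y n : (x + y) n = ((x n + y n) %% p ^ n)%N. Proof. by []. Qed.
Lemma digitsM x y n : (x * y) n = ((x n * y n) %% p ^ n)%N. Proof. by []. Qed.
Lemma digitsN x n : (- x) n = ((p ^ n - x n) %% p ^ n)%N. Proof. by []. Qed.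
Lemma digits_nat m n : (m%:R : Zp) n = (m %% p ^ n)%N.
Proof.
elim: m => [//|m IH]; rewrite -addn1 natrD digitsD IH.
by rewrite -[in RHS]modnDm.
Qed.

Lemma digitsX x k n : (x ^+ k) n = ((x n) ^ k %% p ^ n)%N.
Proof.
elim: k => [|k IH]; first by rewrite expr0 -[1]/(1%:R) digits_nat.
by rewrite exprS digitsM IH modnMmr expnS.
Qed.
Lemma digitsB x y n : x n = y n -> (x - y) n = 0%N.
Proof.
by move=> xy; rewrite digitsD digitsN xy modnDmr subnKC ?modnn // ltnW ?digits_lt.
Qed.

Lemma padic_dvdP k x : (exists u, x = p%:R ^+ k * u) <-> x k = 0%N.
Proof.
split=> [[u ->]|xk0].
  by rewrite -natrX digitsM digits_nat modnn mul0n mod0n.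
have dvd n : (p ^ k %| x (n + k))%N.
  by rewrite /dvdn (digits_small_mod _ (leq_addl n k)) xk0 mod0n.
have hu n : (x (n.+1 + k) %/ p ^ k)%N = (x (n + k) %/ p ^ k)%N %[mod p ^ n].
  apply/eqP; rewrite -(eqn_pmul2r (pX_gt0 k)) !muln_modl -expnD !divnK //.
  by rewrite addSn digits_modS.
exists (padic_mod hu); apply: padicP => n.
rewrite -natrX digitsM digits_nat /= modnMml modnMmr mulnC divnK //.
by rewrite (digits_small_mod _ (leq_addr k n)) digits_small.
Qed.

Fact padic_domain x y : x * y = 0 -> (x == 0) || (y == 0).
Proof.
move=> xy0; apply/norP => -[/eqP x0 /eqP y0].
have nz z : z <> 0 -> exists i, ~~ (p ^ i %| z (i + 0))%N.
  move=> z0; apply/not_existsP => H; apply: z0; apply: padicP => n.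
  have /negP := H n; rewrite negbK addn0 /dvdn digits_small => /eqP ->.
  by rewrite -[0]/(0%:R) digits_nat mod0n.
have [i xi] := nz _ x0; have [j yj] := nz _ y0.
have xi' : ~~ (p ^ i %| x (i + j))%N.
  by apply: contra xi; rewrite addn0 /dvdn (digits_small_mod _ (leq_addr j i)).
have yj' : ~~ (p ^ j %| y (i + j))%N.
  by apply: contra yj; rewrite addn0 /dvdn (digits_small_mod _ (leq_addl i j)).
have x_gt0 : (0 < x (i + j))%N by case: (x _) xi' => //; rewrite dvdn0.
have y_gt0 : (0 < y (i + j))%N by case: (y _) yj' => //; rewrite dvdn0.
have : (p ^ (i + j) %| x (i + j) * y (i + j))%N.
  by rewrite /dvdn -digitsM xy0 -[0]/(0%:R) digits_nat mod0n.
move: xi' yj'; rewrite !pfactor_dvdn ?muln_gt0 ?x_gt0 // lognM // -!ltnNge.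
by move=> xi' yj'; rewrite leqNgt -addnS leq_add // ltnW.
Qed.

Definition padic_unit : pred Zp := fun x => `[< exists y, y * x = 1 >].
Definition padic_inv x : Zp :=
  if padic_unit x then xget 0 [set y | y * x = 1] else x.

Fact padic_mulV : {in padic_unit, left_inverse 1 padic_inv *%R}.
Proof.
move=> x ux; rewrite /padic_inv; case: ifP => [/asboolP [y yx]|/negP []] //.
by apply: (xgetPex 0 (P := [set y | y * x = 1])); exists y.
Qed.
Fact padic_unitP x y : y * x = 1 -> padic_unit x.
Proof. by move=> yx; apply/asboolP; exists y. Qed.
Fact padic_inv_out : {in [predC padic_unit], padic_inv =1 id}.
Proof.
by move=> x ux; rewrite /padic_inv; case: ifP => // xu; case/negP: (ux).
Qed.

HB.instance Definition _ := GRing.ComNzRing_hasMulInverse.Build Zp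
  padic_mulV padic_unitP padic_inv_out.
HB.instance Definition _ := GRing.ComUnitRing_isIntegral.Build Zp padic_domain.

End PadicRing.

Section PadicFunctions.
Variables (p : nat) (p_pr : prime p).
Local Notation Zp := (padic_int p_pr).

Lemma padic_unitE (x : Zp) : x 1%N <> 0%N -> x \is a GRing.unit.
Proof.
move=> x1; have cop n : coprime (x n) (p ^ n).
  case: n => [|n]; first by rewrite coprimen1.
  rewrite coprime_pexpr // coprime_sym prime_coprime // /dvdn.
  have := digits_small_mod x (ltn0Sn n); rewrite expn1 => ->.
  by have := digits_small x 1; rewrite expn1 => ->; apply/eqP.
have inv n : exists u, x n * u = 1 %[mod p ^ n].
  case: (posnP (x n)) => [x0|xn0].
    by exists 0%N; move: (cop n); rewrite x0 /coprime gcd0n => /eqP ->; rewrite !modn1.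
  case: (egcdnP (p ^ n) xn0) => u k e _; exists u.
  by rewrite mulnC e (eqP (cop n)) modnMDl.
pose u n := xget 0%N [set u | x n * u = 1 %[mod p ^ n]].
have hu n : x n * u n = 1 %[mod p ^ n].
  exact: (xgetPex 0%N (P := [set u | x n * u = 1 %[mod p ^ n]])) (inv n).
have cu n : u n.+1 = u n %[mod p ^ n].
  have e : (x n * u n.+1 = x n * u n %[mod p ^ n])%N.
    rewrite hu -modnMml -(digits_modS x) modnMml.
    rewrite -(modn_dvdm _ (dvdn_exp2l p (leqnSn n))) hu.
    by rewrite modn_dvdm ?dvdn_exp2l.
  have mul v : v = u n * (x n * v) %[mod p ^ n].
    by rewrite mulnA -modnMml (mulnC (u n)) hu modnMml mul1n.
  by rewrite (mul (u n.+1)) -modnMmr e modnMmr -mul.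
apply/unitrP; exists (padic_mod p_pr cu); suff e : padic_mod p_pr cu * x = 1.
  by split=> //; rewrite mulrC.
by apply: padicP => n; rewrite digitsM /= modnMml mulnC hu.
Qed.

(* binom(a, k) = a (a - 1) ... (a - k + 1) / k!, the quotient being taken in
   Z_p; it exists by padic_binomialP and is unique as Z_p is a domain of
   characteristic 0. *)
Definition padic_binomial (a : Zp) (k : nat) : Zp :=
  xget 0 [set b | k`!%:R * b = \prod_(i < k) (a - i%:R)].

Lemma prodr_ffact (R : comNzRingType) (x k : nat) :
  \prod_(i < k) (x%:R - i%:R : R) = (x ^_ k)%:R.
Proof.
elim: k => [|k IH]; first by rewrite big_ord0.
rewrite big_ord_recr /= IH ffactnSr natrM.
by have [/natrB ->//|xk] := leqP k x; rewrite ffact_small // !mul0r.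
Qed.

Lemma prodr_shift (R : comNzRingType) (b c t : R) k :
  exists t', \prod_(i < k) (b + c * t - i%:R) = \prod_(i < k) (b - i%:R) + c * t'.
Proof.
elim: k => [|k [t' IH]]; first by exists 0; rewrite !big_ord0 mulr0 addr0.
rewrite !big_ord_recr /= IH; set A := \prod_(i < k) _.
exists (A * t + t' * (b + c * t - k%:R)).
ring.
Qed.

Lemma padic_binomialP a k :
  k`!%:R * padic_binomial a k = \prod_(i < k) (a - i%:R).
Proof.
apply: (xgetPex 0 (P := [set b : Zp | k`!%:R * b = \prod_(i < k) (a - i%:R)])).
have [m pm eN] := pfactor_coprime p_pr (fact_gt0 k); set N := logn p _ in eN.
have [t et] : exists t, a - (a N)%:R = p%:R ^+ N * t.
  apply/padic_dvdP; rewrite digitsD digitsN.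
  rewrite digits_nat digits_small modnDmr subnKC ?modnn //.
  by rewrite ltnW ?digits_lt.
have [t'] := prodr_shift (a N)%:R (p%:R ^+ N) t k.
rewrite -et addrC subrK => ->; rewrite prodr_ffact.
have um : (m%:R : Zp) \is a GRing.unit.
  apply: padic_unitE; rewrite digits_nat expn1 => /eqP.
  by apply/negP; rewrite -/(dvdn p m) -prime_coprime.
exists ('C(a N, k)%:R + m%:R^-1 * t').
rewrite /mkset mulrDr -natrM mulnC bin_ffact; congr (_ + _).
by rewrite eN natrM mulrA -(mulrA m%:R) (mulrC _ m%:R^-1) mulrA mulrV // mul1r natrX.
Qed.

(* omega(a) is the unique (p-1)-st root of unity of Z_p congruent to a mod p;
   for p | a there is none and the value is 0. *)
Definition teichmuller (a : int) : Zp :=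
  xget 0 [set z | z ^+ p.-1 = 1 /\ exists u, a%:~R - z = p%:R * u].

Lemma teichmullerP (a : int) : ~~ (p %| a)%Z ->
  teichmuller a ^+ p.-1 = 1 /\
  exists u, a%:~R - teichmuller a = p%:R * u.
Proof.
move=> pa; apply: (xgetPex 0 (P := [set z : Zp | z ^+ p.-1 = 1 /\
  exists u, a%:~R - z = p%:R * u])).
have p0 : (p%:Z != 0)%R by rewrite eqz_nat -lt0n prime_gt0.
have [r er] : exists r : nat, r%:Z = (a %% p)%Z.
  by exists `|(a %% p)%Z|%N; rewrite gez0_abs ?modz_ge0.
have cop n : coprime r (p ^ n).
  apply: coprimeXr; rewrite coprime_sym prime_coprime //; apply: contra pa.
  by move=> pr; rewrite (divz_eq a p) -er rpredD ?dvdz_mull.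
have fermat n : (r ^ (p ^ n * p.-1) = 1 %[mod p ^ n.+1])%N.
  by rewrite -(cyclic.Euler_exp_totient (cop n.+1)) totient_pfactor // mulnC.
have hu n : (r ^ (p ^ n.+1) = r ^ (p ^ n) %[mod p ^ n])%N.
  have -> : (p ^ n.+1 = p ^ n * p.-1 + p ^ n)%N.
    by rewrite addnC -mulnS prednK ?prime_gt0 // expnSr.
  have e : (r ^ (p ^ n * p.-1) = 1 %[mod p ^ n])%N.
    by rewrite -(modn_dvdm _ (dvdn_exp2l p (leqnSn n))) fermat modn_dvdm ?dvdn_exp2l.
  rewrite expnD.
  by rewrite -modnMml e modnMml mul1n.
exists (padic_mod p_pr hu); split.
  apply: padicP => n; rewrite digitsX /= modnXm -expnM.
  rewrite -(modn_dvdm _ (dvdn_exp2l p (leqnSn n))) fermat.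
  by rewrite modn_dvdm ?dvdn_exp2l.
have [u eu] : exists u, r%:R - padic_mod p_pr hu = p%:R ^+ 1 * u.
  apply/padic_dvdP/digitsB; rewrite digits_nat /= expn1.
  have := fermat 0%N; rewrite expn0 mul1n expn1 => e.
  have -> : (r ^ p = r ^ p.-1 * r)%N by rewrite -expnSr prednK ?prime_gt0.
  by rewrite -modnMml e modnMml mul1n.
exists ((a %/ p)%Z%:~R + u); rewrite mulrDr -[p%:R * u]/(p%:R ^+ 1 * u) -eu.
rewrite [in LHS](divz_eq a p) -er rmorphD rmorphM /= -!pmulrn.
by rewrite addrA (mulrC p%:R).
Qed.

Lemma padic_pow_subproof (c : nat) (s : Zp) n :
  ((1 + p * c) ^ s n.+1 = (1 + p * c) ^ s n %[mod p ^ n])%N.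
Proof.
set y := (1 + p * c)%N.
have dvd_sum z : (p %| z.-1 -> 0 < z -> p %| \sum_(i < p) z ^ i)%N.
  move=> pz z0; rewrite /dvdn -modn_summ.
  have z1 : (z = 1 %[mod p])%N.
    by apply/eqP; rewrite eqn_mod_dvd // subn1.
  under eq_bigr => i _ do rewrite -modnXm z1 modnXm exp1n.
  by rewrite modn_summ sum_nat_const card_ord muln1 modnn.
have y_gt0 m : (0 < y ^ m)%N by rewrite expn_gt0.
have H k : (p ^ k.+1 %| (y ^ (p ^ k)).-1)%N.
  elim: k => [|k IH]; first by rewrite expn1 /y add1n expn1 dvdn_mulr.
  rewrite (expnSr p k) expnM predn_exp (expnSr p k.+1) dvdn_mul // dvd_sum //.
  by apply: dvdn_trans IH; rewrite expnS dvdn_mulr.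
have yn : (y ^ (p ^ n) = 1 %[mod p ^ n])%N.
  apply/eqP; rewrite eqn_mod_dvd // subn1; apply: dvdn_trans (H n).
  by rewrite expnS dvdn_mull.
rewrite (divn_eq (s n.+1) (p ^ n)) digits_modS digits_small expnD (mulnC (_ %/ _)%N).
by rewrite expnM -modnMml -modnXm yn modnXm exp1n modnMml mul1n.
Qed.

(* (1 + p c)^s for s in Z_p: its residue mod p^n is (1 + p c)^(s mod p^n). *)
Definition padic_pow (c : nat) (s : Zp) : Zp :=
  padic_mod p_pr (padic_pow_subproof c s).

End PadicFunctions.

Definition invertible (R : comNzRingType) (x : R) : Prop :=
  exists y, x * y = 1.

Definition fps (R : Type) := nat -> R.
Notation "{ 'fps' R }" := (fps R) (format "{ 'fps'  R }") : type_scope.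

Section PowerSeries.
Variable R : comNzRingType.
Implicit Types F G H : {fps R}.

HB.instance Definition _ := gen_eqMixin {fps R}.
HB.instance Definition _ := gen_choiceMixin {fps R}.

Definition fps_poly (P : {poly R}) : {fps R} := fun n => P`_n.
Definition fps_add F G : {fps R} := fun n => F n + G n.
Definition fps_opp F : {fps R} := fun n => - F n.
Definition fps_mul F G : {fps R} := fun n => \sum_(i < n.+1) F i * G (n - i)%N.

Fact fps_addA : associative fps_add.
Proof. by move=> F G H; apply: funext => n; apply: addrA. Qed.
Fact fps_addC : commutative fps_add.
Proof. by move=> F G; apply: funext => n; apply: addrC. Qed.
Fact fps_add0 : left_id (fps_poly 0) fps_add.
Proof. by move=> F; apply: funext => n; rewrite /fps_add /fps_poly coef0 add0r. Qed.
Fact fps_addN : left_inverse (fps_poly 0) fps_opp fps_add.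
Proof. by move=> F; apply: funext => n; rewrite /fps_poly coef0; apply: addNr. Qed.

HB.instance Definition _ :=
  GRing.isZmodule.Build {fps R} fps_addA fps_addC fps_add0 fps_addN.

Let trunc n F : {poly R} := \poly_(i < n) F i.

Let fps_mulE n m F G : (m < n)%N -> fps_mul F G m = (trunc n F * trunc n G)`_m.
Proof.
move=> mn; rewrite coefM; apply: eq_bigr => i _.
by rewrite !coef_poly !(leq_ltn_trans _ mn) // ?leq_subr // -ltnS.
Qed.

Let truncM n m P F : (m < n)%N ->
  (P * trunc n F)`_m = \sum_(i < m.+1) P`_i * F (m - i)%N.
Proof.
move=> mn; rewrite coefM; apply: eq_bigr => i _.
by rewrite coef_poly (leq_ltn_trans _ mn) // leq_subr.
Qed.

Fact fps_mulC : commutative fps_mul.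
Proof.
by move=> F G; apply: funext => n; rewrite !(fps_mulE (n := n.+1)) // mulrC.
Qed.
Fact fps_mulA : associative fps_mul.
Proof.
suff E F G H n : fps_mul (fps_mul F G) H n =
    (trunc n.+1 F * trunc n.+1 G * trunc n.+1 H)`_n.
  move=> F G H; apply: funext => n.
  by rewrite (fps_mulC F) !E mulrC mulrA.
rewrite truncM //; apply: eq_bigr => i _.
by rewrite -(fps_mulE (n := n.+1)).
Qed.
Fact fps_mul1 : left_id (fps_poly 1) fps_mul.
Proof.
move=> F; apply: funext => n; rewrite /fps_mul big_ord_recl subn0.
rewrite big1 ?addr0 /fps_poly ?coef1 ?mul1r // => i _.
by rewrite coef1 mul0r.
Qed.
Fact fps_mulDl : left_distributive fps_mul fps_add.
Proof.
move=> F G H; apply: funext => n; rewrite /fps_add /fps_mul -big_split /=.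
by apply: eq_bigr => i _; rewrite mulrDl.
Qed.
Fact fps_1neq0 : fps_poly 1 != fps_poly 0.
Proof.
apply/eqP => /(congr1 (fun F : {fps R} => F 0%N)).
by rewrite /fps_poly coef1 coef0 => /eqP; rewrite oner_eq0.
Qed.

HB.instance Definition _ := GRing.Zmodule_isComNzRing.Build {fps R}
  fps_mulA fps_mulC fps_mul1 fps_mulDl fps_1neq0.

End PowerSeries.

Definition fps_map (R S : Type) (g : R -> S) (F : {fps R}) : {fps S} := g \o F.

Notation padic_field p_pr := {fraction padic_int p_pr}.

Section RingOfIntegers.
Variables (p : nat) (p_pr : prime p) (K : fieldExtType (padic_field p_pr)).
Local Notation Zp := (padic_int p_pr).

Definition padic_emb : Zp -> K := in_alg K \o @FracField.tofrac Zp.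
HB.instance Definition _ := GRing.RMorphism.on padic_emb.

(* The valuation ring of K is the integral closure of Z_p in K. *)
Definition integral_pred : {pred K} :=
  fun x => `[< integralOver padic_emb x >].

Fact integral_pred_subring : subring_closed integral_pred.
Proof.
split=> [|x y /asboolP ? /asboolP ?|x y /asboolP ? /asboolP ?]; apply/asboolP.
- exact: integral1.
- exact: integral_sub.
- exact: integral_mul.
Qed.
HB.instance Definition _ :=
  GRing.isSubringClosed.Build K integral_pred integral_pred_subring.

Record int_ring := IntRing { int_val :> K; _ : int_val \in integral_pred }.
HB.instance Definition _ := [isSub for int_val].
HB.instance Definition _ := [Choice of int_ring by <:].
HB.instance Definition _ := [SubChoice_isSubComNzRing of int_ring by <:].

Fact padic_emb_int (z : Zp) : padic_emb z \in integral_pred.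
Proof. by apply/asboolP; apply: integral_id. Qed.

Definition padic_int_emb (z : Zp) : int_ring := IntRing (padic_emb_int z).

(* A uniformizer generates the maximal ideal, that is the ideal of non-units,
   of the valuation ring. *)
Definition is_uniformizer (pi : int_ring) : Prop :=
  forall x : int_ring, ~ invertible x <-> exists y, x = pi * y.

Record uniformizer := Uniformizer {
  unif_val :> int_ring;
  uniformizerP : is_uniformizer unif_val }.

End RingOfIntegers.

Section ResidueField.
Variables (p : nat) (p_pr : prime p) (K : fieldExtType (padic_field p_pr)).
Variable pi : uniformizer K.

Definition unif_ideal : {pred int_ring K} :=
  fun x => `[< exists y, x = (pi : int_ring K) * y >].

Fact unif_ideal_closed : idealr_closed unif_ideal.
Proof.
split.
- by apply/asboolP; exists 0; rewrite mulr0.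
- apply/negP => /asboolP /(uniformizerP pi); apply; exists 1; exact: mulr1.
- move=> a _ _ /asboolP [x ->] /asboolP [y ->]; apply/asboolP.
  by exists (a * x + y); rewrite mulrDr mulrCA.
Qed.
HB.instance Definition _ := isIdealr.Build (int_ring K) unif_ideal unif_ideal_closed.

Definition residue_field := {ideal_quot unif_ideal}.
HB.instance Definition _ := GRing.ComNzRing.on residue_field.

Definition reduction : int_ring K -> residue_field := \pi_residue_field%qT.
HB.instance Definition _ := GRing.RMorphism.on reduction.

Fact reduction_eq0 (x : int_ring K) :
  reduction x = 0 <-> exists y, x = (pi : int_ring K) * y.
Proof.
rewrite -(rmorph0 reduction); split=> [/eqP|[y xy]].
  by rewrite -Quotient.idealrBE subr0 => /asboolP.
by apply/eqP; rewrite -Quotient.idealrBE subr0; apply/asboolP; exists y.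
Qed.

Definition residue_inv (x : residue_field) : residue_field :=
  if x == 0 then 0 else xget 0 [set y | y * x = 1].

Fact residue_mulV x : x != 0 -> residue_inv x * x = 1.
Proof.
rewrite /residue_inv => x0; rewrite (negPf x0).
apply: (xgetPex 0 (P := [set y | y * x = 1])).
have ex : x = reduction (repr x) by rewrite /reduction reprK.
have [y xy] : invertible (repr x).
  apply: contrapT => /(uniformizerP pi) /reduction_eq0 e.
  by move: x0; rewrite ex e eqxx.
by exists (reduction y); rewrite /mkset [x in _ * x]ex -rmorphM mulrC xy rmorph1.
Qed.
Fact residue_inv0 : residue_inv 0 = 0.
Proof. by rewrite /residue_inv eqxx. Qed.
HB.instance Definition _ :=
  GRing.ComNzRing_isField.Build residue_field residue_mulV residue_inv0.

End ResidueField.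

Section DirichletCharacters.
Variable F : fieldType.
Implicit Types chi : int -> F.

Definition dirichlet_char (m : nat) chi : Prop :=
  [/\ (0 < m)%N,
      forall a b, chi (a * b) = chi a * chi b,
      forall a, chi (a + m%:Z) = chi a
    & forall a, (chi a != 0) = coprimez a m].

Definition factors_through (m : nat) chi (f : nat) : Prop :=
  forall a b : int, coprimez a m -> coprimez b m ->
    (a = b %[mod f])%Z -> chi a = chi b.

(* The conductor of a Dirichlet character mod m; divisors m is sorted. *)
Definition conductor (m : nat) chi : nat :=
  head m [seq f <- divisors m | `[< factors_through m chi f >]].

(* The primitive character inducing a Dirichlet character chi mod m: for a
   prime to the conductor f, its value at a is chi b for any b prime to m with
   b = a mod f. *)
Definition primitive_of (m : nat) chi : int -> F := fun a =>
  let f := conductor m chi in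
  if coprimez a f then
    chi (xget 0 [set b : int | coprimez b m /\ (b = a %[mod f])%Z])
  else 0.

Definition primitive_char (m : nat) chi : Prop :=
  dirichlet_char m chi /\ conductor m chi = m.

End DirichletCharacters.

(* The list B_0, ..., B_n of Bernoulli numbers (B_1 = - 1 / 2), by the
   recursion \sum_(k <= n) binom(n + 1, k) B_k = 0 for n > 0. *)
Fixpoint bernoulli_seq (n : nat) : seq rat :=
  if n is n'.+1 then
    let s := bernoulli_seq n' in
    rcons s (- (n.+1%:R^-1) * \sum_(k < n) 'C(n.+1, k)%:R * s`_k)
  else [:: 1].

Definition bernoulli (n : nat) : rat := (bernoulli_seq n)`_n.

Lemma bernoulliP n :
  \sum_(k < n.+1) 'C(n.+1, k)%:R * bernoulli k = (n == 0)%:R.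
Proof.
have size_s m : size (bernoulli_seq m) = m.+1.
  by elim: m => //= m IH; rewrite size_rcons IH.
have nth_s m k : (k <= m)%N -> (bernoulli_seq m)`_k = bernoulli k.
  elim: m => [|m IH]; first by rewrite leqn0 => /eqP ->.
  rewrite leq_eqVlt => /orP[/eqP -> //|km].
  by rewrite /= nth_rcons size_s km IH.
case: n => [|n]; first by rewrite big_ord_recl big_ord0 /bernoulli bin0.
rewrite big_ord_recr /= {2}/bernoulli /= nth_rcons size_s ltnn eqxx binSn.
rewrite mulrA mulrN mulfV ?Num.Theory.pnatr_eq0 // mulN1r.
rewrite [X in _ - X](eq_bigr (fun k : 'I_n.+1 =>
  'C(n.+2, k)%:R * bernoulli k)) ?subrr // => k _.
by rewrite nth_s // -ltnS.
Qed.

Definition bernoulli_poly (n : nat) : {poly rat} :=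
  \sum_(k < n.+1) ('C(n, k)%:R * bernoulli k) *: 'X^(n - k).

(* B_(n,psi) = f^(n-1) \sum_(1 <= a <= f) psi(a) B_n(a/f), for psi a primitive
   character of conductor f. *)
Definition gen_bernoulli (F : fieldType) (f : nat) (psi : int -> F) (n : nat) : F :=
  f%:R ^+ n / f%:R *
  \sum_(1 <= a < f.+1) psi a%:Z * ratr (bernoulli_poly n).[a%:R / f%:R].

Section PadicL.
Variables (p : nat) (p_pr : prime p) (K : fieldExtType (padic_field p_pr)).
Local Notation Zp := (padic_int p_pr).
Local Notation O_K := (int_ring K).

(* The p-adic topologies of Z_p and K are defined by the subgroups p^k Z_p and
   p^k O_K. *)
Definition padic_near (k : nat) (s t : Zp) : Prop :=
  exists u, s - t = p%:R ^+ k * u.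

Definition ext_near (k : nat) (x y : K) : Prop :=
  exists u : O_K, x - y = p%:R ^+ k * int_val u.

Definition padic_continuous (L : Zp -> K) : Prop :=
  forall s k, exists N, forall t, padic_near N s t -> ext_near k (L s) (L t).

Definition ext_cvg (u : nat -> K) (l : K) : Prop :=
  forall k, exists N, forall n, (N <= n)%N -> ext_near k (u n) l.

Definition fps_evaluates (F : {fps O_K}) (x y : K) : Prop :=
  ext_cvg (fun n => \sum_(i < n) int_val (F i) * x ^+ i) y.

(* The character omega^k mod p. *)
Definition teichmuller_char (k : int) : int -> K := fun a =>
  if (p %| a)%Z then 0 else padic_emb K (teichmuller p_pr a) ^ k.

(* The product theta omega^k as a character mod m p, for theta a character
   mod m; it need not be primitive. *)
Definition twist (theta : int -> K) (k : int) : int -> K := fun a =>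
  theta a * teichmuller_char k a.

(* L is the Kubota-Leopoldt p-adic L-function of the non-trivial primitive
   character theta of conductor m: the continuous function on Z_p such that
   L(1-n) = - (1 - psi(p) p^(n-1)) B_(n,psi) / n for all n >= 1, where
   psi is the primitive character theta omega^(-n). *)
Definition kubota_leopoldt (m : nat) (theta : int -> K) (L : Zp -> K) : Prop :=
  padic_continuous L /\
  forall n : nat, (0 < n)%N ->
    let psi0 := twist theta (- n%:Z) in
    let f := conductor (m * p) psi0 in
    let psi := primitive_of (m * p) psi0 in
    L (1 - n%:R) =
      - (1 - psi p%:Z * p%:R ^+ n.-1) * (gen_bernoulli f psi n / n%:R).

(* L(s) = F(kappa^s - 1) for all s in Z_p, where kappa = 1 + p d. *)
Definition iwasawa_series (d : nat) (L : Zp -> K) (F : {fps O_K}) : Prop :=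
  forall s : Zp, fps_evaluates F (padic_emb K (padic_pow d s) - 1) (L s).

End PadicL.

Section Invariants.
Variables (p : nat) (p_pr : prime p) (K : fieldExtType (padic_field p_pr)).
Variable pi : uniformizer K.
Local Notation Zp := (padic_int p_pr).
Local Notation O_K := (int_ring K).
Local Notation Fq := (residue_field pi).
Local Notation red := (@reduction p p_pr K pi).

Definition onepT_pow (a : Zp) : {fps Fq} := fun k =>
  red (padic_int_emb K (padic_binomial a k)).

Definition pseudo_polynomial (F : {fps Fq}) : Prop :=
  exists s : seq (Fq * Zp),
    F = \sum_(ca <- s) fps_poly ca.1%:P * onepT_pow ca.2.

Definition pseudo_rational (F : {fps Fq}) : Prop :=
  exists P Q : {fps Fq}, [/\ pseudo_polynomial P, pseudo_polynomial Q,
    Q != 0 & F * Q = P].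

Definition weierstrass_factorization (F : {fps O_K}) (mu lam : nat)
    (P : {poly O_K}) (U : {fps O_K}) : Prop :=
  [/\ F = fps_poly ((pi : O_K) ^+ mu)%:P * fps_poly P * U,
      invertible U, P \is monic & map_poly red P = 'X^lam].

(* By the Weierstrass preparation theorem such a lam exists and is unique for
   F != 0; the value is 0 for F = 0. *)
Definition lambda_invariant (F : {fps O_K}) : nat :=
  xget 0%N [set lam | exists mu P U, weierstrass_factorization F mu lam P U].

End Invariants.

(* Main.v *)
(* The coefficients of the reduction of f in the basis (1 + T)^y are the values
   at kappa^(-y) of a measure beta on Z_p attached to the Bernoulli numbers. On
   each orbit of the (p-1)st roots of unity, finite differences turn the
   transform of beta into a sum of the functions N(X^r) / (1 - X^(e r)),
   N / (1 - X^e) = sum chi(n) X^n up to constants, with r running over +-zeta^k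
   for k < (p-1)/2, and X = 1 + T. If the reduction were pseudo-rational, this
   sum would be a pseudo-polynomial up to the denominators; a generic additive
   form on the exponents specializes X^a to t^h(a), and the sum of the series
   in t is not a Laurent polynomial. If lambda were large, the transform would be
   constant modulo a high power of T; cancelling the common cyclotomic factors
   leaves exponents in a box of side phi(d), which a norm estimate in
   Q(zeta) separates modulo p^n, and the same specialization applies. *)
Require Import Defs.
From HB Require Import structures.
From mathcomp Require Import all_boot all_order all_algebra all_field.
From mathcomp Require cyclic.
From mathcomp Require Import zify ring boolp classical_sets.

Set Implicit Arguments.
Unset Strict Implicit.
Unset Printing Implicit Defensive.
Import Order.TTheory GRing.Theory Num.Theory.

Local Open Scope ring_scope.

(** * Power series modulo T^n *)

(** The exponents lie in [Z_p], so a pseudo-polynomial has no degree; moreover only congruences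
    modulo [T^(p^N)] are available, and these see exponents modulo [p^N] only. An argument by
    leading terms therefore needs two substitutes: integer-valued additive forms on the finitely
    generated group of the exponents at hand, and a reason why exponents that agree modulo [p^N] are
    equal. For the first claim [N] may grow, and finiteness is reason enough. For the second claim
    [N] is limited by [lambda], and the constant of the bound comes from making the exponents few
    and small: pairing [zeta^k] with [-zeta^k] leaves [(p-1)/2] coordinates, cancelling all
    cyclotomic factors but [Phi_d] bounds each of them by [phi(d)], and the norm from the field of
    [(p-1)]-st roots of unity has [phi(p-1)] factors. The pairing works because
    [chi(-1) (-1)^(delta+1) = 1], so that the two halves add up instead of cancelling.
    Non-triviality of [theta] enters when [d = 1]: there the sum of [chi] over a period is not zero,
    and vanishing sums of roots of unity have to remove it. *)

Section FpsCongruence.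
Variable R : comNzRingType.
Implicit Types F G H : {fps R}.

Lemma fpsD F G n : (F + G) n = F n + G n. Proof. by []. Qed.
Lemma fpsN F n : (- F) n = - F n. Proof. by []. Qed.
Lemma fpsM F G n : (F * G) n = \sum_(i < n.+1) F i * G (n - i)%N. Proof. by []. Qed.
Lemma fps0 n : (0 : {fps R}) n = 0. Proof. by rewrite -[LHS]/((0 : {poly R})`_n) coef0. Qed.
Lemma fps_sum I (r : seq I) (P : pred I) (G : I -> {fps R}) n :
  (\sum_(i <- r | P i) G i) n = \sum_(i <- r | P i) G i n.
Proof. by apply: (big_morph (fun G : {fps R} => G n)) => //; exact: fps0. Qed.

Fact fps_poly_zmod : zmod_morphism (@fps_poly R).
Proof. by move=> P Q; apply: funext => n; rewrite /fps_poly coefB. Qed.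
Fact fps_poly_monoid : monoid_morphism (@fps_poly R).
Proof.
by split=> // P Q; apply: funext => n; rewrite fpsM /fps_poly coefM.
Qed.
HB.instance Definition _ :=
  GRing.isZmodMorphism.Build {poly R} {fps R} (@fps_poly R) fps_poly_zmod.
HB.instance Definition _ :=
  GRing.isMonoidMorphism.Build {poly R} {fps R} (@fps_poly R) fps_poly_monoid.

Lemma fps_polyE (P : {poly R}) n : fps_poly P n = P`_n. Proof. by []. Qed.

Lemma fpsCM (c : R) G n : (fps_poly c%:P * G) n = c * G n.
Proof.
rewrite fpsM big_ord_recl subn0 fps_polyE coefC eqxx big1 ?addr0 // => i _.
by rewrite fps_polyE coefC mul0r.
Qed.

Lemma fpsXnM k G n : (fps_poly 'X^k * G) n = if (n < k)%N then 0 else G (n - k)%N.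
Proof.
rewrite fpsM; case: ltnP => nk.
  rewrite big1 // => i _; rewrite fps_polyE coefXn.
  by rewrite ltn_eqF ?mul0r // (leq_ltn_trans _ nk) // -ltnS.
rewrite (bigD1 (Ordinal (nk : (k < n.+1)%N))) //= fps_polyE coefXn eqxx mul1r.
rewrite big1 ?addr0 // => i /negPf ik; rewrite fps_polyE coefXn.
by rewrite -[X in (X == k)]/(val i) -[k]/(val (Ordinal (nk : (k < n.+1)%N))) val_eqE ik mul0r.
Qed.

(** Congruence modulo [T^n]. The reduction of [f] is only reached through truncations at [n = p^N],
    so most identities below have this form. *)
Definition eqT (n : nat) F G := forall k, (k < n)%N -> F k = G k.

Lemma eqTrefl n F : eqT n F F. Proof. by []. Qed.
Lemma eqTsym n F G : eqT n F G -> eqT n G F.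
Proof. by move=> e k /e. Qed.
Lemma eqTtrans n F G H : eqT n F G -> eqT n G H -> eqT n F H.
Proof. by move=> e1 e2 k kn; rewrite e1 ?e2. Qed.
Lemma eqT_le n m F G : (n <= m)%N -> eqT m F G -> eqT n F G.
Proof. by move=> nm e k kn; apply: e; apply: leq_trans nm. Qed.
Lemma eqTD n F F' G G' : eqT n F F' -> eqT n G G' -> eqT n (F + G) (F' + G').
Proof. by move=> e1 e2 k kn; rewrite !fpsD e1 ?e2. Qed.
Lemma eqTN n F F' : eqT n F F' -> eqT n (- F) (- F').
Proof. by move=> e1 k kn; rewrite !fpsN e1. Qed.
Lemma eqTB n F F' G G' : eqT n F F' -> eqT n G G' -> eqT n (F - G) (F' - G').
Proof. by move=> e1 /eqTN; apply: eqTD. Qed.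
Lemma eqTM n F F' G G' : eqT n F F' -> eqT n G G' -> eqT n (F * G) (F' * G').
Proof.
move=> e1 e2 k kn; rewrite !fpsM; apply: eq_bigr => i _.
by rewrite e1 ?e2 // (leq_ltn_trans _ kn) // ?leq_subr // -ltnS.
Qed.
Lemma eqTMl n F G G' : eqT n G G' -> eqT n (F * G) (F * G').
Proof. exact: eqTM. Qed.
Lemma eqTMr n F F' G : eqT n F F' -> eqT n (F * G) (F' * G).
Proof. by move=> e; apply: eqTM. Qed.
Lemma eqT_sum n I (r : seq I) (P : pred I) (G H : I -> {fps R}) :
  (forall i, P i -> eqT n (G i) (H i)) ->
  eqT n (\sum_(i <- r | P i) G i) (\sum_(i <- r | P i) H i).
Proof. by move=> e k kn; rewrite !fps_sum; apply: eq_bigr => i /e ->. Qed.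
Lemma eqT_prod n I (r : seq I) (P : pred I) (G H : I -> {fps R}) :
  (forall i, P i -> eqT n (G i) (H i)) ->
  eqT n (\prod_(i <- r | P i) G i) (\prod_(i <- r | P i) H i).
Proof.
by move=> e; apply: (big_ind2 (eqT n)) => // F F' G' G'' ? ?; apply: eqTM.
Qed.
Lemma eqTX n F F' k : eqT n F F' -> eqT n (F ^+ k) (F' ^+ k).
Proof. by move=> e; elim: k => // k IH; rewrite !exprS; apply: eqTM. Qed.
Lemma eqT_all F G : (forall n, eqT n F G) -> F = G.
Proof. by move=> e; apply: funext => k; apply: (e k.+1). Qed.
Lemma eqT_subr0 n F G : eqT n (F - G) 0 -> eqT n F G.
Proof. by move=> e k /e; rewrite fpsD fpsN fps0 => /eqP; rewrite subr_eq0 => /eqP. Qed.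
Lemma eqT_subr0' n F G : eqT n F G -> eqT n (F - G) 0.
Proof. by move=> e k /e ek; rewrite fpsD fpsN fps0 ek subrr. Qed.
End FpsCongruence.

Section FpsDomain.
Variable R : fieldType.
Implicit Types F G H : {fps R}.

(** Dividing by a series of order [v] costs [v] terms of precision: once the lower coefficients of
    [G] vanish, only [F v * G k] is left in the coefficient of index [v + k]. *)
Lemma eqT_cancel F v : F v != 0 -> (forall i, (i < v)%N -> F i = 0) ->
  forall G m, eqT m (F * G) 0 -> eqT (m - v) G 0.
Proof.
move=> Fv F0 G m e k; elim/ltn_ind: k => k IH km.
have := e (v + k)%N; rewrite fps0 fpsM => /(_ ltac:(lia)).
rewrite (bigD1 (inord v)) //= inordK ?ltnS ?leq_addr // addKn big1 ?addr0.
  by move/eqP; rewrite mulf_eq0 (negPf Fv) => /eqP ->; rewrite fps0.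
move=> i iv; case: (ltngtP i v) => [/F0 ->|vi|e'].
- by rewrite mul0r.
- have hi := ltn_ord i; rewrite IH ?fps0 ?mulr0 //; lia.
- by case/eqP: iv; apply: val_inj; rewrite /= inordK ?ltnS ?leq_addr.
Qed.

Lemma fps_order F : F != 0 -> exists v, F v != 0 /\ forall i, (i < v)%N -> F i = 0.
Proof.
move=> F0; have ex : exists v, F v != 0.
  apply: contrapT => h; case/eqP: F0; apply: funext => n; rewrite fps0.
  by apply: contrapT => /eqP Fn; apply: h; exists n.
case: (ex_minnP ex) => v Fv vmin; exists v; split=> // i iv.
by apply/eqP; apply: contraTT iv => /vmin; rewrite -leqNgt.
Qed.

Lemma fps_mulf_eq0 F G : F != 0 -> G != 0 -> F * G != 0.
Proof.
move=> F0 /eqP G0; have [v [Fv vm]] := fps_order F0; apply/eqP => e; apply: G0.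
apply: eqT_all => n; rewrite -(addnK v n); apply: (eqT_cancel Fv vm).
by rewrite e.
Qed.

Lemma fps_prod_neq0 I (r : seq I) (P : pred I) (G : I -> {fps R}) :
  (forall i, P i -> G i != 0) -> \prod_(i <- r | P i) G i != 0.
Proof.
move=> h; elim/big_rec: _ => [|i x Pi x0]; first exact: oner_neq0.
by rewrite fps_mulf_eq0 ?h.
Qed.

(** The combination has degree less than [q], so vanishing modulo [T^q] makes it the zero
    polynomial; substituting ['X - 1] turns the powers of [1 + 'X] into monomials. *)
Lemma onepT_free q (b : 'I_q -> R) :
  eqT q (\sum_(y < q) fps_poly (b y)%:P * fps_poly ((1 + 'X) ^+ y)) 0 ->
  forall y, b y = 0.
Proof.
move=> e; pose P := \sum_(y < q) (b y)%:P * 'X^y.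
have e2 : \sum_(y < q) (b y)%:P * (1 + 'X) ^+ y = P \Po (1 + 'X).
  rewrite /P raddf_sum /=; apply: eq_bigr => y _.
  by rewrite comp_polyM comp_polyC rmorphXn /= comp_polyX.
have P0 : P \Po (1 + 'X) = 0.
  apply/polyP => k; rewrite coef0; case: (ltnP k q) => kq.
    have := e k kq; rewrite fps0 => {}e; rewrite -e2 -[RHS]e fps_sum coef_sum.
    by apply: eq_bigr => y _; rewrite -rmorphM.
  rewrite nth_default //; apply: leq_trans kq; rewrite size_comp_poly2; last first.
    by rewrite addrC -[1]opprK -polyCN size_XsubC.
  apply: leq_trans (size_sum _ _ _) _; apply/bigmax_leqP => y _.
  by rewrite mul_polyC (leq_trans (size_scale_leq _ _)) // size_polyXn.
have {}P0 : P = 0.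
  have : (P \Po (1 + 'X)) \Po ('X - 1) = 0 by rewrite P0 comp_poly0.
  by rewrite -comp_polyA rmorphD /= comp_polyX comp_polyC addrC subrK comp_polyXr.
move=> y; have : P`_y = 0 by rewrite P0 coef0.
rewrite coef_sum (bigD1 y) //= coefCM coefXn eqxx mulr1 big1 ?addr0 //.
move=> i iy; rewrite coefCM coefXn; case: eqP => [/val_inj e'|_]; last by rewrite mulr0.
by rewrite e' eqxx in iy.
Qed.
End FpsDomain.

(** * p-adic integers and the series (1 + T)^a *)

Section PadicFacts.
Variables (p : nat) (p_pr : prime p).
Local Notation Zp := (padic_int p_pr).
Implicit Types x y z : Zp.

Lemma digits0 n : (0 : Zp) n = 0%N.
Proof. by rewrite -[0]/(0%:R) digits_nat mod0n. Qed.

Lemma digits_le x y m n : (m <= n)%N -> x n = y n -> x m = y m.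
Proof.
by move=> mn e; rewrite -(digits_small x) -(digits_small y) -!(digits_small_mod _ mn) e.
Qed.

Lemma padic_natr_eq0 n : ((n%:R : Zp) == 0) = (n == 0%N).
Proof.
apply/eqP/eqP => [|-> //] /(congr1 (fun z : Zp => z n)); rewrite digits0 digits_nat.
by rewrite modn_small // ltn_expl // prime_gt1.
Qed.

Lemma padic_pX_neq0 n : (p%:R ^+ n : Zp) != 0.
Proof. by rewrite -natrX padic_natr_eq0 -lt0n expn_gt0 prime_gt0. Qed.

Lemma digits_sub0 x y n : ((x - y) n == 0%N) = (x n == y n).
Proof.
apply/eqP/eqP => [e|/digitsB //]; rewrite -(subrK y x) digitsD e add0n.
by rewrite digits_small.
Qed.

Lemma padic_eqP x y n : x n = y n <-> exists u, x = y + p%:R ^+ n * u.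
Proof.
split=> [/digitsB/padic_dvdP [u e]|[u ->]]; first by exists u; rewrite -e addrC subrK.
apply/eqP; rewrite -digits_sub0 addrC addKr; apply/eqP/padic_dvdP; by exists u.
Qed.

Lemma digitsDl x y y' n : y n = y' n -> (x + y) n = (x + y') n.
Proof. by move=> e; rewrite !digitsD e. Qed.
Lemma digitsMl x y y' n : y n = y' n -> (x * y) n = (x * y') n.
Proof. by move=> e; rewrite !digitsM e. Qed.

Lemma digits_natE x n : ((x n)%:R : Zp) n = x n.
Proof. by rewrite digits_nat digits_small. Qed.

Lemma padic_unit1 x : (x \is a GRing.unit) = (x 1%N != 0%N).
Proof.
apply/idP/idP => [/unitrP [y [yx _]]|/eqP]; last exact: padic_unitE.
apply/eqP => x1; move/(congr1 (fun z : Zp => z 1%N)): yx.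
rewrite digitsM x1 muln0 mod0n -[1]/(1%:R) digits_nat expn1 modn_small //.
exact: prime_gt1.
Qed.

(** The first [n] with [x n.+1] non-zero is the valuation of [x], and the cofactor of [p^n] is then
    a unit. *)
Lemma padic_neq0_dvd x : x != 0 -> exists A u, x * u = p%:R ^+ A.
Proof.
move=> x0; have ex : exists n, x n != 0%N.
  apply: contrapT => h; case/eqP: x0; apply: padicP => n; rewrite digits0.
  by apply: contrapT => /eqP xn; apply: h; exists n.
case: (ex_minnP ex) => -[|n] xn nmin.
  by move: xn (digits_lt x 0); case: (x _).
have /padic_dvdP [u eu] : x n = 0%N.
  by apply/eqP; apply: contraT => /nmin; rewrite ltnn.
have uu : u \is a GRing.unit.
  rewrite padic_unit1; apply: contra xn => /eqP/padic_dvdP [v ev].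
  by apply/eqP/padic_dvdP; exists v; rewrite eu ev expr1 mulrA exprSr.
by exists n, u^-1; rewrite eu -mulrA mulrV // mulr1.
Qed.

Lemma padic_fact_neq0 k : (k`!%:R : Zp) != 0.
Proof. by rewrite padic_natr_eq0 -lt0n fact_gt0. Qed.

Lemma padic_binomial_nat m k : padic_binomial (m%:R : Zp) k = 'C(m, k)%:R.
Proof.
apply: (mulfI (padic_fact_neq0 k)); rewrite padic_binomialP prodr_ffact.
by rewrite -natrM mulnC bin_ffact.
Qed.

(** Replacing [a] by its residue modulo [p^N] changes the falling factorial by a multiple of [p^N].
    Dividing by [k!] loses only its valuation, which is below [N], so at least one factor [p]
    survives. *)
Lemma padic_binomial_digits (a : Zp) (k N : nat) : (logn p k`! < N)%N ->
  padic_binomial a k 1%N = ('C(a N, k) %% p)%N.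
Proof.
move=> hN; have [m pm eN] := pfactor_coprime p_pr (fact_gt0 k).
have [t et] : exists u, a = (a N)%:R + p%:R ^+ N * u.
  by apply/padic_eqP; rewrite digits_natE.
have [t'] := prodr_shift (a N)%:R (p%:R ^+ N) t k.
rewrite -et -padic_binomialP prodr_ffact -bin_ffact mulnC natrM.
set v := logn p _ in eN hN => e.
have {}e : k`!%:R * (padic_binomial a k - 'C(a N, k)%:R) = p%:R ^+ N * t'.
  by rewrite mulrBr e addrC addKr.
have um : (m%:R : Zp) \is a GRing.unit.
  rewrite padic_unit1 digits_nat expn1; apply: contraL pm => /eqP e'.
  by rewrite prime_coprime // negbK /dvdn e'.
have e3 : padic_binomial a k - 'C(a N, k)%:R = p%:R ^+ 1 * (p%:R ^+ (N - v.+1) * t' / m%:R).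
  apply: (mulfI (padic_fact_neq0 k)); rewrite e eN natrM natrX.
  have -> : p%:R ^+ N = p%:R ^+ v * p%:R ^+ 1 * p%:R ^+ (N - v.+1) :> Zp.
    by rewrite -!exprD; congr (_ ^+ _); lia.
  transitivity (p%:R ^+ v * p%:R ^+ 1 * p%:R ^+ (N - v.+1) * t' * (m%:R * m%:R^-1)).
    by rewrite mulrV // mulr1.
  move: (m%:R) (m%:R^-1) => a1 a2; ring.
have /eqP : (padic_binomial a k - 'C(a N, k)%:R) 1%N = 0%N.
  by apply/padic_dvdP; rewrite e3; exists (p%:R ^+ (N - v.+1) * t' / m%:R).
by rewrite digits_sub0 digits_nat expn1 => /eqP.
Qed.

End PadicFacts.

Section ResidueFacts.
Variables (p : nat) (p_pr : prime p) (K : fieldExtType (padic_field p_pr)).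
Local Notation Zp := (padic_int p_pr).
Local Notation O := (int_ring K).

Lemma padic_emb_inj : injective (@padic_emb p p_pr K).
Proof.
move=> x y; rewrite /padic_emb /= => /(fmorph_inj (in_alg K)) e.
by apply/eqP; rewrite -tofrac_eq e.
Qed.

Fact padic_int_emb_zmod : zmod_morphism (@padic_int_emb p p_pr K).
Proof. by move=> x y; apply: val_inj; rewrite /= rmorphB. Qed.
Fact padic_int_emb_monoid : monoid_morphism (@padic_int_emb p p_pr K).
Proof. by split=> [|x y]; apply: val_inj; rewrite /= ?rmorph1 ?rmorphM. Qed.
HB.instance Definition _ :=
  GRing.isZmodMorphism.Build Zp O (@padic_int_emb p p_pr K) padic_int_emb_zmod.
HB.instance Definition _ :=
  GRing.isMonoidMorphism.Build Zp O (@padic_int_emb p p_pr K) padic_int_emb_monoid.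

Lemma natrK_eq0 n : ((n%:R : K) == 0) = (n == 0%N).
Proof.
rewrite -(padic_natr_eq0 p_pr) -(rmorph_nat (@padic_emb p p_pr K)).
by rewrite -(rmorph0 (@padic_emb p p_pr K)) (inj_eq padic_emb_inj).
Qed.

Lemma pXK_neq0 n : (p%:R ^+ n : K) != 0.
Proof. by rewrite expf_neq0 // natrK_eq0 -lt0n prime_gt0. Qed.

Fact int_val_zmod : zmod_morphism (@int_val p p_pr K). Proof. by []. Qed.
Fact int_val_monoid : monoid_morphism (@int_val p p_pr K). Proof. by []. Qed.
HB.instance Definition _ :=
  GRing.isZmodMorphism.Build O K (@int_val p p_pr K) int_val_zmod.
HB.instance Definition _ :=
  GRing.isMonoidMorphism.Build O K (@int_val p p_pr K) int_val_monoid.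

Lemma int_val_inj : injective (@int_val p p_pr K).
Proof. by move=> x y; apply: val_inj. Qed.

Lemma int_mulfI (a : O) : int_val a != 0 -> injective ( *%R a).
Proof. by move=> a0 x y /(congr1 (@int_val _ _ K)); rewrite !rmorphM => /(mulfI a0)/int_val_inj. Qed.

(** If [p y = 1] with [y] integral, the monic equation of [y] multiplied by [p^n] reads
    [1 + p z = 0] with [z] in [Z_p], which is impossible modulo [p]. *)
Lemma p_not_invertible : ~ invertible (p%:R : O).
Proof.
case=> y; move/(congr1 (@int_val _ _ K)); rewrite rmorphM rmorph_nat rmorph1.
case: y => y /= /asboolP [q q_mon qy] py.
have e : \sum_(i < size q) padic_emb K q`_i * y ^+ i = 0.
  move/rootP: qy; rewrite horner_coef size_map_inj_poly ?rmorph0 //; last exact: padic_emb_inj.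
  by under eq_bigr => i _ do rewrite coef_map.
have sq : (0 < size q)%N by rewrite size_poly_gt0 monic_neq0.
move/eqP: q_mon e; rewrite lead_coefE; case: (size q) sq => // n _ /= qn.
rewrite big_ord_recr /= qn rmorph1 mul1r => e.
have : p%:R * \sum_(i < n) q`_i * p%:R ^+ (n.-1 - i) + 1 = 0 :> Zp.
  apply: padic_emb_inj; rewrite rmorph0 rmorphD rmorphM rmorph_nat rmorph1 rmorph_sum /=.
  rewrite -[RHS](mulr0 (p%:R ^+ n)) -[X in _ = _ * X]e mulrDr -exprMn py expr1n mulr_sumr.
  congr (_ + _); rewrite mulr_sumr; apply: eq_bigr => i _.
  rewrite rmorphM rmorphXn rmorph_nat mulrCA -exprS [RHS]mulrCA; congr (_ * _).
  have hi := ltn_ord i; rewrite (_ : (n.-1 - i).+1 = (n - i)%N); last lia.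
  have -> : p%:R ^+ n = p%:R ^+ (n - i) * p%:R ^+ i :> K by rewrite -exprD subnK // ltnW.
  by rewrite -mulrA -exprMn py expr1n mulr1.
move/(congr1 (fun z : Zp => z 1%N)); rewrite digitsD digitsM digits_nat expn1 modnn mul0n mod0n.
by rewrite -[1]/(1%:R) digits_nat digits0 !modn_small // prime_gt1.
Qed.

Variable pi : uniformizer K.
Local Notation F := (residue_field pi).
Local Notation red := (@reduction p p_pr K pi).

Lemma red_p : (p%:R : F) = 0.
Proof.
rewrite -(rmorph_nat red); apply/(reduction_eq0 pi); apply/(uniformizerP pi).
exact: p_not_invertible.
Qed.

Lemma pcharF : p \in [pchar F].
Proof. by rewrite inE p_pr red_p eqxx. Qed.

Lemma red_padic (z : Zp) : red (padic_int_emb K z) = (z 1%N)%:R.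
Proof.
have [u eu] : exists u, z = (z 1%N)%:R + p%:R ^+ 1 * u.
  by apply/padic_eqP; rewrite digits_natE.
rewrite {1}eu (rmorphD (@padic_int_emb p p_pr K)) (rmorphM (@padic_int_emb p p_pr K)).
rewrite (rmorphXn (@padic_int_emb p p_pr K)) !(rmorph_nat (@padic_int_emb p p_pr K)).
by rewrite (rmorphD red) (rmorphM red) (rmorphXn red) !(rmorph_nat red) red_p expr1 mul0r addr0.
Qed.

Lemma natrF_mod n : ((n %% p)%:R : F) = n%:R.
Proof. by rewrite [in RHS](divn_eq n p) natrD natrM red_p mulr0 add0r. Qed.

Lemma natrF_eq0 n : ((n%:R : F) == 0) = (p %| n)%N.
Proof. by rewrite (dvdn_pcharf pcharF). Qed.

Lemma onepT_pow_nat m : onepT_pow pi m%:R = fps_poly ((1 + 'X) ^+ m).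
Proof.
apply: funext => k; rewrite /onepT_pow padic_binomial_nat !rmorph_nat.
rewrite fps_polyE addrC exprDn coef_sum.
under eq_bigr => i _ do rewrite expr1n mulr1 coefMn coefXn.
case: (ltnP k m.+1) => km; last first.
  rewrite bin_small // big1 // => i _; case: eqP => [e|]; last by rewrite mul0rn.
  by exfalso; have := ltn_ord i; lia.
rewrite -(big_mkord predT (fun i : nat => ((k == m - i)%N)%:R *+ 'C(m, i))).
rewrite (bigD1_seq (m - k)%N) ?iota_uniq ?mem_index_iota //=; last lia.
rewrite subKn // eqxx bin_sub // big_seq_cond big1 ?addr0 // => i /andP[].
rewrite mem_index_iota => hi ik; case: eqP => [e|]; last by rewrite mul0rn.
by case/eqP: ik; lia.
Qed.

(** In characteristic [p], Frobenius gives [(1 + X)^(p^N) = 1 + X^(p^N)]. *)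
Lemma onepX_pN N l : eqT (p ^ N) (fps_poly ((1 + 'X) ^+ (p ^ N * l)) : {fps F}) 1.
Proof.
have -> : (1 + 'X : {poly F}) ^+ (p ^ N * l) = (1 + 'X^(p ^ N)) ^+ l.
  rewrite exprM; congr (_ ^+ _); elim: N => [//|N IH].
  rewrite expnSr exprM IH.
  have pcP : p \in [pchar {poly F}] by rewrite pchar_poly; exact: pcharF.
  rewrite -!(pFrobenius_autE pcP) pFrobenius_autD_comm; last exact: mulrC.
  by rewrite !pFrobenius_autE expr1n -exprM.
rewrite rmorphXn -[X in eqT _ _ X](expr1n _ l); apply: eqTX => k kN.
rewrite [LHS](_ : _ = (1 + 'X^(p ^ N) : {poly F})`_k) //.
by rewrite coefD coefXn ltn_eqF // addr0.
Qed.

Lemma onepX_mod N m m' : m = m' %[mod p ^ N] ->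
  eqT (p ^ N) (fps_poly ((1 + 'X) ^+ m) : {fps F}) (fps_poly ((1 + 'X) ^+ m')).
Proof.
have H n : eqT (p ^ N) (fps_poly ((1 + 'X) ^+ n) : {fps F}) (fps_poly ((1 + 'X) ^+ (n %% p ^ N))).
  rewrite {1}(divn_eq n (p ^ N)) exprD mulnC rmorphM.
  by rewrite -[X in eqT _ _ X]mul1r; apply: eqTMr; apply: onepX_pN.
by move=> e; apply: eqTtrans (H m) _; rewrite e; apply: eqTsym.
Qed.

Lemma onepT_pow_digits N (a : Zp) :
  eqT (p ^ N) (onepT_pow pi a) (fps_poly ((1 + 'X) ^+ (a N))).
Proof.
(* [N'] exceeds the valuation of [k!], so the [k]-th coefficient can be read off the residue of [a]
   at level [N']; [onepX_mod] then brings the exponent down to level [N]. *)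
move=> k kN; pose N' := (N + (logn p k`!).+1)%N.
have -> : onepT_pow pi a k = fps_poly ((1 + 'X) ^+ (a N')) k.
  rewrite -onepT_pow_nat /onepT_pow padic_binomial_nat !rmorph_nat.
  rewrite red_padic (@padic_binomial_digits _ _ a k N') /N' ?natrF_mod //; lia.
apply: onepX_mod kN; rewrite digits_small_mod //; apply: leq_addr.
Qed.

Lemma onepT_pow_eqT N (a b : Zp) : a N = b N ->
  eqT (p ^ N) (onepT_pow pi a) (onepT_pow pi b).
Proof.
move=> e; apply: eqTtrans (onepT_pow_digits a) _; rewrite e.
exact/eqTsym/onepT_pow_digits.
Qed.

Lemma onepT_powD a b : onepT_pow pi (a + b) = onepT_pow pi a * onepT_pow pi b.
Proof.
apply: eqT_all => n; have hn : (n <= p ^ n)%N by rewrite ltnW // ltn_expl // prime_gt1.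
apply: (eqT_le hn); apply: eqTtrans (onepT_pow_digits _) _.
apply: eqTsym; apply: eqTtrans (eqTM (onepT_pow_digits _) (onepT_pow_digits _)) _.
rewrite -rmorphM -exprD; apply: onepX_mod.
by rewrite digitsD modn_mod.
Qed.

Lemma onepT_pow0 : onepT_pow pi 0 = 1.
Proof. by rewrite -[0]/(0%:R) onepT_pow_nat expr0 rmorph1. Qed.

Lemma onepT_powMn (a : Zp) n : onepT_pow pi (a *+ n) = onepT_pow pi a ^+ n.
Proof.
by elim: n => [|n IH]; rewrite ?mulr0n ?onepT_pow0 // mulrS exprS onepT_powD IH.
Qed.

Lemma onepT_pow_sum I (r : seq I) (P : pred I) (a : I -> Zp) :
  onepT_pow pi (\sum_(i <- r | P i) a i) = \prod_(i <- r | P i) onepT_pow pi (a i).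
Proof. exact: (big_morph _ onepT_powD onepT_pow0). Qed.

(* The family ((1 + T)^y), y < p^N, is a basis of F[[T]] / (T^(p^N)), so any
   map out of Z_p / p^N extends linearly. *)
Lemma onepT_relabel N M (I : finType) (c : I -> F) (z : I -> Zp) (G : Zp -> {fps F}) :
  (forall x y : Zp, x N = y N -> eqT M (G x) (G y)) ->
  eqT (p ^ N) (\sum_i fps_poly (c i)%:P * onepT_pow pi (z i)) 0 ->
  eqT M (\sum_i fps_poly (c i)%:P * G (z i)) 0.
Proof.
move=> hG e; have pN : (0 < p ^ N)%N by rewrite expn_gt0 prime_gt0.
pose dg i : 'I_(p ^ N) := Ordinal (digits_lt (z i) N).
(* Terms are grouped by their exponent modulo [p^N]. Freeness makes the coefficients of each group
   sum to 0, and [G] is constant on a group up to precision [M]. *)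
have b0 : forall y : 'I_(p ^ N), \sum_(i | dg i == y) c i = 0.
  apply: onepT_free; apply: eqTtrans e; apply: eqTsym.
  rewrite (partition_big dg predT) //=; apply: eqT_sum => y _.
  rewrite rmorph_sum rmorph_sum mulr_suml; apply: eqT_sum => i /eqP <-.
  exact/eqTMl/onepT_pow_digits.
rewrite (partition_big dg predT) //=.
apply: (@eqTtrans _ _ _ (\sum_(y : 'I_(p ^ N)) 0)); last by rewrite big1.
apply: eqT_sum => y _; apply: (@eqTtrans _ _ _ (\sum_(i | dg i == y) fps_poly (c i)%:P * G y%:R)).
  apply: eqT_sum => i /eqP <-; apply/eqTMl/hG.
  by rewrite digits_natE.
by rewrite -mulr_suml -!rmorph_sum b0 !rmorph0 mul0r.
Qed.

Lemma onepT_free_digits N (b : 'I_(p ^ N) -> F) (z : 'I_(p ^ N) -> Zp) :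
  (forall y, z y N = y) ->
  eqT (p ^ N) (\sum_y fps_poly (b y)%:P * onepT_pow pi (z y)) 0 -> forall y, b y = 0.
Proof.
move=> hz e; apply: onepT_free; apply: eqTtrans e; apply: eqT_sum => y _.
by apply: eqTMl; apply: eqTsym; have := @onepT_pow_digits N (z y); rewrite hz.
Qed.

End ResidueFacts.

(** * Additive forms and specialization of exponents *)

Section LinearForms.
Variables (p : nat) (p_pr : prime p).
Local Notation Zp := (padic_int p_pr).

Lemma padic_mulrz_eq0 (x : Zp) (n : int) : x *~ n = 0 -> (x == 0) || (n == 0).
Proof.
case: n => n; rewrite ?NegzE ?mulrNz -?pmulrn => /eqP; rewrite ?oppr_eq0 -mulr_natl mulf_eq0.
  by rewrite padic_natr_eq0 orbC.
by rewrite padic_natr_eq0 orbC.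
Qed.

Definition subgroup (A : Zp -> Prop) := A 0 /\ forall x y, A x -> A y -> A (x - y).

Lemma subgroupN A x : subgroup A -> A x -> A (- x).
Proof. by case=> A0 Asub Ax; rewrite -sub0r; apply: Asub. Qed.
Lemma subgroupD A x y : subgroup A -> A x -> A y -> A (x + y).
Proof.
move=> sA Ax Ay; rewrite -[y]opprK; apply: (proj2 sA) => //; exact: subgroupN.
Qed.
Lemma subgroupMn A x n : subgroup A -> A x -> A (x *+ n).
Proof.
move=> sA Ax; elim: n => [|n IH]; first by rewrite mulr0n; case: sA.
by rewrite mulrS; apply: subgroupD.
Qed.
Lemma subgroupMz A x (n : int) : subgroup A -> A x -> A (x *~ n).
Proof.
move=> sA Ax; case: n => n; first exact: subgroupMn.
by rewrite NegzE mulrNz; apply: subgroupN => //; apply: subgroupMn.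
Qed.

Definition additive_on (A : Zp -> Prop) (h : Zp -> int) :=
  forall x y, A x -> A y -> h (x - y) = h x - h y.

Section Additive.
Variables (A : Zp -> Prop) (h : Zp -> int).
Hypotheses (sA : subgroup A) (hA : additive_on A h).
Lemma additive_on0 : h 0 = 0.
Proof. by rewrite -[X in h X](subrr 0) hA ?subrr //; case: sA. Qed.
Lemma additive_onN x : A x -> h (- x) = - h x.
Proof. by move=> Ax; rewrite -sub0r hA ?additive_on0 ?sub0r //; case: sA. Qed.
Lemma additive_onD x y : A x -> A y -> h (x + y) = h x + h y.
Proof. by move=> Ax Ay; rewrite -{1}[y]opprK hA ?additive_onN ?opprK //; exact: subgroupN. Qed.
Lemma additive_on_sum I (r : seq I) (P : pred I) (a : I -> Zp) :
  (forall i, P i -> A (a i)) -> h (\sum_(i <- r | P i) a i) = \sum_(i <- r | P i) h (a i).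
Proof.
move=> Aa; pose B x v := A x /\ h x = v.
suff [] : B (\sum_(i <- r | P i) a i) (\sum_(i <- r | P i) h (a i)) by [].
apply: (big_ind2 B) => [|x v y w [Ax <-] [Ay <-]|i Pi].
- by split; rewrite ?additive_on0 //; case: sA.
- by split; rewrite ?additive_onD //; apply: subgroupD.
- by split => //; apply: Aa.
Qed.
Lemma additive_onMn x n : A x -> h (x *+ n) = h x *+ n.
Proof.
move=> Ax; elim: n => [|n IH]; first by rewrite !mulr0n additive_on0.
by rewrite !mulrS additive_onD ?IH //; apply: subgroupMn.
Qed.
End Additive.

(** These forms replace the missing degree: the group of exponents is finitely generated and
    torsion-free, so integer forms can avoid 0 on any finite set of non-zero elements. Generators
    are adjoined one at a time, which spares the choice of a basis. *)
Lemma generic_form (gens : seq Zp) : exists A : Zp -> Prop,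
  [/\ subgroup A, forall a, a \in gens -> A a &
   forall T : seq Zp, (forall t, t \in T -> A t /\ t != 0) ->
     exists h, additive_on A h /\ forall t, t \in T -> h t != 0].
Proof.
elim: gens => [|a gens [A0 [sA0 gA0 hA0]]].
  exists (fun x => x = 0); split=> //.
    by split=> // x y -> ->; rewrite subr0.
  by move=> T hT; exists (fun=> 0); split=> [x y _ _|t /hT [-> /eqP]]; rewrite ?subr0.
pose A z := exists x n, A0 x /\ z = x + a *~ n.
have sA : subgroup A.
  split; first by exists 0, 0; split; [case: sA0|rewrite mulr0z addr0].
  move=> _ _ [x [n [Ax ->]]] [y [m [Ay ->]]]; exists (x - y), (n - m).
  by split; [apply: (proj2 sA0)|rewrite mulrzBr; ring].
exists A; split=> // [b|].
  rewrite inE => /predU1P [->|/gA0 Ab]; last by exists b, 0; rewrite mulr0z addr0.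
  by exists 0, 1; rewrite mulr1z add0r; split=> //; case: sA0.
(* If a non-zero multiple [c a] lies in [A0], multiplication by [c] maps the new group into [A0] and
   the old forms are composed with it. Otherwise the sum is direct and a value at [a] can be
   prescribed. *)
have [[c [c0 cA]]|indep] := pselect (exists c : int, c != 0 /\ A0 (a *~ c)).
  have cz z : A z -> A0 (z *~ c).
    move=> [x [n [Ax ->]]]; rewrite mulrzDl mulrzAC; apply: subgroupD => //; exact: subgroupMz.
  move=> T hT; have [|h [hadd hT']] := hA0 [seq t *~ c | t <- T].
    move=> _ /mapP [t tT ->]; have [At t0] := hT t tT; split; first exact: cz.
    by apply/eqP => /padic_mulrz_eq0; rewrite (negPf t0) (negPf c0).
  exists (fun z => h (z *~ c)); split=> [x y Ax Ay|t tT].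
    by rewrite mulrzBl hadd //; apply: cz.
  by apply: hT'; apply: map_f.
move=> T hT.
have uniq_n x n y m : A0 x -> A0 y -> x + a *~ n = y + a *~ m -> n = m /\ x = y.
  move=> Ax Ay e; have nm : n = m.
    apply/eqP; rewrite -subr_eq0; apply: contraT => nm; case: indep.
    exists (n - m); split=> //; rewrite mulrzBr (_ : _ - _ = y - x); first exact: (proj2 sA0).
    by apply/eqP; rewrite subr_eq addrAC -e; apply/eqP; ring.
  by split=> //; move: e; rewrite nm => /addIr.
pose dec z (xn : Zp * int) := A0 xn.1 /\ z = xn.1 + a *~ xn.2.
pose d z := xget (0, 0) [set xn | dec z xn].
have dP z : A z -> dec z (d z).
  by move=> [x [n xn]]; apply: (xgetPex (0, 0) (P := [set xn | dec z xn])); exists (x, n).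
have dE x n : A0 x -> d (x + a *~ n) = (x, n).
  move=> Ax; have /dP : A (x + a *~ n) by exists x, n.
  by case: (d _) => y m [/= Ay /(uniq_n _ _ _ _ Ax Ay) [-> ->]].
have [|h [hadd hT']] := hA0 [seq (d t).1 | t <- T & (d t).2 == 0].
  move=> u /mapP [t ht ->]; move: ht; rewrite mem_filter => /andP[/eqP d2 tT].
  have [At t0] := hT t tT; have [Ad e] := dP t At; split=> //.
  by apply: contra t0 => /eqP d1; rewrite e d1 d2 mulr0z addr0.
(* The value at the new generator exceeds all old values on the first components, so a non-zero
   multiple of it cannot be cancelled by them. *)
pose M := 1 + \sum_(t <- T) `|h (d t).1|.
exists (fun z => h (d z).1 + M * (d z).2); split.
  move=> _ _ [x [n [Ax ->]]] [y [m [Ay ->]]].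
  have -> : x + a *~ n - (y + a *~ m) = (x - y) + a *~ (n - m) by rewrite mulrzBr; ring.
  by rewrite !dE //= ?hadd //; [ring|apply: (proj2 sA0)].
move=> t tT; have [d2|d2] := eqVneq (d t).2 0.
  by rewrite d2 mulr0 addr0; apply: hT'; apply/mapP; exists t => //; rewrite mem_filter d2 eqxx.
have hM : `|h (d t).1| < M.
  rewrite /M (big_rem t) //=.
  by rewrite addrCA ltrDl ltr_pwDl // sumr_ge0.
rewrite addr_eq0; apply/eqP => e.
have : `|h (d t).1| = `|M| * `|(d t).2| by rewrite e normrN normrM.
have : 1 <= `|(d t).2| by move: d2; lia.
have : 0 <= `|h (d t).1| by [].
nia.
Qed.

(** Turns congruence of exponents into equality when finitely many exponents occur and the level may
    be taken as high as desired. *)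
Lemma padic_separate (I : finType) (z : I -> Zp) :
  exists N0, forall N, (N0 <= N)%N -> forall i j, z i N = z j N -> z i = z j.
Proof.
have ex (ij : I * I) : exists n, z ij.1 n = z ij.2 n -> z ij.1 = z ij.2.
  apply: contrapT => h; have e : z ij.1 = z ij.2; last by apply: h; exists 0%N.
  by apply: padicP => n; apply: contrapT => e; apply: h; exists n => /e.
pose n ij := xget 0%N [set n | z ij.1 n = z ij.2 n -> z ij.1 = z ij.2].
have nP ij : z ij.1 (n ij) = z ij.2 (n ij) -> z ij.1 = z ij.2.
  exact: (xgetPex 0%N (P := [set n | z ij.1 n = z ij.2 n -> z ij.1 = z ij.2])) (ex ij).
exists (\max_ij n ij) => N hN i j e; apply: (nP (i, j)).
apply: digits_le e; apply: leq_trans hN; exact: (leq_bigmax (i, j)).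
Qed.

End LinearForms.

Lemma mulr_prod_sum (R : comNzRingType) (J : finType) n (f : J -> 'I_n -> R) (c : R) :
  c * \prod_g \sum_i f g i = \sum_(j : {ffun J -> 'I_n}) c * \prod_g f g (j g).
Proof. by rewrite bigA_distr_bigA mulr_sumr. Qed.

Section Transfer.
Variables (p : nat) (p_pr : prime p) (K : fieldExtType (padic_field p_pr)).
Variable pi : uniformizer K.
Local Notation Zp := (padic_int p_pr).
Local Notation F := (residue_field pi).

(** The value of [P] at [(1 + T)^z], spelled as a combination of powers so that its exponents can be
    relabelled. *)
Definition ev (z : Zp) (P : {poly F}) : {fps F} :=
  \sum_(i < size P) fps_poly (P`_i)%:P * onepT_pow pi (z *+ i).

Lemma ev_wide (B : nat) (P : {poly F}) (z : Zp) : (size P <= B)%N ->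
  ev z P = \sum_(i < B) fps_poly (P`_i)%:P * onepT_pow pi (z *+ i).
Proof.
move=> sP; rewrite /ev (big_ord_widen _ (fun i => fps_poly (P`_i)%:P * onepT_pow pi (z *+ i)) sP).
rewrite big_mkcond; apply: eq_bigr => i _; case: ltnP => // iP.
by rewrite nth_default // rmorph0 mul0r.
Qed.

Lemma evE z P : ev z P = (map_poly (fun c => fps_poly c%:P) P).[onepT_pow pi z].
Proof.
rewrite horner_poly /ev; apply: eq_bigr => i _; by rewrite onepT_powMn.
Qed.

Fact ev_zmod z : zmod_morphism (ev z).
Proof.
move=> P Q; pose B := maxn (size P) (size Q).
have sB : (size (P - Q)%R <= B)%N by rewrite (leq_trans (size_polyD _ _)) ?size_polyN.
rewrite (ev_wide z sB) (@ev_wide B P) ?leq_maxl // (@ev_wide B Q) ?leq_maxr //.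
rewrite -sumrB; apply: eq_bigr => i _.
by rewrite coefB polyCB rmorphB mulrBl.
Qed.

Fact ev_monoid z : monoid_morphism (ev z).
Proof.
split.
  by rewrite evE (rmorph1 (map_poly (@fps_poly F \o polyC))) hornerC.
by move=> P Q; rewrite !evE (rmorphM (map_poly (@fps_poly F \o polyC))) hornerM.
Qed.
HB.instance Definition _ z := GRing.isZmodMorphism.Build {poly F} {fps F} (ev z) (ev_zmod z).
HB.instance Definition _ z := GRing.isMonoidMorphism.Build {poly F} {fps F} (ev z) (ev_monoid z).

Lemma evX z : ev z 'X = onepT_pow pi z.
Proof. by rewrite evE (map_polyX (@fps_poly F \o polyC)) hornerX. Qed.
Lemma evXn n z : ev z 'X^n = onepT_pow pi (z *+ n).
Proof. by rewrite rmorphXn /= evX onepT_powMn. Qed.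

Variables (J I : finType) (a : J -> Zp) (phi : J -> nat).
Variables (e : I -> F) (P : I -> J -> {poly F}) (B N : nat).

(** Expanding the products gives a combination of the [(1 + T)^(z j)] over the box of all [j]. By
    the separation hypothesis [w j] depends only on [z j] modulo [p^N], so [onepT_relabel] may
    replace each power by the monomial ['X^(w j)], at any target precision. *)
Lemma transfer :
  (forall t g, (size (P t g) <= B.+1)%N) ->
  (forall j j' : {ffun J -> 'I_B.+1},
     (\sum_g a g *+ j g) N = (\sum_g a g *+ j' g) N ->
     (\sum_g phi g * j g = \sum_g phi g * j' g)%N) ->
  eqT (p ^ N) (\sum_t fps_poly (e t)%:P * \prod_g ev (a g) (P t g)) 0 ->
  \sum_t e t *: \prod_g (P t g \Po 'X^(phi g)) = 0.
Proof.
move=> sP sep h.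
pose C (j : {ffun J -> 'I_B.+1}) : F := \sum_t e t * \prod_g (P t g)`_(j g).
pose z (j : {ffun J -> 'I_B.+1}) : Zp := \sum_g a g *+ j g.
pose w (j : {ffun J -> 'I_B.+1}) : nat := (\sum_g phi g * j g)%N.
have {}h : eqT (p ^ N) (\sum_j fps_poly (C j)%:P * onepT_pow pi (z j)) 0.
  apply: eqTtrans h => k kN; congr (_ k).
  under eq_bigr => j _ do rewrite /C rmorph_sum rmorph_sum mulr_suml.
  rewrite exchange_big /=; apply: eq_bigr => t _.
  under [in RHS]eq_bigr => g _ do rewrite (ev_wide _ (sP t g)).
  rewrite [RHS](@mulr_prod_sum {fps F}); apply: eq_bigr => j _.
  rewrite big_split -onepT_pow_sum polyCM (rmorphM (@fps_poly F)) -[LHS]mulrA.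
  by rewrite (rmorph_prod (@polyC F)) (rmorph_prod (@fps_poly F)).
(* One more than the largest exponent, so that the congruence determines every coefficient. *)
have key : eqT (\max_j w j).+1 (\sum_j fps_poly (C j)%:P * fps_poly 'X^(w j)) 0.
  (* [hw] reads the integer exponent off a residue modulo [p^N]; the default 0 is only taken at
     residues that no point of the box attains. *)
  pose hw (x : Zp) := xget 0%N [set v | exists j, x N = z j N /\ v = w j].
  have hwE j : hw (z j) = w j.
    have [j' [/sep e' e'']] := xgetPex 0%N (P := [set v | exists j', z j N = z j' N /\ v = w j'])
      (ex_intro _ _ (ex_intro _ j (conj erefl erefl))).
    by rewrite /hw e'' /w e'.
  apply: (@eqTtrans _ _ _ (\sum_j fps_poly (C j)%:P * fps_poly 'X^(hw (z j)))).
    by apply: eqT_sum => j _; rewrite hwE.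
  apply: (onepT_relabel (G := fun x => fps_poly 'X^(hw x)) _ h) => x y exy.
  by rewrite /hw exy.
have e1 : \sum_t e t *: \prod_g (P t g \Po 'X^(phi g)) = \sum_j (C j)%:P * 'X^(w j).
  under eq_bigr => t _.
    under eq_bigr => g _.
      rewrite (_ : P t g \Po 'X^(phi g) = \sum_(i < B.+1) (P t g)`_i *: 'X^(phi g * i)); last first.
        rewrite comp_polyE (big_ord_widen _ (fun i => (P t g)`_i *: ('X^(phi g) ^+ i)) (sP t g)).
        rewrite big_mkcond; apply: eq_bigr => i _; rewrite -exprM; case: ltnP => // iP.
        by rewrite nth_default // scale0r.
    over.
    rewrite bigA_distr_bigA scaler_sumr.
  over.
  rewrite exchange_big /=; apply: eq_bigr => j _.
  rewrite /C rmorph_sum mulr_suml; apply: eq_bigr => t _.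
  rewrite scaler_prod -prodrXr scalerA mul_polyC.
  by congr (_ *: _).
rewrite e1; apply/polyP => k; rewrite coef0.
have e2 : (\sum_j (C j)%:P * 'X^(w j))`_k = (\sum_j fps_poly (C j)%:P * fps_poly 'X^(w j)) k.
  by rewrite coef_sum fps_sum; apply: eq_bigr => j _; rewrite -rmorphM.
case: (ltnP k (\max_j w j).+1) => kw; first by rewrite e2 key // fps0.
rewrite coef_sum big1 // => j _; rewrite coefCM coefXn gtn_eqF ?mulr0 //.
by apply: leq_ltn_trans kw; apply: (leq_bigmax j).
Qed.

End Transfer.

(** * The norm estimate *)

Section MultiplicationMatrix.
Variables (P g : {poly int}) (m : nat).
Hypotheses (P_mon : P \is monic) (sP : size P = m.+1).

(** Row [i] holds the coordinates of ['X^i * g] in [Z[X]/(P)], so the determinant is the norm of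
    [g]. *)
Definition mult_mx : 'M[int]_m :=
  \matrix_(i, j) (Pdiv.CommonRing.rmodp ('X^i * g) P)`_j.

Lemma mult_mxE (R : comNzRingType) (x : R) (i : 'I_m) : (map_poly intr P).[x] = 0 ->
  \sum_j (mult_mx i j)%:~R * x ^+ j = (map_poly intr g).[x] * x ^+ i.
Proof.
move=> Px; transitivity (map_poly intr (Pdiv.CommonRing.rmodp ('X^i * g) P)).[x].
  rewrite (@horner_coef_wide _ m); last first.
    apply: leq_trans (size_poly _ _) _.
    by rewrite -ltnS -sP Pdiv.CommonRing.ltn_rmodp monic_neq0.
  by apply: eq_bigr => j _; rewrite !mxE coef_map.
have := Pdiv.RingMonic.rdivp_eq P_mon ('X^i * g).
move/(congr1 (fun q => (map_poly intr q : {poly R}).[x])).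
rewrite rmorphD !rmorphM /= map_polyXn hornerD !hornerM Px mulr0 add0r hornerXn mulrC.
by move->.
Qed.

(** The vector of powers of [x] is an eigenvector for the eigenvalue [g(x)]; applying the adjugate
    and reading the entry of index 0, where the vector is 1, shows that [g(x)] divides the norm. *)
Lemma det_mult_mx (R : comNzRingType) (x : R) : (0 < m)%N -> (map_poly intr P).[x] = 0 ->
  exists u, (\det mult_mx)%:~R = (map_poly intr g).[x] * u.
Proof.
move=> m0 Px; pose A := map_mx intr mult_mx : 'M[R]_m.
pose v := \col_(j < m) x ^+ j : 'cV[R]_m.
have Av : A *m v = (map_poly intr g).[x] *: v.
  apply/colP => i; rewrite !mxE -mult_mxE //.
  by apply: eq_bigr => j _; rewrite !mxE.
exists ((\adj A *m v) (Ordinal m0) 0).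
have : (\adj A *m (A *m v)) (Ordinal m0) 0 = \det A.
  by rewrite mulmxA mul_adj_mx mul_scalar_mx !mxE expr0 mulr1.
rewrite Av -scalemxAr mxE => ->; rewrite /A -det_map_mx //.
Qed.

End MultiplicationMatrix.

(** The Vandermonde matrix of the roots diagonalizes multiplication by [g], and distinct roots make
    its determinant non-zero. *)
Lemma det_mult_mx_roots (P g : {poly int}) m (rs : m.-tuple algC) :
  P \is monic -> size P = m.+1 -> uniq rs -> (forall r, r \in rs -> (map_poly intr P).[r] = 0) ->
  (\det (mult_mx P g m))%:~R = \prod_(r <- rs) (map_poly intr g).[r].
Proof.
move=> P_mon sP rs_uniq rsP.
pose a : 'rV[algC]_m := \row_k tnth rs k.
pose A := map_mx intr (mult_mx P g m) : 'M[algC]_m.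
have e : A *m Vandermonde m a = Vandermonde m a *m diag_mx (\row_k (map_poly intr g).[a 0 k]).
  apply/matrixP => i k; rewrite mul_mx_diag !mxE.
  transitivity ((map_poly intr g).[tnth rs k] * tnth rs k ^+ i); last by rewrite mulrC.
  rewrite -(mult_mxE g P_mon sP) ?rsP ?mem_tnth //.
  by apply: eq_bigr => j _; rewrite !mxE.
have V0 : \det (Vandermonde m a) != 0.
  rewrite det_Vandermonde; apply/prodf_neq0 => i _; apply/prodf_neq0 => j ij.
  rewrite subr_eq0 !mxE !(tnth_nth 0) nth_uniq ?size_tuple //.
  by rewrite gtn_eqF.
have := congr1 determinant e; rewrite !det_mulmx mulrC => /(mulfI V0).
rewrite /A -det_map_mx => ->; rewrite det_diag big_tuple.
by apply: eq_bigr => k _; rewrite !mxE.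
Qed.

Section CyclotomicNorm.
Variables (p : nat) (p_pr : prime p).
Local Notation Zp := (padic_int p_pr).
Variables (n1 : nat) (zeta : Zp).
Hypothesis (prim_zeta : n1.-primitive_root zeta).

Lemma Phi_root : (map_poly intr 'Phi_n1).[zeta] = 0.
Proof.
have n1_gt0 := prim_order_gt0 prim_zeta.
have : (map_poly intr (\prod_(d <- divisors n1) 'Phi_d)).[zeta] = 0.
  rewrite prod_Cyclotomic // rmorphB rmorph1 /= map_polyXn.
  by rewrite hornerD hornerN hornerXn hornerC (prim_expr_order prim_zeta) subrr.
rewrite rmorph_prod horner_prod => /eqP; rewrite prodf_seq_eq0 => /hasP [d].
rewrite -dvdn_divisors // => dn /andP[_ /eqP e].
have [<- //|dn1] := eqVneq d n1; have d0 : (0 < d)%N by apply: dvdn_gt0 dn.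
have : zeta ^+ d = 1.
  have /(congr1 (fun q => (map_poly intr q : {poly Zp}).[zeta])) := prod_Cyclotomic d0.
  rewrite rmorph_prod horner_prod (big_rem d) -?dvdn_divisors //= e mul0r.
  rewrite rmorphB rmorph1 /= map_polyXn hornerD hornerN hornerXn hornerC => /esym/eqP.
  by rewrite subr_eq0 => /eqP.
move/eqP; rewrite -(prim_order_dvd prim_zeta) => nd; case/eqP: dn1.
by apply/eqP; rewrite eqn_dvd dn nd.
Qed.

(* The norm of g(zeta) is an integer divisible by p^n and smaller than p^n. *)
Lemma norm_bound h (j : 'I_h -> int) (B n : nat) :
  (forall k, `|j k| <= B%:Z) -> ((h * B) ^ totient n1 < p ^ n)%N ->
  (\sum_(k < h) zeta ^+ k *~ j k) n = 0%N -> \sum_(k < h) zeta ^+ k *~ j k = 0.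
Proof.
move=> jB hB; have n1_gt0 := prim_order_gt0 prim_zeta.
pose g : {poly int} := \sum_(k < h) j k *: 'X^k.
have gE (R : comNzRingType) (x : R) : (map_poly intr g).[x] = \sum_(k < h) x ^+ k *~ j k.
  rewrite rmorph_sum horner_sum; apply: eq_bigr => k _.
  by rewrite /= map_polyZ map_polyXn hornerZ hornerXn mulrzl.
rewrite -!gE; set m := totient n1 in hB *.
have sP : size 'Phi_n1 = m.+1 by rewrite size_Cyclotomic.
have m_gt0 : (0 < m)%N by rewrite totient_gt0.
have [w prim_w] := C_prim_root_exists n1_gt0.
pose rs := [seq w ^+ i | i : 'I_n1 in [pred i : 'I_n1 | coprime i n1]].
have PhiE : map_poly intr 'Phi_n1 = \prod_(r <- rs) ('X - r%:P).
  by rewrite (Cintr_Cyclotomic prim_w) /cyclotomic big_image.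
have srs : size rs == m.
  have := congr1 (fun q : {poly algC} => size q) PhiE.
  by rewrite (Cintr_Cyclotomic prim_w) size_cyclotomic size_prod_XsubC => /succn_inj <-.
have urs : uniq rs.
  rewrite map_inj_in_uniq ?enum_uniq // => x y _ _ /eqP.
  by rewrite (eq_prim_root_expr prim_w) !modn_small // => /eqP/val_inj.
have det_eq := @det_mult_mx_roots 'Phi_n1 g m (Tuple srs) (Cyclotomic_monic n1) sP urs.
have {det_eq} := det_eq _; set D := \det _ => /= det_eq.
have rsr r : r \in rs -> root (map_poly intr 'Phi_n1) r.
  by rewrite PhiE root_prod_XsubC.
have {}det_eq : D%:~R = \prod_(r <- rs) (map_poly intr g).[r].
  by apply: det_eq => r /rsr /rootP.
have rs1 r : r \in rs -> `|r| = 1.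
  move=> /mapP [i _ ->]; rewrite normrX.
  have /eqP : `|w| ^+ n1 = 1 by rewrite -normrX (prim_expr_order prim_w) normr1.
  by rewrite pexpr_eq1 // => /eqP ->; rewrite expr1n.
(* Each of the [totient n1] conjugates of [g(zeta)] is a sum of [h] terms of absolute value at most
   [B]. *)
have Dbound : (`|D| <= (h * B) ^ m)%N.
  rewrite -(ler_nat algC) natr_absz intr_norm det_eq normr_prod natrX.
  have -> : (h * B)%:R ^+ m = \prod_(r <- rs) (h * B)%:R :> algC.
    by rewrite big_tnth prodr_const card_ord (eqP srs).
  rewrite !big_seq; apply: ler_prod => r rrs; rewrite normr_ge0 /= gE.
  apply: le_trans (ler_norm_sum _ _ _) _; rewrite natrM mulr_natl.
  rewrite -[X in _ *+ X]card_ord -sumr_const; apply: ler_sum => k _.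
  rewrite -mulrzr normrM normrX rs1 // expr1n mul1r -intr_norm.
  by rewrite -[B%:R]/(B%:Z%:~R) ler_int.
move=> gz.
have D0 : D = 0.
  have [u eu] := det_mult_mx g (Cyclotomic_monic n1) sP m_gt0 Phi_root.
  apply/eqP; rewrite -absz_eq0; apply: contraT; rewrite -lt0n => D_gt0.
  have : (p ^ n %| `|D|)%N.
    have : ((`|D|%N)%:R : Zp) n = 0%N.
      have [e|e] : (`|D|%N)%:R = D%:~R :> Zp \/ (`|D|%N)%:R = - D%:~R :> Zp.
        case: D {det_eq Dbound eu D_gt0} => k /=; first by left.
        by right; rewrite NegzE mulrNz opprK.
      by rewrite e eu digitsM gz mul0n mod0n.
      by rewrite e eu -mulrN digitsM gz mul0n mod0n.
    by rewrite digits_nat => /eqP.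
  by move/(dvdn_leq D_gt0); rewrite leqNgt (leq_ltn_trans Dbound hB).
have [r rrs gr] : exists2 r, r \in rs & (map_poly intr g).[r] = 0.
  have /eqP := det_eq; rewrite D0 eq_sym prodf_seq_eq0 => /hasP [r rrs /eqP gr].
  by exists r.
(* [g] vanishes at one complex primitive root, whose minimal polynomial is ['Phi_n1]; so ['Phi_n1]
   divides [g], and the vanishing passes to the root [zeta] in [Z_p]. *)
pose R := Pdiv.CommonRing.rmodp g 'Phi_n1.
have gD := Pdiv.RingMonic.rdivp_eq (Cyclotomic_monic n1) g; rewrite -/R in gD.
have R0 : R = 0.
  have prim_r : n1.-primitive_root r.
    by rewrite -(root_cyclotomic prim_w) -(Cintr_Cyclotomic prim_w) rsr.
  have [q [eq q_mon qP]] := minCpolyP r.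
  have : root (map_poly ratr (map_poly intr R : {poly rat})) r.
    rewrite -map_poly_comp (eq_map_poly (g := intr)); last by move=> x; rewrite /= ratr_int.
    move: gr; rewrite gD rmorphD rmorphM hornerD hornerM.
    by rewrite (rootP (rsr r rrs)) mulr0 add0r => /rootP.
  rewrite qP => /dvdp_leq qR; apply/eqP; apply: contraT => R0.
  have injQ : injective (intr : int -> rat) by exact: intr_inj.
  have R1 : map_poly intr R != 0 :> {poly rat} by rewrite map_poly_eq0_id0 ?intr_eq0 ?lead_coef_eq0.
  have := qR R1; rewrite (size_map_inj_poly injQ) ?rmorph0 //.
  have -> : size q = size 'Phi_n1.
    rewrite sP -(size_cyclotomic r n1) -(minCpoly_cyclotomic prim_r) eq size_map_inj_poly ?rmorph0 //.
    exact: fmorph_inj.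
  by rewrite leqNgt Pdiv.CommonRing.ltn_rmodp monic_neq0 ?Cyclotomic_monic.
by rewrite gD R0 addr0 rmorphM hornerM Phi_root mulr0.
Qed.
End CyclotomicNorm.

(** * Roots of unity in [Z_p] and their residues *)

Section Teichmuller.
Variables (p : nat) (p_pr : prime p).
Local Notation Zp := (padic_int p_pr).

Definition resF (z : Zp) : 'F_p := (z 1%N)%:R.

Lemma resF_natr n : (n %% p)%:R = n%:R :> 'F_p.
Proof. by rewrite [in RHS](divn_eq n p) natrD natrM pchar_Fp_0 // mulr0 add0r. Qed.
Fact resF_zmod : zmod_morphism resF.
Proof.
move=> x y; apply/eqP; rewrite eq_sym subr_eq -natrD; apply/eqP.
rewrite -[x in LHS](subrK y) /resF digitsD expn1.
by rewrite resF_natr.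
Qed.
Fact resF_monoid : monoid_morphism resF.
Proof.
split.
  rewrite /resF (_ : (1 : Zp) 1%N = (1 %% p ^ 1)%N) ?expn1 ?resF_natr //.
by move=> x y; rewrite /resF digitsM expn1 resF_natr natrM.
Qed.
HB.instance Definition _ := GRing.isZmodMorphism.Build Zp 'F_p resF resF_zmod.
HB.instance Definition _ := GRing.isMonoidMorphism.Build Zp 'F_p resF resF_monoid.

Lemma resF_eq0 z : (resF z == 0) = (z 1%N == 0%N).
Proof.
rewrite /resF -(dvdn_pcharf (pchar_Fp p_pr)) /dvdn.
by have := digits_small z 1; rewrite expn1 => ->.
Qed.
Lemma resF_eq x y : (resF x == resF y) = (x 1%N == y 1%N).
Proof. by rewrite -subr_eq0 -rmorphB resF_eq0 digits_sub0. Qed.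
Lemma resF_unit z : (z \is a GRing.unit) = (resF z != 0).
Proof. by rewrite padic_unit1 resF_eq0. Qed.

(** If [x] and [y] differ, the cofactor of [x - y] in [x^(p-1) - y^(p-1)] vanishes; its residue is
    [(p-1) x^(p-2)], which is not 0. *)
Lemma root_unity_inj (x y : Zp) : x ^+ p.-1 = 1 -> y ^+ p.-1 = 1 ->
  resF x = resF y -> x = y.
Proof.
move=> x1 y1 e; pose s := \sum_(i < p.-1) x ^+ (p.-1.-1 - i) * y ^+ i.
have := subrXX x y p.-1; rewrite x1 y1 subrr => /esym/eqP; rewrite mulf_eq0 subr_eq0.
case/orP => [/eqP //|/eqP s0]; have := congr1 resF s0; rewrite rmorph0 rmorph_sum.
have rx : resF x ^+ p.-1 = 1 by rewrite -rmorphXn x1 rmorph1.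
have p1 : (0 < p.-1)%N by have := prime_gt1 p_pr; lia.
under eq_bigr => i _.
  rewrite rmorphM !rmorphXn /= -e -exprD subnK; last by have := ltn_ord i; lia.
over.
rewrite sumr_const card_ord => /eqP; rewrite -mulr_natl mulf_eq0 -(dvdn_pcharf (pchar_Fp p_pr)).
case/orP => [/dvdn_leq|]; first by have := prime_gt1 p_pr; lia.
rewrite expf_eq0 => /andP[_ /eqP x0]; move: rx; rewrite x0 expr0n gtn_eqF // => /eqP.
Qed.

Lemma resF_teichmuller (a : int) : ~~ (p %| a)%Z -> resF (teichmuller p_pr a) = a%:~R.
Proof.
move=> pa; have [_ [u eu]] := teichmullerP p_pr pa.
have := congr1 resF eu; rewrite rmorphB rmorphM rmorph_nat rmorph_int /=.
by rewrite pchar_Fp_0 // mul0r => /eqP; rewrite subr_eq0 => /eqP.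
Qed.

(** A generator of the multiplicative group of ['F_p] is lifted by [teichmuller]; the order of the
    lift cannot drop, since it is already full modulo [p]. *)
Lemma padic_primitive_root : exists zeta : Zp,
  p.-1.-primitive_root zeta /\ p.-1.-primitive_root (resF zeta).
Proof.
have p1 : (0 < p.-1)%N by have := prime_gt1 p_pr; lia.
have /hasP [g _ prim_g] : has p.-1.-primitive_root (enum [pred x : 'F_p | x != 0]).
  apply: cyclic.has_prim_root => //; first 1 last.
  - exact: enum_uniq.
  - have -> : size (enum [pred x : 'F_p | x != 0]) = #|predC1 (0 : 'F_p)| by rewrite -cardE.
    by rewrite cardC1 card_Fp.
  apply/allP => x; rewrite mem_enum inE unity_rootE => x0.
  apply/eqP/(mulfI x0); rewrite -exprS prednK ?prime_gt0 // mulr1.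
  by have := expf_card x; rewrite card_Fp.
pose z := teichmuller p_pr (val g)%:Z.
have pg : ~~ (p %| (val g)%:Z)%Z.
  apply/negP => pg; have g0 : g = 0.
    by apply/eqP; rewrite -[g]natr_Zp -(dvdn_pcharf (pchar_Fp p_pr)).
  have := prim_expr_order prim_g; rewrite g0 expr0n gtn_eqF // => /eqP.
have [z1 _] := teichmullerP p_pr pg.
have zg : resF z = g by rewrite resF_teichmuller // -pmulrn natr_Zp.
exists z; rewrite zg; split=> //.
have [m prim_z mp] := prim_order_exists p1 z1.
suff -> : p.-1 = m by [].
apply/eqP; rewrite eqn_dvd mp andbT (prim_order_dvd prim_g) -zg -rmorphXn.
by rewrite (prim_expr_order prim_z) rmorph1.
Qed.

End Teichmuller.

(** * The one-variable contradiction *)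

Lemma mulr_prod_sumD1 (R : comNzRingType) (I : finType) (x y E e : I -> R) :
  (forall k, x k * E k = y k) ->
  (\prod_l x l) * (\sum_k e k * E k) = \sum_k e k * (y k * \prod_(l | l != k) x l).
Proof.
move=> h; rewrite mulr_sumr; apply: eq_bigr => k _; rewrite (bigD1 k) //= -h.
by ring.
Qed.

Section Contradiction.
Variables (F : fieldType) (c : nat -> F) (e : nat).
Hypotheses (two_neq0 : 2%:R != 0 :> F) (e_gt0 : (0 < e)%N).
Hypotheses (c_per : forall n, c (n + e)%N = c n) (c1 : c 1%N = 1).

(* num2 / (1 - X^e) = c 0 + 2 \sum_(n > 0) c n X^n *)
Definition num2 : {poly F} :=
  \poly_(i < e) c i + \poly_(i < e.+1) (if i == 0%N then 0 else c i).

(** The expansion of [num2 / (1 - X^e)] at [X^r]; see [gen2E]. *)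
Definition gen2 (r : nat) : {fps F} := fun n =>
  if (r %| n)%N then (if n == 0%N then c 0 else 2%:R * c (n %/ r)%N) else 0.

Lemma gen2E r : (0 < r)%N ->
  fps_poly (1 - 'X^(e * r)) * gen2 r = fps_poly (num2 \Po 'X^r).
Proof.
move=> r0; apply: funext => n.
have -> : (fps_poly (1 - 'X^(e * r)) * gen2 r) n =
    gen2 r n - (if (n < e * r)%N then 0 else gen2 r (n - e * r)%N).
  by rewrite (rmorphB (@fps_poly F)) rmorph1 mulrBl mul1r fpsD fpsN fpsXnM.
rewrite fps_polyE coef_comp_poly_Xn // /gen2.
case: (ltnP n (e * r)) => ner.
  case: ifP => [/dvdnP [m em]|]; last by rewrite subr0.
  have {ner}me : (m < e)%N by move: ner; rewrite em ltn_pmul2r.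
  rewrite em mulnK // coefD !coef_poly me (leqW me : (m < e.+1)%N) subr0.
  rewrite muln_eq0 (gtn_eqF r0) orbF; case: m {em} me => [|m] me /=; first by rewrite addr0.
  by rewrite mulr2n mulrDl mul1r.
rewrite dvdn_subl ?dvdn_mull //.
case: ifP => [/dvdnP [m em]|]; last by rewrite subr0.
have {ner}me : (e <= m)%N by move: ner; rewrite em leq_pmul2r.
rewrite em -mulnBl !mulnK // coefD !coef_poly ltnNge me /= add0r.
rewrite !muln_eq0 (gtn_eqF r0) !orbF ltnS gtn_eqF; last exact: leq_trans me.
have cm : c (m - e)%N = c m by rewrite -{2}(subnK me) c_per.
have [e_lt|m_lt|{}me] := ltngtP e m.
- by rewrite gtn_eqF ?cm ?subrr // subn_gt0.
- by move: m_lt; rewrite ltnNge me.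
have c0 : c 0 = c m by rewrite -cm me subnn.
by rewrite me subnn eqxx c0 mulr2n mulrDl mul1r addrK.
Qed.

(** With denominators cleared, this says that the sum of the [w k * gen2 (r k)] is not a Laurent
    polynomial: the term with the smallest [r k] has coefficients of arbitrarily high index that no
    other term reaches. *)
Lemma no_laurent (I : finType) (r : I -> nat) (w : I -> F) (Z : nat) (D : {poly F}) :
  I -> (forall k, 0 < r k)%N -> injective r -> (forall k, w k != 0) ->
  (\sum_k w k *: ((num2 \Po 'X^(r k)) * \prod_(l | l != k) (1 - 'X^(e * r l)))) * 'X^Z
    <> D * \prod_l (1 - 'X^(e * r l)).
Proof.
move=> i0 r_gt0 r_inj w0 eq.
pose x l : {fps F} := fps_poly (1 - 'X^(e * r l)).
pose G : {fps F} := \sum_k fps_poly (w k)%:P * gen2 (r k).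
have x0 : \prod_l x l != 0.
  apply: fps_prod_neq0 => l _; apply/eqP => /(congr1 (fun G : {fps F} => G 0%N)).
  rewrite fps0 /x fps_polyE coefB coef1 coefXn eqxx.
  rewrite (_ : (0 == e * r l)%N = false); last by rewrite ltn_eqF ?muln_gt0 ?e_gt0 ?r_gt0.
  by apply/eqP; rewrite subr0 oner_eq0.
have eG : fps_poly 'X^Z * G = fps_poly D.
  apply/eqP; rewrite -subr_eq0; apply: contraTT isT => GD0.
  have := fps_mulf_eq0 x0 GD0; rewrite mulrBr.
  rewrite mulrCA /G (mulr_prod_sumD1 _ (y := fun k => fps_poly (num2 \Po 'X^(r k)))); last first.
    by move=> k; apply: gen2E.
  suff -> : fps_poly 'X^Z * (\sum_k fps_poly (w k)%:P *
      (fps_poly (num2 \Po 'X^(r k)) * \prod_(l | l != k) x l)) = \prod_l x l * fps_poly D.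
    by rewrite subrr eqxx.
  rewrite [RHS]mulrC /x -(rmorph_prod (@fps_poly F)) -(rmorphM (@fps_poly F)) -eq.
  rewrite (rmorphM (@fps_poly F)) mulrC; congr (_ * _).
  rewrite (rmorph_sum (@fps_poly F)); apply: eq_bigr => k _.
  rewrite -mul_polyC !(rmorphM (@fps_poly F)); congr (_ * (_ * _)).
  by rewrite (rmorph_prod (@fps_poly F)).
pose k0 := [arg min_(k < i0) r k].
have k0P k : (r k0 <= r k)%N by rewrite /k0; case: arg_minnP => // k' _ /(_ k isT).
(* The index is [r k0] plus a multiple of every [r k], so any [r k] dividing it divides [r k0] and
   equals it by minimality. The quotient by [r k0] is 1 modulo [e], where [c] takes the value 1, and
   the factor [size D] puts [z] beyond the degree of [D]. *)
pose z := (r k0 * (1 + e * ((\prod_k r k) * size D)))%N.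
have zD : (size D <= Z + z)%N.
  have : (0 < \prod_k r k)%N by apply: prodn_gt0.
  move=> P_gt0; rewrite (leq_trans _ (leq_addl _ _)) // /z mulnDr muln1.
  by rewrite (leq_trans _ (leq_addl _ _)) // !mulnA leq_pmull // !muln_gt0 r_gt0 e_gt0 P_gt0.
have /(congr1 (fun G : {fps F} => G (Z + z)%N)) := eG.
rewrite fpsXnM ltnNge leq_addr /= addKn fps_polyE nth_default // /G fps_sum.
rewrite (bigD1 k0) //= fpsCM big1 ?addr0 => [|k kk0].
  rewrite /gen2 /z dvdn_mulr // muln_eq0 (gtn_eqF (r_gt0 _)) /= mulKn //.
  have -> : c (1 + e * ((\prod_k r k) * size D))%N = 1.
    elim: (_ * size D)%N => [|n IH]; first by rewrite muln0.
    by rewrite mulnS (addnC e) addnA c_per.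
  by rewrite mulr1 => /eqP; rewrite mulf_eq0 (negPf (w0 _)) (negPf two_neq0).
rewrite fpsCM /gen2 ifN ?mulr0 //; apply: contra kk0 => rz; apply/eqP/r_inj.
apply/eqP; rewrite eqn_leq k0P andbT dvdn_leq ?r_gt0 //.
move: rz; rewrite /z mulnDr muln1 dvdn_addl // (bigD1 k) //=.
by rewrite -!mulnA; do 2 apply: dvdn_mull; apply: dvdn_mulr.
Qed.

End Contradiction.

(** * Conductors and twists *)

Section Conductors.
Variable F : fieldType.
Implicit Types psi chi : int -> F.

Lemma conductorP (m : nat) psi : (0 < m)%N -> factors_through m psi m ->
  [/\ (conductor m psi %| m)%N, factors_through m psi (conductor m psi) &
      forall f, (f %| m)%N -> factors_through m psi f -> (conductor m psi <= f)%N].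
Proof.
move=> m0 mm; rewrite /conductor; set s := [seq _ <- _ | _].
have inS f : (f \in s) = `[< factors_through m psi f >] && (f %| m)%N.
  by rewrite mem_filter dvdn_divisors.
have ms : m \in s by rewrite inS dvdnn andbT; apply/asboolP.
have ss : sorted leq s by apply: sorted_filter; [exact: leq_trans|exact: sorted_divisors].
case: s inS ms ss => [//|x s] inS _ /= ss.
have := inS x; rewrite mem_head => /esym/andP[/asboolP xm xd]; split=> // f fm ff.
have : f \in x :: s by rewrite inS fm andbT; apply/asboolP.
rewrite inE => /predU1P [-> //|fs].
by have /allP := order_path_min leq_trans ss; apply.
Qed.

Lemma coprimez_mod (a b : int) (m : nat) : (a = b %[mod m])%Z -> coprimez a m = coprimez b m.
Proof. by move=> e; rewrite /coprimez -gcdz_modl e gcdz_modl. Qed.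

Lemma coprimez_dvdr (a : int) (f m : nat) : (f %| m)%N -> coprimez a m -> coprimez a f.
Proof. by move=> fm; rewrite !coprimezE !absz_nat; apply: coprime_dvdr. Qed.

Lemma coprimezM (a : int) (u v : nat) : coprimez a (u * v)%N = coprimez a u && coprimez a v.
Proof. by rewrite !coprimezE !absz_nat coprimeMr. Qed.

Lemma coprime_lift (f m : nat) (a : int) : (0 < m)%N -> (f %| m)%N -> coprimez a f ->
  exists b : int, coprimez b m /\ (b = a %[mod f])%Z.
Proof.
move=> m0 fm af; have [a0|a0] := eqVneq a 0.
  exists 1; rewrite /coprimez gcd1z; split=> //.
  move: af; rewrite a0 /coprimez gcd0z absz_nat => /eqP [->].
  by rewrite !modz1.
(* [t] collects the primes of [m] that do not divide [a], so a prime of [m] divides exactly one of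
   [t] and [a]; it could divide [f t + a] only by dividing both [f] and [a]. *)
pose t := (m`_(\pi(`|a|%N)^'))%N.
exists (f%:Z * t%:Z + a); split; last by rewrite mulrC modzMDl.
rewrite coprimezE absz_nat; apply: contraT => nc.
have [l l_pr /andP[lb lm]] : exists2 l, prime l & (l %| `|(f%:Z * t%:Z + a)%R|)%N && (l %| m)%N.
  exists (pdiv (gcdn `|(f%:Z * t%:Z + a)%R| m)).
    apply: pdiv_prime; rewrite ltn_neqAle eq_sym nc gcdn_gt0 m0 orbT //.
  by rewrite -dvdn_gcd pdiv_dvd.
have lt : (l %| t)%N = (l \notin \pi(`|a|%N)).
  have := pi_of_part (\pi(`|a|%N)^') m0 l; rewrite !inE !mem_primes part_gt0 m0 lm l_pr /=.
  by [].
have lbz : (l %| f%:Z * t%:Z + a)%Z by rewrite dvdzE absz_nat.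
have [la|la] := boolP (l %| `|a|)%N.
  have : (l %| f%:Z * t%:Z)%Z by rewrite -(rpredDr _ (_ : a \in dvdz l)) // dvdzE absz_nat.
  rewrite -PoszM dvdzE !absz_nat Euclid_dvdM // lt mem_primes l_pr absz_gt0 a0 la /= orbF => lf.
  move: af; rewrite coprimezE absz_nat => /(coprime_dvdr lf).
  by rewrite coprime_sym prime_coprime // la.
have : (l %| a)%Z.
  rewrite -(rpredDl _ (_ : f%:Z * t%:Z \in dvdz l)) // -PoszM dvdzE !absz_nat.
  by rewrite dvdn_mull // lt mem_primes (negPf la) !andbF.
by rewrite dvdzE absz_nat (negPf la).
Qed.

(** Bezout provides [c] congruent to [a] modulo [f] and to [b] modulo [m], whence
    [psi a = psi c = psi b]; the second congruence also makes [c] prime to [m]. *)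
Lemma factors_gcd (m f : nat) psi : factors_through m psi m -> factors_through m psi f ->
  factors_through m psi (gcdn f m).
Proof.
move=> pm pf a b am bm /eqP; rewrite eqz_mod_dvd => /dvdzP [t et].
have [u [v euv]] := Bezoutz f m; rewrite -[gcdz _ _]/(gcdn f m)%:Z in euv.
pose c := a - f%:Z * (u * t).
have cb : (c = b %[mod m])%Z.
  apply/eqP; rewrite eqz_mod_dvd; apply/dvdzP; exists (v * t).
  transitivity (a - b - u * f * t); first by rewrite /c; ring.
  by rewrite et -euv; ring.
have ca : (c = a %[mod f])%Z.
  apply/eqP; rewrite eqz_mod_dvd; apply/dvdzP; exists (- (u * t)).
  by rewrite /c; ring.
have cm : coprimez c m by rewrite (coprimez_mod cb).
by rewrite -(pf _ _ cm am ca); apply: pm.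
Qed.

Lemma dirichlet_factors m chi : dirichlet_char m chi -> factors_through m chi m.
Proof.
move=> [m0 _ per _] a b _ _ /eqP; rewrite eqz_mod_dvd => /dvdzP [t et].
have perMn (n : nat) x : chi (x + n%:Z * m%:Z) = chi x.
  elim: n => [|n IH]; first by rewrite mul0r addr0.
  by rewrite -[n.+1]addn1 PoszD mulrDl mul1r addrA per IH.
have {et} -> : a = b + t * m%:Z by rewrite -et addrC subrK.
case: t => t; first by rewrite perMn.
by rewrite -(perMn t.+1) NegzE mulNr subrK.
Qed.

Lemma dirichlet_mod m chi (a b : int) : dirichlet_char m chi -> (a = b %[mod m])%Z -> chi a = chi b.
Proof.
move=> dc e; have [am|am] := boolP (coprimez a m).
  by apply: (dirichlet_factors dc) => //; rewrite -(coprimez_mod e).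
have [_ _ _ nz] := dc; have bm : ~~ coprimez b m by rewrite -(coprimez_mod e).
by move: am bm; rewrite -!nz !negbK => /eqP -> /eqP ->.
Qed.

Lemma dirichlet1 m chi : dirichlet_char m chi -> chi 1 = 1.
Proof.
move=> [m0 mul _ nz]; have c1 : chi 1 != 0 by rewrite nz /coprimez gcd1z.
by apply: (mulfI c1); rewrite -mul !mulr1.
Qed.

Lemma primitive_factors m chi (f : nat) : primitive_char m chi -> factors_through m chi f -> (m %| f)%N.
Proof.
move=> [dc cm] ff; have [m0 _ _ _] := dc; have mm := dirichlet_factors dc.
have [_ _] := conductorP m0 mm; rewrite cm => /(_ _ (dvdn_gcdr f m) (factors_gcd mm ff)) le.
have -> : m = gcdn f m; last exact: dvdn_gcdl.
by apply/eqP; rewrite eqn_leq le dvdn_leq // dvdn_gcdr.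
Qed.

Lemma primitive_ofE m psi (a : int) : (0 < m)%N -> factors_through m psi m ->
  coprimez a (conductor m psi) -> exists b, [/\ coprimez b m, (b = a %[mod conductor m psi])%Z
    & primitive_of m psi a = psi b].
Proof.
move=> m0 mm ac; have [cd cf _] := conductorP m0 mm; rewrite /primitive_of ac.
have ex := coprime_lift m0 cd ac.
have [] := xgetPex 0 (P := [set b : int | coprimez b m /\ (b = a %[mod conductor m psi])%Z]) ex.
by set b := xget _ _ => bm ba; exists b.
Qed.

Lemma primitive_of_coprime m psi (a : int) : (0 < m)%N -> factors_through m psi m ->
  coprimez a m -> primitive_of m psi a = psi a.
Proof.
move=> m0 mm am; have [cd cf _] := conductorP m0 mm.
have [b [bm ba ->]] := primitive_ofE m0 mm (coprimez_dvdr cd am).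
exact: cf.
Qed.

Lemma primitive_dvd d p chi (f : nat) : primitive_char d chi -> (0 < p)%N -> coprime d p ->
  (f %| d * p ^ 2)%N ->
  (forall a b : int, coprimez a (d * p)%N -> coprimez b (d * p)%N ->
     (a = 1 %[mod p])%Z -> (b = 1 %[mod p])%Z -> (a = b %[mod f])%Z -> chi a = chi b) ->
  (d %| f)%N.
Proof.
move=> chi_prim p0 dp fd H; have [dc _] := chi_prim.
have cop : coprimez d%:Z (p ^ 2)%N by rewrite coprimezE !absz_nat coprimeXr.
suff /(primitive_factors chi_prim) : factors_through d chi (gcdn f d).
  by move/dvdn_trans; apply; apply: dvdn_gcdl.
move=> a b ad bd ab.
pose lift (x : int) := zchinese d%:Z (p ^ 2)%N x 1.
have l1 x : (lift x = x %[mod d])%Z by apply: zchinese_modl.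
have l2 x : (lift x = 1 %[mod (p ^ 2)%N])%Z by apply: zchinese_modr.
have l3 x : (lift x = 1 %[mod p])%Z.
  have := l2 x; move/eqP; rewrite eqz_mod_dvd => h; apply/eqP; rewrite eqz_mod_dvd.
  by apply: dvdz_trans h; rewrite dvdzE !absz_nat expnS dvdn_mulr.
have l4 x : coprimez x d -> coprimez (lift x) (d * p)%N.
  by move=> xd; rewrite coprimezM (coprimez_mod (l1 x)) xd (coprimez_mod (l3 x)) /coprimez gcd1z.
rewrite -(dirichlet_mod dc (l1 a)) -(dirichlet_mod dc (l1 b)).
apply: H => //; try exact: l4.
apply/eqP; rewrite eqz_mod_dvd; apply: (@dvdz_trans (gcdn f d * p ^ 2)%N).
  rewrite dvdzE !absz_nat; have : (f %| gcdn (d * p ^ 2) (f * p ^ 2))%N.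
    by rewrite dvdn_gcd fd dvdn_mulr.
  by rewrite -muln_gcdl gcdnC.
rewrite dvdzE !absz_nat Gauss_dvd; last by rewrite (coprime_dvdl (dvdn_gcdr f d)) // coprimeXr.
apply/andP; split.
  have : ((gcdn f d)%:Z %| (lift a - a) + (a - b) - (lift b - b))%Z.
    apply: rpredB; first apply: rpredD.
    - apply: (@dvdz_trans d); first by rewrite dvdzE !absz_nat dvdn_gcdr.
      by rewrite -eqz_mod_dvd; apply/eqP.
    - by rewrite -eqz_mod_dvd; apply/eqP.
    - apply: (@dvdz_trans d); first by rewrite dvdzE !absz_nat dvdn_gcdr.
      by rewrite -eqz_mod_dvd; apply/eqP.
  by rewrite dvdzE absz_nat; congr (_ %| `|_|)%N; ring.
have : ((p ^ 2)%N%:Z %| (lift a - 1) - (lift b - 1))%Z.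
  by rewrite rpredB // -eqz_mod_dvd; apply/eqP.
by rewrite dvdzE absz_nat; congr (_ %| `|_|)%N; ring.
Qed.
End Conductors.

(** * The twists of [theta] by powers of [omega] *)

Section Twist.
Variables (p : nat) (p_pr : prime p) (p_odd : odd p).
Variables (d : nat) (d_gt0 : (0 < d)%N) (p_ndvd_d : ~~ (p %| d)%N).
Variables (K : fieldExtType (padic_field p_pr)).
Variables (chi : int -> K) (chi_prim : primitive_char d chi).
Variables (k : nat) (m : nat) (theta : int -> K) (theta_prim : primitive_char m theta).
Hypothesis theta_chi : forall a : int,
  theta a = primitive_of (d * p) (twist chi k%:Z) a.

Lemma teichmuller_mod (a b : int) : (a = b %[mod p])%Z -> teichmuller p_pr a = teichmuller p_pr b.
Proof.
move/eqP; rewrite eqz_mod_dvd => /dvdzP [t et]; rewrite /teichmuller; congr (xget 0 _).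
apply/predeqP => z; rewrite /mkset; have e : a%:~R = b%:~R + p%:R * t%:~R :> padic_int p_pr.
  apply/eqP; rewrite addrC -subr_eq -rmorphB et rmorphM /= mulrC.
  by rewrite -[p%:~R]/(p%:R).
split=> -[z1 [u eu]]; split=> //.
  by exists (u - t%:~R); rewrite mulrBr -eu e; ring.
by exists (u + t%:~R); rewrite mulrDr -eu e; ring.
Qed.

Lemma coprimezp (a : int) : coprimez a p = ~~ (p %| a)%Z.
Proof. by rewrite coprimezE coprime_sym absz_nat prime_coprime // dvdzE absz_nat. Qed.

Lemma teichmuller_char_mod (l : int) (a b : int) : (a = b %[mod p])%Z ->
  teichmuller_char K l a = teichmuller_char K l b.
Proof.
move=> e; rewrite /teichmuller_char (teichmuller_mod e).
by have := coprimez_mod e; rewrite !coprimezp => /negb_inj ->.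
Qed.

Let cdp : coprime d p. Proof. by rewrite coprime_sym prime_coprime. Qed.
Let dp_gt0 : (0 < d * p)%N. Proof. by rewrite muln_gt0 d_gt0 prime_gt0. Qed.

Lemma eqz_mod_dvdn (a b : int) (f g : nat) : (f %| g)%N -> (a = b %[mod g])%Z -> (a = b %[mod f])%Z.
Proof.
move=> fg /eqP; rewrite eqz_mod_dvd => h; apply/eqP; rewrite eqz_mod_dvd.
by apply: dvdz_trans h; rewrite dvdzE !absz_nat.
Qed.

Let psi1 := twist chi k%:Z.
Let psi1_mod : factors_through (d * p) psi1 (d * p).
Proof.
move=> a b _ _ ab; rewrite /psi1 /twist; congr (_ * _).
  by apply: (dirichlet_mod (proj1 chi_prim)); apply: eqz_mod_dvdn ab; apply: dvdn_mulr.
by apply: teichmuller_char_mod; apply: eqz_mod_dvdn ab; apply: dvdn_mull.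
Qed.

Lemma theta_coprime (a : int) : coprimez a (d * p)%N -> theta a = psi1 a.
Proof. by move=> ac; rewrite theta_chi primitive_of_coprime. Qed.

Lemma tc_neq0 (l : int) (a : int) : coprimez a p -> teichmuller_char K l a != 0.
Proof.
rewrite coprimezp /teichmuller_char => pa; rewrite (negPf pa) expfz_neq0 //.
have [t1 _] := teichmullerP p_pr pa.
rewrite -(rmorph0 (@padic_emb p p_pr K)) (inj_eq (@padic_emb_inj p p_pr K)).
apply/eqP => t0; move: t1; rewrite t0 expr0n gtn_eqF; first by move/eqP; rewrite eq_sym oner_eq0.
by have := prime_gt1 p_pr; lia.
Qed.

Lemma psi1_neq0 (a : int) : coprimez a (d * p)%N -> psi1 a != 0.
Proof.
rewrite coprimezM => /andP[ad ap]; rewrite /psi1 /twist mulf_neq0 ?tc_neq0 //.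
by have [[_ _ _ ->] _] := chi_prim.
Qed.

Lemma theta_unit (a : int) : coprimez a m = coprimez a (conductor (d * p) psi1).
Proof.
have [[_ _ _ <-] _] := theta_prim; rewrite theta_chi.
have [ac|ac] := boolP (coprimez a (conductor (d * p) psi1)).
  have [b [bm _ ->]] := primitive_ofE dp_gt0 psi1_mod ac; exact: psi1_neq0.
by rewrite /primitive_of -/psi1 (negPf ac) eqxx.
Qed.

(** [theta] comes with its own modulus [m]; being primitive, it must have the conductor of the twist
    of [chi] as its modulus. *)
Lemma modulus_eq : m = conductor (d * p) psi1.
Proof.
have [dct cm] := theta_prim; have [m0 _ _ _] := dct.
have [f1d f1f f1min] := conductorP dp_gt0 psi1_mod; set f1 := conductor _ _ in f1d f1f f1min *.
have mf1 : (m %| f1)%N.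
  apply: (primitive_factors theta_prim) => a b am bm ab; rewrite !theta_chi.
  move: am bm; rewrite !theta_unit => am bm.
  have [a' [am' a1 ->]] := primitive_ofE dp_gt0 psi1_mod am.
  have [b' [bm' b1 ->]] := primitive_ofE dp_gt0 psi1_mod bm.
  by apply: f1f => //; rewrite a1 b1.
have : (f1 <= gcdn m (d * p))%N.
  apply: f1min; first exact: dvdn_gcdr.
  apply: factors_gcd => // a b ac bc ab; rewrite -!theta_coprime //.
  by apply: (dirichlet_mod dct).
rewrite (gcdn_idPl (dvdn_trans mf1 f1d)) => le.
by apply/eqP; rewrite eqn_leq le andbT dvdn_leq // (dvdn_gt0 dp_gt0).
Qed.

Lemma tc_1 (l : int) (a : int) : (a = 1 %[mod p])%Z -> teichmuller_char K l a = teichmuller_char K l 1.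
Proof. exact: teichmuller_char_mod. Qed.

Lemma d_dvd_m : (d %| m)%N.
Proof.
have [f1d f1f _] := conductorP dp_gt0 psi1_mod.
rewrite modulus_eq; apply: (primitive_dvd chi_prim (prime_gt0 p_pr) cdp).
  by apply: dvdn_trans f1d _; rewrite dvdn_mul // expnS dvdn_mulr.
move=> a b ac bc a1 b1 /(f1f _ _ ac bc); rewrite /psi1 /twist (tc_1 _ a1) (tc_1 _ b1).
by apply: mulIf; apply: tc_neq0; rewrite /coprimez gcd1z.
Qed.

Lemma m_dvd_dp : (m %| d * p)%N.
Proof. by rewrite modulus_eq; have [] := conductorP dp_gt0 psi1_mod. Qed.

Let mp_coprime (a : int) : coprimez a (m * p)%N = coprimez a (d * p)%N.
Proof.
apply/idP/idP; first by apply: coprimez_dvdr; rewrite dvdn_mul ?d_dvd_m.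
move=> ac; rewrite coprimezM (coprimez_dvdr m_dvd_dp ac) /=.
by move: ac; rewrite coprimezM => /andP[].
Qed.

Section Exponent.
Variable n : nat.
Hypothesis kn : k = n %[mod p.-1].
Let psi0 := twist theta (- n%:Z).

(** For [n] in the class of [k] the two powers of [omega] cancel, so the twist of [theta] in the
    definition of [L] gives back [chi]. *)
Lemma psi0E (a : int) : coprimez a (d * p)%N -> psi0 a = chi a.
Proof.
move=> ac; rewrite /psi0 /twist theta_coprime // /psi1 /twist -mulrA.
move: ac; rewrite coprimezM => /andP[_]; rewrite coprimezp => pa.
rewrite /teichmuller_char (negPf pa).
have [t1 _] := teichmullerP p_pr pa.
set t := padic_emb K _; have {}t1 : t ^+ p.-1 = 1 by rewrite /t -rmorphXn t1 rmorph1.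
have tmod j : t ^+ j = t ^+ (j %% p.-1).
  by rewrite {1}(divn_eq j p.-1) exprD mulnC exprM t1 expr1n mul1r.
have t0 : t != 0.
  apply: contra_eq_neq t1 => ->; rewrite expr0n gtn_eqF ?(eq_sym 0) ?oner_neq0 //.
  by have := prime_gt1 p_pr; lia.
rewrite -exprnN -exprnP (tmod k) kn -tmod mulfV ?mulr1 // expf_neq0 //.
Qed.

Let mp_gt0 : (0 < m * p)%N.
Proof. by have [[m0 _ _ _] _] := theta_prim; rewrite muln_gt0 m0 prime_gt0. Qed.

Let psi0_mod : factors_through (m * p) psi0 d.
Proof.
move=> a b; rewrite !mp_coprime => ac bc; rewrite !psi0E //.
exact: (dirichlet_mod (proj1 chi_prim)).
Qed.

Lemma conductor_twist : conductor (m * p) psi0 = d.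
Proof.
have dmp : (d %| m * p)%N by rewrite dvdn_mulr // d_dvd_m.
have mm : factors_through (m * p) psi0 (m * p).
  by move=> a b ac bc /(eqz_mod_dvdn dmp); apply: psi0_mod.
have [fd ff fmin] := conductorP mp_gt0 mm; set f := conductor _ _ in fd ff fmin *.
apply/eqP; rewrite eqn_leq fmin //= dvdn_leq ?(dvdn_gt0 mp_gt0) //.
apply: (primitive_dvd chi_prim (prime_gt0 p_pr) cdp).
  by apply: dvdn_trans fd _; rewrite expnS expn1 mulnA dvdn_mul // m_dvd_dp.
by move=> a b ac bc _ _ /ff; rewrite !mp_coprime !psi0E //; apply.
Qed.

Lemma primitive_of_twist : primitive_of (m * p) psi0 =1 chi.
Proof.
move=> a; have dmp : (d %| m * p)%N by rewrite dvdn_mulr // d_dvd_m.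
have mm : factors_through (m * p) psi0 (m * p).
  by move=> b c bc cc /(eqz_mod_dvdn dmp); apply: psi0_mod.
have [ad|ad] := boolP (coprimez a d).
  have := @primitive_ofE _ _ _ a mp_gt0 mm; rewrite conductor_twist => /(_ ad) [b [bc ba ->]].
  rewrite psi0E ?(dirichlet_mod (proj1 chi_prim) ba) //.
  by rewrite -mp_coprime.
rewrite /primitive_of conductor_twist (negPf ad).
by have [[_ _ _ nz] _] := chi_prim; move: ad; rewrite -nz negbK => /eqP.
Qed.
End Exponent.

(** As [omega(-1) = -1], the evenness of [theta] fixes the parity of [chi]; this sign governs the
    pairing of [x] with [-x] in the measure. *)
Lemma chi_sign : theta (-1) = 1 -> chi (-1) * (-1) ^+ k = 1.
Proof.
have c1 (M : nat) : coprimez (-1) M by rewrite /coprimez gcdNz gcd1z.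
rewrite theta_coprime // /psi1 /twist => e; rewrite -[RHS]e; congr (_ * _).
have p1 : ~~ (p %| -1)%Z by rewrite -coprimezp.
rewrite /teichmuller_char (negPf p1) -exprnP; congr (_ ^+ _).
rewrite -[-1](rmorphN1 (@padic_emb p p_pr K)); congr (padic_emb K _).
have [t1 _] := teichmullerP p_pr p1.
apply: root_unity_inj => //; last by rewrite resF_teichmuller // rmorphN rmorph1.
by rewrite -signr_odd -subn1 oddB ?prime_gt0 // p_odd.
Qed.

(** Read backwards: a non-trivial [theta] excludes [d = 1] with [p - 1] dividing [k], the case in
    which the measure would fail to be integral. *)
Lemma trivial_character : d = 1%N -> (p.-1 %| k)%N -> forall a, coprimez a m -> theta a = 1.
Proof.
move=> d1 pk a; rewrite theta_unit theta_chi => ac.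
have [b [bm _ ->]] := primitive_ofE dp_gt0 psi1_mod ac.
rewrite /psi1 /twist (_ : chi b = 1); last first.
  rewrite -(dirichlet1 (proj1 chi_prim)); apply: (dirichlet_mod (proj1 chi_prim)).
  by rewrite d1 !modz1.
move: bm; rewrite coprimezM => /andP[_]; rewrite coprimezp => pb.
have [t1 _] := teichmullerP p_pr pb.
rewrite mul1r /teichmuller_char (negPf pb) -exprnP -rmorphXn.
by case/dvdnP: pk => q ->; rewrite mulnC exprM t1 expr1n rmorph1.
Qed.
End Twist.

(** * Bernoulli numbers *)

Lemma sum_mul (V : nmodType) (P d : nat) (G : nat -> V) :
  \sum_(i < P * d) G i = \sum_(l < P) \sum_(a < d) G (l * d + a)%N.
Proof.
elim: P => [|P IH]; first by rewrite !big_ord0.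
by rewrite mulSnr big_split_ord /= IH [RHS]big_ord_recr.
Qed.

Lemma bernoulli_polyE n : bernoulli_poly n = \sum_(k < n.+1) ('C(n, k)%:R * bernoulli k) *: 'X^(n - k).
Proof. by []. Qed.

Lemma expr_addn1_sub (R : comNzRingType) (x : R) m :
  (x + 1) ^+ m - x ^+ m = \sum_(j < m) x ^+ j *+ 'C(m, j).
Proof.
rewrite [x + 1]addrC exprDn big_ord_recr /= subnn expr0 mul1r binn mulr1n addrK.
by apply: eq_bigr => j _; rewrite expr1n mul1r.
Qed.

(** After expanding [(x + 1)^(m - k)] and exchanging the sums, the coefficient of [x^j] contains the
    Bernoulli recursion of length [m - j], which vanishes except for [j = n]. *)
Lemma bernoulli_diff n (x : rat) :
  (bernoulli_poly n.+1).[x + 1] - (bernoulli_poly n.+1).[x] = n.+1%:R * x ^+ n.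
Proof.
pose m := n.+1; rewrite -/m.
transitivity (\sum_(k < m) \sum_(j < m | (j < m - k)%N)
    'C(m, k)%:R * bernoulli k * (x ^+ j *+ 'C(m - k, j))).
  rewrite !bernoulli_polyE !horner_sum -sumrB big_ord_recr /= subnn !hornerZ !hornerXn !expr0.
  rewrite subrr addr0; apply: eq_bigr => k _; rewrite !hornerZ !hornerXn -mulrBr.
  rewrite expr_addn1_sub mulr_sumr (big_ord_widen m (fun j => 'C(m, k)%:R * bernoulli k * (x ^+ j *+ 'C(m - k, j)))) //.
  exact: leq_subr.
rewrite (exchange_big_dep predT) //=.
transitivity (\sum_(j < m) 'C(m, j)%:R * x ^+ j * \sum_(k < m - j) 'C(m - j, k)%:R * bernoulli k).
  apply: eq_bigr => j _; rewrite mulr_sumr.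
  rewrite (big_ord_widen m (fun k => 'C(m, j)%:R * x ^+ j * ('C(m - j, k)%:R * bernoulli k))); last exact: leq_subr.
  apply: eq_big => [k|k kj]; first by have := ltn_ord k; have := ltn_ord j; lia.
  have e : ('C(m, k) * 'C(m - k, j) = 'C(m, j) * 'C(m - j, k))%N.
    have kjm : (k + j <= m)%N by have := ltn_ord k; have := ltn_ord j; lia.
    have fp i : (0 < i`!)%N := fact_gt0 i.
    apply/eqP; rewrite -(eqn_pmul2r (fp k)) -(eqn_pmul2r (fp j)) -(eqn_pmul2r (fp (m - k - j)%N)).
    have e1 := @bin_fact m k ltac:(lia); have e2 := @bin_fact (m - k) j ltac:(lia).
    have e3 := @bin_fact m j ltac:(lia); have e4 := @bin_fact (m - j) k ltac:(lia).
    have e5 : (m - j - k = m - k - j)%N by lia.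
    rewrite e5 in e4; apply/eqP.
    transitivity m`!; [rewrite -e1 -e2|rewrite -e3 -e4]; ring.
  rewrite -mulr_natr -[X in X = _]mulrA mulrCA; transitivity (bernoulli k * x ^+ j * ('C(m, k) * 'C(m - k, j))%:R).
    by rewrite natrM; ring.
  by rewrite e natrM; ring.
rewrite big_ord_recr /= big1 ?add0r => [|j _].
  by rewrite subSnn big_ord1 /= bin0 mul1r (_ : bernoulli 0 = 1) // mulr1 binSn.
have := bernoulliP (n - j.+1).+1; rewrite (_ : (n - j.+1).+2 = (m - j)%N); last by have := ltn_ord j; lia.
by move=> ->; rewrite mulr0.
Qed.

Lemma bernoulli_sum n (x : rat) P :
  n.+1%:R * \sum_(l < P) (x + l%:R) ^+ n = (bernoulli_poly n.+1).[x + P%:R] - (bernoulli_poly n.+1).[x].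
Proof.
elim: P => [|P IH]; first by rewrite big_ord0 mulr0 addr0 subrr.
rewrite big_ord_recr /= mulrDr IH -bernoulli_diff -[x + P%:R + 1]addrA natr1; ring.
Qed.

Lemma bernoulli_deriv n : (bernoulli_poly n.+1)^`() = n.+1%:R *: bernoulli_poly n.
Proof.
rewrite !bernoulli_polyE linear_sum big_ord_recr /= subnn derivZ expr0 (derivC 1) scaler0 addr0.
rewrite scaler_sumr; apply: eq_bigr => k _; rewrite derivZ derivXn -scaler_nat !scalerA.
have kn : (k <= n)%N by rewrite -ltnS.
have := mul_bin_down n.+1 k; rewrite subSn //= => e; congr (_ *: _).
by rewrite mulrA -natrM e natrM; ring.
Qed.

Lemma poly_taylor2 (Q : {poly rat}) (x : rat) :
  exists R : {poly rat}, forall y, Q.[x + y] = Q.[x] + y * Q^`().[x] + y ^+ 2 * R.[y].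
Proof.
pose S := Q \Po ('X + x%:P); exists (drop_poly 2 S) => y.
have -> : Q.[x + y] = S.[y] by rewrite horner_comp !hornerE addrC.
rewrite -{1}(poly_take_drop 2 S) hornerD hornerM hornerXn [_ * y ^+ 2]mulrC; congr (_ + _).
have S0 : S`_0 = Q.[x] by rewrite -horner_coef0 horner_comp !hornerE.
have S1 : S`_1 = Q^`().[x].
  have := coef_deriv S 0; rewrite mulr1n => <-; rewrite -horner_coef0.
  by rewrite deriv_comp !hornerE horner_comp !hornerE derivD derivX derivC !hornerE.
rewrite (@horner_coef_wide _ 2) ?size_take_poly // !big_ord_recr big_ord0 /= !coef_take_poly /=.
by rewrite S0 S1 add0r expr0 mulr1 expr1 mulrC.
Qed.

Lemma rat_poly_int (Q : {poly rat}) : exists2 C : nat, (0 < C)%N &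
  forall y : nat, exists z : int, C%:R * Q.[y%:R] = z%:~R.
Proof.
have [q [c c0 ->]] := rat_poly_scale Q.
exists `|c|%N; first by rewrite absz_gt0.
move=> y; rewrite hornerZ -[y%:R]/(y%:Z%:~R) horner_map /=.
case: c c0 => k k0 /=.
  by exists q.[y%:Z]; rewrite mulrA mulfV ?mul1r // pnatr_eq0.
exists (- q.[y%:Z]); rewrite (_ : (Negz k)%:~R = - k.+1%:R) // invrN mulNr mulrN mulrA.
by rewrite mulfV ?mul1r ?mulrNz // pnatr_eq0.
Qed.

(** * Generalized Bernoulli numbers as limits of power sums *)

Section GenBernoulli.
Variables (K : fieldType) (charK : forall n, ((n%:R : K) == 0) = (n == 0%N)).

Lemma ratr_clear (c : nat) (r : rat) (z : int) :
  c%:R * r = z%:~R -> c%:R * ratr r = z%:~R :> K.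
Proof.
move=> e; rewrite /ratr; have d0 : (denq r)%:~R != 0 :> K.
  have := denq_gt0 r; case: (denq r) => // k k0; rewrite charK; by case: k k0.
apply: (mulIf d0); rewrite mulrA divfK //.
have : c%:R * (numq r)%:~R = z%:~R * (denq r)%:~R :> rat.
  by rewrite -e -{2}[r]divq_num_den mulrA divfK // intr_eq0 denq_neq0.
rewrite -[c%:R]/(c%:Z%:~R) -!intrM => /intr_inj e'.
by rewrite -[c%:R]/(c%:Z%:~R) -!intrM e'.
Qed.

Variables (d : nat) (d_gt0 : (0 < d)%N) (chi : int -> K).
Hypothesis chi_per : forall a, chi (a + d%:Z) = chi a.

(** On each class [a] modulo [d] the power sum is a difference of values of [bernoulli_poly n.+1] at
    [a/d] and [a/d + P]; its Taylor expansion in [P] starts with the Bernoulli term and continues in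
    [P^2]. [C] clears denominators uniformly in [P], so [P = p^N] gives a [p]-adic approximation. *)
Lemma gen_bernoulli_sum n : exists2 C : nat, (0 < C)%N &
  forall P : nat, exists z : nat -> int,
    C%:R * \sum_(i < P * d) chi i.+1%:Z * i.+1%:R ^+ n =
    C%:R * (P * d)%:R * gen_bernoulli d chi n +
      P%:R ^+ 2 * \sum_(a < d) chi a.+1%:Z * (z a)%:~R.
Proof.
have step (a : nat) : exists2 C : nat, (0 < C)%N & exists b : int,
    C%:R * (d%:R ^+ n * (bernoulli_poly n).[a%:R / d%:R]) = b%:~R :> rat /\
    forall P : nat, exists z : int,
    C%:Z * \sum_(l < P) (a + d * l)%:Z ^+ n = P%:Z * b + P%:Z ^+ 2 * z.
  have d0 : d%:R != 0 :> rat by rewrite pnatr_eq0 -lt0n.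
  set x := a%:R / d%:R; have [R hR] := poly_taylor2 (bernoulli_poly n.+1) x.
  have [C C0 hC] := rat_poly_int ((d%:R ^+ n / n.+1%:R) *: R).
  have [C' C'0 hC'] := rat_poly_int (d%:R ^+ n * (bernoulli_poly n).[x])%:P.
  exists (C * C')%N; first by rewrite muln_gt0 C0 C'0.
  have [b hb] := hC' 0%N; rewrite hornerC in hb; exists (C%:Z * b); split.
    by rewrite natrM -mulrA hb intrM.
  move=> P; have [z hz] := hC P; exists (C'%:Z * z).
  apply: (@intr_inj rat); rewrite rmorphM rmorph_sum rmorphD !rmorphM /= -hz -hb.
  have := bernoulli_sum n x P; rewrite hR bernoulli_deriv hornerZ.
  set S := \sum_(l < P) _ => e.
  have -> : \sum_(l < P) ((a + d * l)%:Z ^+ n)%:~R = d%:R ^+ n * S :> rat.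
    rewrite mulr_sumr; apply: eq_bigr => l _; rewrite rmorphXn -exprMn /=; congr (_ ^+ _).
    by rewrite -[LHS]/((a + d * l)%:R) natrD natrM mulrDr /x mulrCA divff // mulr1.
  have n0 : n.+1%:R != 0 :> rat by rewrite pnatr_eq0.
  have -> : S = P%:R * (bernoulli_poly n).[x] + P%:R ^+ 2 * R.[P%:R] / n.+1%:R.
    apply: (mulfI n0); rewrite e; move: {e} (n.+1%:R) n0 => N n0; by field.
  rewrite hornerZ -[P%:Z%:~R]/(P%:R) -[C'%:Z%:~R]/(C'%:R) -[C%:Z%:~R]/(C%:R).
  by move: (n.+1%:R) {e} n0 => N n0; field.
have [C hC] := choice (fun a => let: ex_intro2 c c0 h := step a in ex_intro _ c (conj c0 h)).
pose D := (\prod_(a < d) C a.+1)%N.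
have D0 : (0 < D)%N by apply: prodn_gt0 => a; have [] := hC a.+1.
exists D => // P.
have DC (a : 'I_d) : exists q, (D = q * C a.+1)%N.
  exists (\prod_(i < d | i != a) C i.+1)%N; rewrite /D (bigD1 a) //= mulnC.
  by [].
have hz (a : nat) : exists z : int, (a < d)%N ->
    D%:R * \sum_(l < P) (a.+1 + d * l)%:R ^+ n =
    D%:R * P%:R * (d%:R ^+ n * ratr (bernoulli_poly n).[a.+1%:R / d%:R]) + P%:R ^+ 2 * z%:~R :> K.
  case: (ltnP a d) => ad; last by exists 0.
  have [q eq] := DC (Ordinal ad); have [_ [b [hb1 hb2]]] := hC a.+1.
  have [z hz] := hb2 P; exists (q%:Z * z) => _.
  have e1 : (C a.+1)%:R * (d%:R ^+ n * ratr (bernoulli_poly n).[a.+1%:R / d%:R]) = b%:~R :> K.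
    have := @ratr_clear (C a.+1 * d ^ n) (bernoulli_poly n).[a.+1%:R / d%:R] b.
    by rewrite !natrM !natrX -!mulrA; apply.
  have := congr1 (fun w : int => w%:~R : K) hz.
  rewrite rmorphD !rmorphM rmorph_sum /= -e1 => e2.
  rewrite eq /= natrM.
  transitivity (q%:R * ((C a.+1)%:R * \sum_(l < P) ((a.+1 + d * l)%:Z ^+ n)%:~R) : K).
    rewrite mulrA; congr (_ * _); apply: eq_bigr => l _; by rewrite rmorphXn.
  by rewrite e2; ring.
have [z {}hz] := choice hz; exists z.
rewrite (sum_mul P d (fun i => chi i.+1%:Z * i.+1%:R ^+ n)) exchange_big /=.
have chi_perM (l a : nat) : chi (l * d + a).+1%:Z = chi a.+1%:Z.
  elim: l => [//|l IH]; rewrite -IH -[RHS]chi_per; congr (chi _); lia.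
rewrite /gen_bernoulli big_add1 big_mkord /= !mulr_sumr -big_split /=.
apply: eq_bigr => a _.
transitivity (chi a.+1%:Z * (D%:R * \sum_(l < P) (a.+1 + d * l)%:R ^+ n)).
  rewrite mulrCA; congr (_ * _); rewrite mulr_sumr; apply: eq_bigr => l _.
  by rewrite chi_perM; congr (_ * _%:R ^+ _); lia.
rewrite hz //; have d0 : d%:R != 0 :> K by rewrite charK -lt0n.
by rewrite natrM; field.
Qed.
End GenBernoulli.

(** * Powers of kappa *)

Section Reindex.
Variables (p : nat) (p_pr : prime p).
Local Notation Zp := (padic_int p_pr).

Lemma padic_reindex (N : nat) (V : nmodType) (G : Zp -> V) (s : Zp -> Zp) :
  (forall x y : Zp, x N = y N -> G x = G y) ->
  (forall x y : Zp, (s x) N = (s y) N -> x N = y N) ->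
  \sum_(x < p ^ N) G (s x%:R) = \sum_(x < p ^ N) G x%:R.
Proof.
move=> hG hs; pose f (x : 'I_(p ^ N)) : 'I_(p ^ N) := Ordinal (digits_lt (s x%:R) N).
have f_inj : injective f.
  move=> x y [/hs]; rewrite !digits_nat !modn_small // => e; exact: val_inj.
rewrite [RHS](reindex_inj f_inj) /=; apply: eq_bigr => x _; apply: hG.
by rewrite digits_natE.
Qed.

Lemma digits_addI (a x y : Zp) (N : nat) : (x + a) N = (y + a) N -> x N = y N.
Proof.
move/eqP; rewrite -digits_sub0 opprD addrACA subrr addr0 digits_sub0.
by move/eqP.
Qed.

Lemma digits_mulI (u v x y : Zp) (N : nat) : v * u = 1 -> (u * x) N = (u * y) N -> x N = y N.
Proof. by move=> vu /(digitsMl v); rewrite !mulrA vu !mul1r. Qed.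

(* The p lifts of z to level N.+1, spaced by a unit multiple of p^N. *)
Lemma lift_count (N : nat) (z y u v : Zp) : v * u = 1 ->
  \sum_(j < p) ((y N.+1 == (z + p%:R ^+ N * u * j%:R) N.+1) : nat) = (y N == z N).
Proof.
move=> vu; case: eqP => [/padic_eqP [w ->]|yz]; last first.
  rewrite big1 // => j _; case: eqP => // /(digits_le (leqnSn N)) e; case: yz.
  rewrite e; apply/padic_eqP; exists (u * j%:R).
  by rewrite mulrA.
have jlt : ((v * w)%R 1%N < p)%N by have := digits_lt (v * w) 1; rewrite expn1.
have iff (j : 'I_p) : (((z + p%:R ^+ N * w) N.+1 == (z + p%:R ^+ N * u * j%:R) N.+1) : bool) = (j == Ordinal jlt).
  apply/eqP/eqP => [/eqP|->].
    rewrite -digits_sub0 opprD addrACA subrr add0r -mulrA -mulrBr => /eqP/padic_dvdP [q].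
    rewrite exprSr -mulrA => /(mulfI (padic_pX_neq0 _ _)) e.
    apply: val_inj; rewrite -[RHS]/((v * w)%R 1%N).
    have -> : v * w = j%:R + p%:R ^+ 1 * (v * q).
      rewrite mulrCA expr1 -e mulrBr [v * (u * _)]mulrA vu mul1r; ring.
    have /padic_eqP -> : exists t, j%:R + p%:R ^+ 1 * (v * q) = j%:R + p%:R ^+ 1 * t.
      by exists (v * q).
    by rewrite digits_nat expn1 modn_small.
  have /padic_eqP [q eq] : (v * w)%R 1%N = (((v * w)%R 1%N)%:R : Zp) 1%N by rewrite digits_natE.
  apply/padic_eqP; exists (u * q).
  rewrite -[X in _ = _ + _ * X%:R + _]/((v * w)%R 1%N).
  have -> : w = u * (v * w) by rewrite mulrA (mulrC u) vu mul1r.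
  have -> : v * (u * (v * w)) = v * w by rewrite mulrA vu mul1r.
  move: eq; set r := ((v * w)%R 1%N)%:R; move: r => r ->.
  by rewrite expr1 (exprS _ N); ring.
under eq_bigr => j _ do rewrite iff.
by rewrite (bigD1 (Ordinal jlt)) //= eqxx big1 ?addn0 // => j /negPf ->.
Qed.

End Reindex.

Section Kappa.
Variables (p : nat) (p_pr : prime p) (p_odd : odd p).
Local Notation Zp := (padic_int p_pr).
Variables (d : nat) (p_ndvd_d : ~~ (p %| d)%N).
Let kappa : Zp := (1 + p * d)%:R.

(** The cofactor of [p a] is the sum of the [(1 + p a)^i], which is [p] plus [p a] times the sum of
    the [i < p], modulo [p^2]; that sum is divisible by [p] because [p] is odd. *)
Lemma pth_power_sub1 (a : Zp) : exists w,
  (1 + p%:R * a) ^+ p - 1 = p%:R * a * (p%:R * (1 + p%:R * w)).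
Proof.
have exp1 i : exists w, (1 + p%:R * a) ^+ i = 1 + i%:R * (p%:R * a) + p%:R ^+ 2 * w.
  elim: i => [|i [w IH]]; first by exists 0; rewrite expr0; ring.
  exists (w * (1 + p%:R * a) + i%:R * a ^+ 2); rewrite exprSr IH -natr1; ring.
have [f hf] := choice exp1.
have pE : p = (p./2.*2.+1)%N by rewrite -{1}(odd_double_half p) p_odd.
have sumi : \sum_(i < p) i%:R = p%:R * p./2%:R :> Zp.
  rewrite -natr_sum -(big_mkord predT id) -natrM; congr (_%:R); rewrite bin2_sum bin2.
  have -> : (p * p.-1 = (p * p./2).*2)%N by rewrite {2}pE /= -doubleMr.
  by rewrite doubleK.
exists (a * p./2%:R + \sum_(i < p) f i).
have := subrX1 (1 + p%:R * a) p; rewrite addrAC subrr add0r => ->.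
congr (_ * _); under eq_bigr => i _ do rewrite hf.
rewrite !big_split /= sumr_const card_ord -mulr_suml sumi -mulr_sumr; ring.
Qed.

Lemma kappa_pX j : exists u : Zp, u 1%N != 0%N /\ kappa ^+ (p ^ j) = 1 + p%:R ^+ j.+1 * u.
Proof.
elim: j => [|j [u [u1 IH]]].
  exists d%:R; rewrite expr1 /kappa natrD natrM; split=> //.
  by rewrite digits_nat expn1.
rewrite expnSr exprM IH; have [w ew] := pth_power_sub1 (p%:R ^+ j * u).
rewrite mulrA -exprS in ew; exists (u * (1 + p%:R * w)); split.
  have e1 : (1 + p%:R * w) 1%N = (1 : Zp) 1%N by apply/padic_eqP; exists w; rewrite expr1.
  by rewrite -padic_unit1 unitrM !padic_unit1 u1 e1 -padic_unit1 unitr1.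
rewrite -[LHS](subrK 1) ew addrC; congr (1 + _); rewrite [in RHS]exprS; ring.
Qed.

Lemma kappa_pow_mod n a b : a = b %[mod p ^ n] -> (kappa ^+ a) n.+1 = (kappa ^+ b) n.+1.
Proof.
have H q r : (kappa ^+ (q * p ^ n + r)) n.+1 = (kappa ^+ r) n.+1.
  rewrite exprD mulnC exprM; have [u [_ ->]] := kappa_pX n.
  suff e : ((1 + p%:R ^+ n.+1 * u) ^+ q) n.+1 = (1 : Zp) n.+1.
    by rewrite mulrC (digitsMl _ e) mulr1.
  rewrite digitsX; have /padic_eqP -> : exists t, 1 + p%:R ^+ n.+1 * u = 1 + p%:R ^+ n.+1 * t by exists u.
  by rewrite -digitsX expr1n.
by move=> e; rewrite (divn_eq a (p ^ n)) (divn_eq b (p ^ n)) !H e.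
Qed.

Lemma kappa_pow_eq1 (n a : nat) : (kappa ^+ a) n.+1 = (1 : Zp) n.+1 -> (p ^ n %| a)%N.
Proof.
elim: n a => [|n IH] a e; first by rewrite expn0 dvd1n.
have /IH /dvdnP [b eb] := digits_le (leqnSn _) e.
move: e; rewrite eb mulnC exprM; have [u [u1 ->]] := kappa_pX n.
have exp1 i : exists w, (1 + p%:R ^+ n.+1 * u) ^+ i = 1 + p%:R ^+ n.+1 * (i%:R * u + p%:R * w).
  elim: i => [|i [w IHi]]; first by exists 0; rewrite expr0; ring.
  exists (w + p%:R ^+ n * (u * (i%:R * u + p%:R * w))); rewrite exprSr IHi -natr1.
  rewrite exprS; ring.
have [w ->] := exp1 b => /eqP.
rewrite -digits_sub0 addrAC subrr add0r => /eqP/padic_dvdP [t].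
rewrite [p%:R ^+ n.+2]exprSr -[RHS]mulrA => /(mulfI (padic_pX_neq0 _ _)) e.
have : (b%:R * u) 1%N == 0%N.
  by apply/eqP/padic_dvdP; exists (t - w); rewrite expr1 mulrBr -e; ring.
rewrite -[_ == _]negbK -padic_unit1 unitrM !padic_unit1 u1 andbT negbK digits_nat expn1 => pb.
by rewrite expnSr dvdn_mul.
Qed.

Lemma kappa_pow_inj n a b : (kappa ^+ a) n.+1 = (kappa ^+ b) n.+1 -> a = b %[mod p ^ n].
Proof.
wlog ab : a b / (b <= a)%N.
  by move=> H e; case: (leqP b a) => h; [apply: H|apply/esym/H; rewrite // ltnW].
rewrite -{1}(subnK ab) exprD => e.
have ku : kappa ^+ b \is a GRing.unit.
  rewrite unitrX // padic_unit1 digits_nat expn1 -modnDmr modnMr modn_small ?prime_gt1 //.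
apply/eqP; rewrite eqn_mod_dvd //; apply: kappa_pow_eq1.
apply: (@digits_mulI _ _ (kappa ^+ b) (kappa ^+ b)^-1); first exact: mulVr.
by rewrite mulr1 mulrC.
Qed.

Lemma padic_pow_digits (s : Zp) n : (padic_pow d s) n.+1 = (kappa ^+ s n) n.+1.
Proof.
have -> : (padic_pow d s) n.+1 = (kappa ^+ s n.+1) n.+1.
  by rewrite digitsX digits_nat modnXm.
by apply: kappa_pow_mod; apply: digits_modS.
Qed.

(** Exponents modulo [p^n] correspond to powers of [kappa] modulo [p^(n+1)]. This shift is why the
    measure at level [N + 1] is later evaluated at the [kinv y] with [y < p^N]. *)
Lemma padic_pow_eq (s t : Zp) (n : nat) : (padic_pow d s) n.+1 = (padic_pow d t) n.+1 <-> s n = t n.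
Proof.
rewrite !padic_pow_digits; split=> [/kappa_pow_inj|-> //].
by rewrite !digits_small.
Qed.

Lemma padic_pow_inj : injective (@padic_pow p p_pr d).
Proof. by move=> s t e; apply: padicP => n; apply/padic_pow_eq; rewrite e. Qed.

Lemma padic_ext (x y : Zp) : (forall n, x n.+1 = y n.+1) -> x = y.
Proof.
move=> e; apply: padicP => -[|n] //; have := digits_lt x 0; have := digits_lt y 0.
by rewrite expn0; case: (x 0%N) => //; case: (y 0%N).
Qed.

Lemma padic_powD (s t : Zp) : padic_pow d (s + t) = padic_pow d s * padic_pow d t.
Proof.
apply: padic_ext => n; rewrite digitsM !padic_pow_digits -digitsM -exprD.
by apply: kappa_pow_mod; rewrite digitsD modn_mod.
Qed.

Lemma padic_pow0 : padic_pow d (0 : Zp) = 1.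
Proof. by apply: padic_ext => n; rewrite padic_pow_digits digits0 expr0. Qed.

Lemma padic_powMn (s : Zp) k : padic_pow d (s *+ k) = padic_pow d s ^+ k.
Proof. by elim: k => [|k IH]; rewrite ?mulr0n ?padic_pow0 // mulrS exprS padic_powD IH. Qed.

Lemma padic_powNV (s : Zp) : padic_pow d (- s) * padic_pow d s = 1.
Proof. by rewrite -padic_powD addNr padic_pow0. Qed.

Lemma padic_pow1 (s : Zp) : resF (padic_pow d s) = 1.
Proof.
apply/eqP; rewrite -(rmorph1 (@resF p p_pr)) resF_eq padic_pow_digits.
by have := digits_lt s 0; case: (s 0%N).
Qed.

(** Modulo [p^(N+1)] each unit is uniquely a root of unity times a power of [kappa]: reduction
    modulo [p] separates the roots of unity, and surjectivity follows by counting with [totient]. *)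
Lemma units_reindex (zeta : Zp) (N : nat) (V : nmodType) (G : Zp -> V) :
  p.-1.-primitive_root (resF zeta) ->
  (forall x y : Zp, x N.+1 = y N.+1 -> G x = G y) ->
  \sum_(k < p.-1) \sum_(y < p ^ N) G (zeta ^+ k * padic_pow d (- y%:R)) =
  \sum_(x < p ^ N.+1 | ~~ (p %| x)%N) G x%:R.
Proof.
move=> prim hG; rewrite pair_big /=.
pose f (ky : 'I_p.-1 * 'I_(p ^ N)) : 'I_(p ^ N.+1) :=
  Ordinal (digits_lt (zeta ^+ ky.1 * padic_pow d (- ky.2%:R)) N.+1).
have rf (ky : 'I_p.-1 * 'I_(p ^ N)) : resF (zeta ^+ ky.1 * padic_pow d (- ky.2%:R)) = resF zeta ^+ ky.1.
  by rewrite rmorphM rmorphXn /= padic_pow1 mulr1.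
have f_inj : injective f.
  move=> [k y] [l y'] e0.
  have e : (zeta ^+ k * padic_pow d (- y%:R)) N.+1 = (zeta ^+ l * padic_pow d (- y'%:R)) N.+1.
    exact: (congr1 (@nat_of_ord _) e0).
  have kl : k = l.
    have /eqP := digits_le (ltn0Sn N) e; rewrite -resF_eq (rf (k, y)) (rf (l, y')).
    by rewrite (eq_prim_root_expr prim) !modn_small // => /eqP/val_inj.
  have zu : (zeta ^+ l) \is a GRing.unit.
    rewrite resF_unit rmorphXn expf_neq0 //; apply/eqP => z0; move: prim; rewrite z0.
    move/prim_expr_order; rewrite expr0n gtn_eqF //; have := prime_gt1 p_pr; lia.
  move: e; rewrite kl => /(digits_mulI (mulVr zu)) /padic_pow_eq e; congr (_, _).
  have /eqP := e; rewrite -digits_sub0 opprK addrC digits_sub0 !digits_nat !modn_small //.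
  by move/eqP => ?; apply: val_inj.
have fU ky : ~~ (p %| f ky)%N.
  rewrite -[f ky : nat]/((_ : Zp) N.+1); rewrite /dvdn.
  have := digits_small_mod (zeta ^+ ky.1 * padic_pow d (- ky.2%:R)) (ltn0Sn N).
  rewrite expn1 => ->; have := digits_small (zeta ^+ ky.1 * padic_pow d (- ky.2%:R)) 1.
  rewrite expn1 => ->; rewrite -padic_unit1 resF_unit rf expf_neq0 //.
  apply/eqP => z0; move: prim; rewrite z0.
  move/prim_expr_order; rewrite expr0n gtn_eqF //; have := prime_gt1 p_pr; lia.
have img : [set f ky | ky in predT] = [set x : 'I_(p ^ N.+1) | ~~ (p %| x)%N]%SET.
  apply/eqP; rewrite eqEcard; apply/andP; split.
    by apply/fintype.subsetP => _ /imsetP [ky _ ->]; rewrite inE fU.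
  rewrite card_imset // (eq_card (B := {: 'I_p.-1 * 'I_(p ^ N)})) // card_prod !card_ord.
  rewrite -(totient_pfactor p_pr (ltn0Sn N)) totient_count_coprime big_mkord -sum1_card.
  rewrite big_mkcond /=; apply: leq_sum => x _; rewrite inE coprime_sym coprime_pexpr //.
  by rewrite coprime_sym prime_coprime //; case: (p %| x)%N.
rewrite (eq_bigl (fun x => x \in [set x : 'I_(p ^ N.+1) | ~~ (p %| x)%N]%SET)); last first.
  by move=> x; rewrite inE.
rewrite -img big_imset; last by move=> x y _ _; apply: f_inj.
by apply: eq_bigr => ky _; apply: hG; exact/esym/(digits_natE (zeta ^+ ky.1 * padic_pow d (- ky.2%:R))).
Qed.

End Kappa.

(** * The measure *)

Arguments digits : simpl never.

Lemma sum_ord_odd n : odd n -> (\sum_(i < n) i = n * n./2)%N.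
Proof.
move=> n_odd; rewrite -(big_mkord predT id) bin2_sum bin2.
have -> : (n * n.-1 = (n * n./2).*2)%N.
  by rewrite doubleMr; congr (_ * _)%N; rewrite -{1}(odd_double_half n) n_odd.
by rewrite doubleK.
Qed.

Lemma sum_pred_const (V : nmodType) (I : finType) (P : pred I) (F : V) :
  \sum_(j | P j) F = F *+ (\sum_j (P j : nat))%N.
Proof. by rewrite sumr_const -sum1_card big_mkcond; congr (_ *+ _); apply: eq_bigr => j _; rewrite unfold_in; case: (P j). Qed.

Lemma digits_pM (p : nat) (p_pr : prime p) (x : padic_int p_pr) (N : nat) :
  (p%:R * x) N.+1 = (p * x N)%N.
Proof.
by rewrite digitsM digits_nat modnMml expnS -muln_modr digits_modS digits_small.
Qed.

Lemma sum_residues (V : nmodType) (P n r : nat) (G : nat -> V) : (r < P)%N ->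
  \sum_(i < n * P | (i %% P == r)%N) G i = \sum_(l < n) G (l * P + r)%N.
Proof.
move=> rP; rewrite big_mkcond /= (sum_mul n P (fun i => if (i %% P == r)%N then G i else 0)).
apply: eq_bigr => l _; rewrite (bigD1 (Ordinal rP)) //= modnMDl modn_small // eqxx.
rewrite big1 ?addr0 // => a; rewrite -val_eqE /= => /negPf ar.
by rewrite modnMDl modn_small // ar.
Qed.

Lemma periodicMn (T : Type) (c : nat -> T) (d : nat) : (forall i, c (i + d)%N = c i) ->
  forall l i, c (l * d + i)%N = c i.
Proof. by move=> per; elim=> [//|l IH] i; rewrite mulSn -addnA addnC per IH. Qed.

Lemma periodic_mod (T : Type) (c : nat -> T) (d : nat) : (forall i, c (i + d)%N = c i) ->
  forall i, c (i %% d)%N = c i.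
Proof. by move=> per i; rewrite [in RHS](divn_eq i d) periodicMn. Qed.

Lemma sum_period (V : nmodType) (d P r : nat) (c : nat -> V) : (0 < d)%N -> coprime d P ->
  (forall i, c (i + d)%N = c i) -> \sum_(l < d) c (l * P + r)%N = \sum_(l < d) c l.
Proof.
move=> d0 dP per; have lt l : ((l * P + r) %% d < d)%N by rewrite ltn_pmod.
pose f (l : 'I_d) : 'I_d := Ordinal (lt l).
have f_inj : injective f.
  move=> l l' [/eqP]; rewrite eqn_modDr => e; apply: val_inj.
  move: e; wlog ll : l l' / (l' <= l)%N.
    by move=> H e; case: (leqP l' l) => h; [apply: H|apply/esym/H; rewrite ?(ltnW h) // eq_sym].
  rewrite eqn_mod_dvd ?leq_mul2r ?ll ?orbT // -mulnBl Gauss_dvdl // => dl.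
  have : (l - l' == 0)%N by rewrite -leqn0 leqNgt; apply/negP => /(dvdn_leq)/(_ dl); have := ltn_ord l; lia.
  by rewrite subn_eq0 => le; apply/eqP; rewrite eqn_leq ll le.
rewrite [RHS](reindex_inj f_inj) /=; apply: eq_bigr => l _.
by rewrite periodic_mod.
Qed.

Section Congruence.
Variables (p : nat) (p_pr : prime p) (K : fieldExtType (padic_field p_pr)).
Local Notation O := (int_ring K).
Definition eqO (n : nat) (x y : O) := exists u, x - y = p%:R ^+ n * u.
Lemma eqOrefl n x : eqO n x x. Proof. by exists 0; rewrite subrr mulr0. Qed.
Lemma eqOD n x x' y y' : eqO n x x' -> eqO n y y' -> eqO n (x + y) (x' + y').
Proof. by move=> [u eu] [v ev]; exists (u + v); rewrite mulrDr -eu -ev; ring. Qed.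
Lemma eqOMl n a x y : eqO n x y -> eqO n (a * x) (a * y).
Proof. by move=> [u eu]; exists (a * u); rewrite -mulrBr eu mulrCA. Qed.
Lemma eqO_sum n I (r : seq I) (P : pred I) (f g : I -> O) :
  (forall i, P i -> eqO n (f i) (g i)) ->
  eqO n (\sum_(i <- r | P i) f i) (\sum_(i <- r | P i) g i).
Proof. by move=> h; apply: (big_ind2 (eqO n)) => // [|*]; [exact: eqOrefl|exact: eqOD]. Qed.
Lemma eqOtrans n x y z : eqO n x y -> eqO n y z -> eqO n x z.
Proof. by move=> [u eu] [v ev]; exists (u + v); rewrite mulrDr -eu -ev; ring. Qed.
Lemma eqOsym n x y : eqO n x y -> eqO n y x.
Proof. by move=> [u eu]; exists (- u); rewrite mulrN -eu opprB. Qed.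
Lemma eqO_le n m x y : (n <= m)%N -> eqO m x y -> eqO n x y.
Proof.
move=> nm [u eu]; exists (p%:R ^+ (m - n) * u).
by rewrite eu mulrA -exprD subnKC.
Qed.
Lemma eqO_digits n (x : padic_int p_pr) : eqO n (padic_int_emb K x) (x n)%:R.
Proof.
have [t et] : exists t, x = (x n)%:R + p%:R ^+ n * t by apply/padic_eqP; rewrite digits_natE.
exists (padic_int_emb K t); rewrite {1}et rmorphD rmorphM rmorphXn !rmorph_nat.
by rewrite addrAC subrr add0r.
Qed.
Lemma natrO_inj n (x y : O) : (0 < n)%N -> n%:R * x = n%:R * y -> x = y.
Proof. by move=> n0; apply: int_mulfI; rewrite rmorph_nat natrK_eq0 -lt0n. Qed.
End Congruence.

Section Measure.
Variables (p : nat) (p_pr : prime p) (p_odd : odd p).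
Variables (d : nat) (d_gt0 : (0 < d)%N) (p_ndvd_d : ~~ (p %| d)%N).
Variables (K : fieldExtType (padic_field p_pr)).
Local Notation Zp := (padic_int p_pr).
Local Notation O := (int_ring K).
Local Notation emb := (@padic_int_emb p p_pr K).
Variables (zeta zeta' : Zp) (delta : nat).
Hypotheses (zz : zeta' * zeta = 1) (prim_zeta : p.-1.-primitive_root zeta).

(** Up to a multiple of [Csum], this is [d p^N] times the first Bernoulli distribution twisted by
    [c]; the factor keeps it integral. *)
Definition Asum (c : nat -> O) N (x : Zp) : O :=
  \sum_(i < d * p ^ N | (i %% p ^ N == x N)%N) i%:R * c i.
Definition Csum (c : nat -> O) N (x : Zp) : O :=
  \sum_(i < d * p ^ N | (i %% p ^ N == x N)%N) c i.
(** The weighted sum over roots of unity projects to the part on which [zeta] acts by [zeta'^delta];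
    see [betaS_zeta]. *)
Definition betaS (c : nat -> O) N (x : Zp) : O :=
  \sum_(k < p.-1) emb (zeta' ^+ (k * delta)) * Asum c N (zeta' ^+ k * x).

Let p_gt0 : (0 < p)%N. Proof. exact: prime_gt0. Qed.
Let p1_gt0 : (0 < p.-1)%N. Proof. by have := prime_gt1 p_pr; lia. Qed.
Let pX_gt0 N : (0 < p ^ N)%N. Proof. by rewrite expn_gt0 p_gt0. Qed.
Let dpX_gt0 N : (0 < d * p ^ N)%N. Proof. by rewrite muln_gt0 d_gt0 pX_gt0. Qed.

Lemma zetaV_order : zeta' ^+ p.-1 = 1.
Proof. by have := exprMn p.-1 zeta' zeta; rewrite zz expr1n (prim_expr_order prim_zeta) mulr1. Qed.

Lemma zetaV_eq1 m : (zeta' ^+ m == 1) = (p.-1 %| m)%N.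
Proof.
rewrite (prim_order_dvd prim_zeta); have e : zeta' ^+ m * zeta ^+ m = 1 by rewrite -exprMn zz expr1n.
by apply/eqP/eqP => h; move: e; rewrite h ?mul1r ?mulr1.
Qed.

Lemma zetaV_sum0 m : ~~ (p.-1 %| m)%N -> \sum_(k < p.-1) zeta' ^+ (k * m) = 0.
Proof.
rewrite -zetaV_eq1 -subr_eq0 => h; apply: (mulfI h); rewrite mulr0.
under eq_bigr => k _ do rewrite mulnC exprM.
by rewrite -subrX1 -exprM mulnC exprM zetaV_order expr1n subrr.
Qed.

Lemma Asum_mod c N (x y : Zp) : x N = y N -> Asum c N x = Asum c N y.
Proof. by rewrite /Asum => ->. Qed.

Lemma betaS_mod c N (x y : Zp) : x N = y N -> betaS c N x = betaS c N y.
Proof.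
move=> e; apply: eq_bigr => k _; congr (_ * _).
by apply: Asum_mod; apply: digitsMl.
Qed.

Variable c : nat -> O.
Hypotheses (c_per : forall i, c (i + d)%N = c i) (c_mul : forall i, c (p * i)%N = c p * c i).
Let C0 := \sum_(l < d) c l.
Hypotheses (HC1 : C0 = 0 \/ ~~ (p.-1 %| delta.+1)%N) (HC2 : C0 = 0 \/ ~~ (p.-1 %| delta)%N).

Lemma coprime_dpX N : coprime d (p ^ N).
Proof. by rewrite coprimeXr // coprime_sym prime_coprime. Qed.

(** As [d] is prime to [p], a class modulo [p^N] meets each class modulo [d] once in the range of
    summation. *)
Lemma CsumE N x : Csum c N x = C0.
Proof. by rewrite /Csum sum_residues ?digits_lt // sum_period ?coprime_dpX. Qed.

(** Either the sum of [c] over a period is 0, or the roots of unity cancel. The exponent [delta + 1]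
    serves the integrality of [beta], the exponent [delta] its distribution relation. *)
Lemma C0_sum m : (C0 = 0 \/ ~~ (p.-1 %| m)%N) ->
  C0 * \sum_(k < p.-1) emb (zeta' ^+ (k * m)) = 0.
Proof. by case=> [->|/zetaV_sum0 e]; rewrite ?mul0r // -rmorph_sum e rmorph0 mulr0. Qed.

Lemma Asum_eqO N x : eqO N (Asum c N x) (emb x * C0).
Proof.
apply: (@eqOtrans _ _ _ _ _ ((x N)%:R * C0)); last first.
  by rewrite mulrC [emb x * _]mulrC; apply/eqOMl/eqOsym/eqO_digits.
rewrite /Asum (sum_residues d (fun i => i%:R * c i)) ?digits_lt // /C0 -(sum_period (x N) d_gt0 (coprime_dpX N) c_per).
exists (\sum_(l < d) l%:R * c (l * p ^ N + x N)%N); rewrite !mulr_sumr -sumrB.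
by apply: eq_bigr => l _; rewrite -mulrBl natrD addrK natrM natrX; ring.
Qed.

(** Modulo [p^N], [Asum] is linear in [x] with slope [C0], so [betaS] becomes [C0] times a sum of
    roots of unity, which vanishes by [HC1]; [d] is a unit. *)
Lemma beta_exists N x : exists b : O, (d * p ^ N)%:R * b = - betaS c N x.
Proof.
have [y ey] : exists y, betaS c N x = p%:R ^+ N * y.
  suff [y ey] : eqO N (betaS c N x) 0 by exists y; rewrite -ey subr0.
  rewrite -[0](mulr0 (emb x)) -(C0_sum HC1) mulrCA mulr_sumr mulr_sumr.
  apply: eqO_sum => k _.
  rewrite (_ : C0 * _ = emb (zeta' ^+ (k * delta)) * (emb (zeta' ^+ k * x) * C0)).
    exact/eqOMl/Asum_eqO.
  by rewrite rmorphM mulnS exprD rmorphM; ring.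
have du : (d%:R : Zp) \is a GRing.unit by rewrite padic_unit1 digits_nat expn1.
exists (- (emb (d%:R^-1) * y)); rewrite ey natrM natrX.
have := congr1 emb (mulrV du); rewrite rmorphM rmorph_nat rmorph1 => e.
by rewrite mulrN mulrACA e mul1r.
Qed.

Definition beta N x : O := xget 0 [set b : O | (d * p ^ N)%:R * b = - betaS c N x].

Lemma betaE N x : (d * p ^ N)%:R * beta N x = - betaS c N x.
Proof. exact: (xgetPex 0 (P := [set b : O | (d * p ^ N)%:R * b = - betaS c N x])) (beta_exists N x). Qed.

Lemma beta_mod N (x y : Zp) : x N = y N -> beta N x = beta N y.
Proof. by move=> e; rewrite /beta (betaS_mod _ e). Qed.

Lemma betaS_zeta N x : betaS c N (zeta * x) = emb (zeta' ^+ delta) * betaS c N x.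
Proof.
pose G k := emb (zeta' ^+ (k * delta)) * Asum c N (zeta' ^+ k * (zeta * x)).
have GS k : G k.+1 = emb (zeta' ^+ delta) * (emb (zeta' ^+ (k * delta)) * Asum c N (zeta' ^+ k * x)).
  rewrite /G mulSn exprD rmorphM -mulrA; congr (_ * (_ * Asum c N _)).
  by rewrite exprSr -mulrA [zeta' * _]mulrA zz mul1r.
rewrite mulr_sumr /betaS -/(G _); under [RHS]eq_bigr => k _ do rewrite -GS.
rewrite -[LHS]/(\sum_(k < p.-1) G k); case: p.-1 p1_gt0 zetaV_order => // q _ z1.
rewrite big_ord_recl big_ord_recr addrC /=; congr (_ + _).
by rewrite /G mul0n z1 mulnC exprM -exprM mulnC exprM z1 expr1n.
Qed.

Lemma beta_zeta N k x : beta N (zeta ^+ k * x) = emb (zeta' ^+ (k * delta)) * beta N x.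
Proof.
elim: k x => [|k IH] x; first by rewrite mul0n !expr0 rmorph1 !mul1r.
apply: (natrO_inj (dpX_gt0 N)); rewrite exprS -mulrA betaE betaS_zeta -mulrN -betaE IH.
by rewrite mulSn exprD rmorphM; ring.
Qed.

(** All lifts together run over the class of [x] in a range [p] times as long; cut into [p] blocks,
    block [l] is shifted by [l d p^N], which adds a multiple of [C0]. The unit [u] is there because
    the lifts get multiplied by roots of unity and by powers of [kappa]. *)
Lemma Asum_dist N (x u v : Zp) : v * u = 1 ->
  \sum_(j < p) Asum c N.+1 (x + p%:R ^+ N * u * j%:R) =
  p%:R * Asum c N x + (d * p ^ N * (p * p./2))%:R * C0.
Proof.
move=> vu; pose Q := (d * p ^ N)%N.
transitivity (\sum_(i < p * Q | (i %% p ^ N == x N)%N) i%:R * c i).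
  have -> : (p * Q = d * p ^ N.+1)%N by rewrite /Q expnS; lia.
  rewrite /Asum (exchange_big_dep predT) //= [RHS]big_mkcond; apply: eq_bigr => i _.
  rewrite sum_pred_const; have := lift_count N x i%:R vu; rewrite !digits_nat => ->.
  by case: ifP => _; rewrite ?mulr1n ?mulr0n.
rewrite big_mkcond (sum_mul p Q (fun i => if (i %% p ^ N == x N)%N then i%:R * c i else 0)).
transitivity (\sum_(l < p) ((l * Q)%:R * C0 + Asum c N x)).
  apply: eq_bigr => l _; rewrite -(CsumE N x) mulr_sumr -big_split -big_mkcond /=.
  have lQ a : (l * Q + a)%N = (l * p ^ N * d + a)%N by rewrite /Q; lia.
  apply: eq_big => a.
    have -> : (l * Q + a = l * d * p ^ N + a)%N by rewrite /Q mulnA.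
    by rewrite modnMDl.
  by move=> _; rewrite natrD mulrDl lQ (periodicMn c_per).
rewrite big_split /= sumr_const card_ord -mulr_suml addrC mulr_natl; congr (_ + _ * _).
by rewrite -natr_sum -big_distrl /= sum_ord_odd // mulnC.
Qed.

Lemma betaS_dist N (x u v : Zp) : v * u = 1 ->
  \sum_(j < p) betaS c N.+1 (x + p%:R ^+ N * u * j%:R) = p%:R * betaS c N x.
Proof.
move=> vu; rewrite exchange_big /=.
transitivity (\sum_(k < p.-1) (p%:R * (emb (zeta' ^+ (k * delta)) * Asum c N (zeta' ^+ k * x)) +
   (d * p ^ N * (p * p./2))%:R * (C0 * emb (zeta' ^+ (k * delta))))).
  apply: eq_bigr => k _; rewrite -mulr_sumr.
  have e (j : Zp) : zeta' ^+ k * (x + p%:R ^+ N * u * j) = zeta' ^+ k * x + p%:R ^+ N * (zeta' ^+ k * u) * j.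
    by ring.
  under eq_bigr => j _ do rewrite e.
  rewrite (@Asum_dist N _ (zeta' ^+ k * u) (v * zeta ^+ k)); last first.
    have -> : v * zeta ^+ k * (zeta' ^+ k * u) = (v * u) * (zeta' * zeta) ^+ k.
      by rewrite exprMn; ring.
    by rewrite vu zz expr1n mulr1.
  by rewrite mulrDr; ring.
by rewrite big_split /= -!mulr_sumr (C0_sum HC2) mulr0 addr0.
Qed.

Lemma beta_dist N (x u v : Zp) : v * u = 1 ->
  \sum_(j < p) beta N.+1 (x + p%:R ^+ N * u * j%:R) = beta N x.
Proof.
move=> vu; apply: (natrO_inj (dpX_gt0 N.+1)); rewrite mulr_sumr.
under eq_bigr => j _ do rewrite betaE.
by rewrite sumrN (betaS_dist _ _ vu) -mulrN -betaE mulrA -natrM expnS mulnCA.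
Qed.

Lemma Asum_p N (x : Zp) : Asum c N.+1 (p%:R * x) = p%:R * c p * Asum c N x.
Proof.
rewrite /Asum expnSr mulnA big_mkcond /=.
rewrite (sum_mul (d * p ^ N) p (fun i => if (i %% (p ^ N * p) == (p%:R * x : Zp)%R N.+1)%N then i%:R * c i else 0)).
rewrite mulr_sumr [RHS]big_mkcond /=; apply: eq_bigr => l _.
rewrite (bigD1 (Ordinal p_gt0)) //= big1 ?addr0 => [|a].
  rewrite addn0 -muln_modl digits_pM [(p * x N)%N]mulnC eqn_pmul2r //; case: ifP => // _.
  by rewrite [(l * p)%N]mulnC c_mul natrM; ring.
rewrite -val_eqE /= => a0; case: eqP => // e; case/eqP: a0.
have := congr1 (modn^~ p) e; rewrite /= digits_pM modn_dvdm ?dvdn_mull // modnMDl modnMr.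
by rewrite modn_small.
Qed.

Lemma beta_p N (x : Zp) : beta N.+1 (p%:R * x) = c p * beta N x.
Proof.
apply: (natrO_inj (dpX_gt0 N.+1)); rewrite betaE /betaS.
under eq_bigr => k _ do rewrite mulrCA Asum_p mulrCA.
rewrite -mulr_sumr -/(betaS c N x) -mulrN -betaE expnS !natrM; ring.
Qed.

End Measure.

(** * Interpolation *)

Lemma expr_taylor2 (R : comNzRingType) (b t : R) m :
  exists w, (b + t) ^+ m.+1 = b ^+ m.+1 + m.+1%:R * t * b ^+ m + t ^+ 2 * w.
Proof.
elim: m => [|m [w IH]]; first by exists 0; rewrite !expr1 expr0; ring.
exists (m.+1%:R * b ^+ m + w * (b + t)); rewrite exprSr IH -[m.+2%:R]natr1 !exprS.
ring.
Qed.

(** To be read with [X = p^N], [q = p], [Pm = p^m], [n = m + 1], [dd = d], [cp = chi(p)]: [g] is the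
    Riemann sum, [B] the Bernoulli number, [S1] and [S0] the power sums at levels [N + 1] and [N],
    and [u], [z1], [z0] the error terms. *)
Lemma interp_algebra (F : fieldType) (C n dd q X Pm g B cp S1 S0 u z1 z0 : F) : n != 0 ->
  n * (dd * (X * q) * g) + (S1 - cp * (Pm * q) * S0) = (X * q) ^+ 2 * u ->
  C * S1 = C * (X * q * dd) * B + (X * q) ^+ 2 * z1 ->
  C * S0 = C * (X * dd) * B + X ^+ 2 * z0 ->
  X * (C * (n * (dd * q)) * (g - - (1 - cp * Pm) * (B / n))) =
  X * (X * (C * u * q ^+ 2 - z1 * q ^+ 2 + cp * (Pm * q) * z0)).
Proof.
move=> n0 e e1 e0.
transitivity (C * (n * (dd * (X * q) * g)) + C * dd * X * q * (1 - cp * Pm) * B).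
  by field.
have -> : n * (dd * (X * q) * g) = (X * q) ^+ 2 * u - (S1 - cp * (Pm * q) * S0).
  by rewrite -e addrK.
transitivity (C * (X * q) ^+ 2 * u - C * S1 + cp * (Pm * q) * (C * S0) + C * dd * X * q * (1 - cp * Pm) * B).
  by ring.
by rewrite e1 e0; ring.
Qed.

Lemma eqON (p : nat) (p_pr : prime p) (K : fieldExtType (padic_field p_pr)) n (x y : int_ring K) :
  eqO n x y -> eqO n (- x) (- y).
Proof. by move=> [u eu]; exists (- u); rewrite mulrN -eu; ring. Qed.

Section Interpolation.
Variables (p : nat) (p_pr : prime p) (p_odd : odd p).
Variables (d : nat) (d_gt0 : (0 < d)%N) (p_ndvd_d : ~~ (p %| d)%N).
Variables (K : fieldExtType (padic_field p_pr)).
Local Notation Zp := (padic_int p_pr).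
Local Notation O := (int_ring K).
Local Notation emb := (@padic_int_emb p p_pr K).
Variables (zeta zeta' : Zp) (delta : nat).
Hypotheses (zz : zeta' * zeta = 1) (prim_zeta : p.-1.-primitive_root zeta).
Hypothesis (prim_resF : p.-1.-primitive_root (resF zeta)).
Variable c : nat -> O.
Hypotheses (c_per : forall i, c (i + d)%N = c i) (c_mul : forall i, c (p * i)%N = c p * c i).
Let C0 := \sum_(l < d) c l.
Hypotheses (HC1 : C0 = 0 \/ ~~ (p.-1 %| delta.+1)%N) (HC2 : C0 = 0 \/ ~~ (p.-1 %| delta)%N).

Local Notation Beta := (@beta p p_pr d K zeta' delta c).
Definition kinv (y : nat) : Zp := padic_pow d (- y%:R).

Let p_gt0 : (0 < p)%N. Proof. exact: prime_gt0. Qed.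
Let p1_gt0 : (0 < p.-1)%N. Proof. by have := prime_gt1 p_pr; lia. Qed.
Let pX_gt0 N : (0 < p ^ N)%N. Proof. by rewrite expn_gt0 p_gt0. Qed.
Let dpX_gt0 N : (0 < d * p ^ N)%N. Proof. by rewrite muln_gt0 d_gt0 pX_gt0. Qed.

Lemma prim_resFV : p.-1.-primitive_root (resF zeta').
Proof.
have e : resF zeta' * resF zeta = 1 by rewrite -rmorphM zz rmorph1.
have z1 : resF zeta' ^+ p.-1 = 1.
  by have := exprMn p.-1 (resF zeta') (resF zeta); rewrite e expr1n (prim_expr_order prim_resF) mulr1.
have [m prim mp] := prim_order_exists p1_gt0 z1.
suff -> : p.-1 = m by [].
apply/eqP; rewrite eqn_dvd mp andbT (prim_order_dvd prim_resF).
by have := exprMn m (resF zeta') (resF zeta); rewrite e expr1n (prim_expr_order prim) mul1r => <-.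
Qed.

Lemma zetaV_expr i j : i = j %[mod p.-1] -> zeta' ^+ i = zeta' ^+ j.
Proof.
move=> e; rewrite (divn_eq i p.-1) (divn_eq j p.-1) e !exprD ![(_ %/ _ * _)%N]mulnC !exprM.
by rewrite (zetaV_order zz prim_zeta) !expr1n.
Qed.

Lemma emb_expM (z v : Zp) k m : emb (z ^+ k * v) ^+ m = emb (z ^+ (k * m)) * emb v ^+ m.
Proof. by rewrite rmorphM exprMn exprM !rmorphXn. Qed.

Definition units_sum (n N : nat) : O := \sum_(i < d * p ^ N.+1 | ~~ (p %| i)%N) c i * i%:R ^+ n.
(** The Riemann sum of [x^m] over [1 + p Z_p] against the measure. *)
Definition interp (m N : nat) : O := \sum_(y < p ^ N) Beta N.+1 (kinv y) * emb (kinv y) ^+ m.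

(** First-order Taylor expansion: if [i = x] modulo [p^N], then [(m+1) i x^m = i^(m+1) + m x^(m+1)]
    modulo [p^(2N)]. The doubled precision survives the division by [p^N] hidden in [beta]. *)
Lemma Asum_interp m N (x : Zp) :
  eqO (N * 2) (m.+1%:R * (Asum d c N x * emb x ^+ m))
    (\sum_(i < d * p ^ N | (i %% p ^ N == x N)%N) c i * i%:R ^+ m.+1 + m%:R * emb x ^+ m.+1 * C0).
Proof.
rewrite /C0 -(CsumE d_gt0 p_ndvd_d c_per N x) /Asum /Csum mulr_suml !mulr_sumr -big_split /=.
apply: eqO_sum => i /eqP ix.
have [t et] : exists t, i%:R = x + p%:R ^+ N * t by apply/padic_eqP; rewrite digits_nat.
have {}et : i%:R = emb x + p%:R ^+ N * emb t.
  by rewrite -(rmorph_nat emb) et rmorphD rmorphM rmorphXn rmorph_nat.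
have [w ew] := expr_taylor2 (emb x) (p%:R ^+ N * emb t) m.
exists (- (c i * emb t ^+ 2 * w)); rewrite et ew exprM -[m.+1%:R]natr1 !exprS; ring.
Qed.

(** For [m] in the class of [delta] the weight [zeta'^(k delta)] is the [m]-th power of [zeta'^k],
    so the sum over [k] and [y] becomes a sum over all units; the correction terms of [Asum_interp]
    carry a vanishing sum of roots of unity. *)
Lemma interp_units_sum m N : m = delta %[mod p.-1] ->
  eqO (N.+1 * 2) (m.+1%:R * ((d * p ^ N.+1)%:R * interp m N)) (- units_sum m.+1 N).
Proof.
move=> md; have md1 : m.+1 = delta.+1 %[mod p.-1] by rewrite -[m.+1]addn1 -[delta.+1]addn1 -modnDml md modnDml.
pose H (x : Zp) := \sum_(i < d * p ^ N.+1 | (i %% p ^ N.+1 == x N.+1)%N) c i * i%:R ^+ m.+1.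
have eH : \sum_(k < p.-1) \sum_(y < p ^ N) H (zeta' ^+ k * kinv y) = units_sum m.+1 N.
  rewrite (units_reindex p_odd p_ndvd_d (G := H) prim_resFV); last by move=> x y e; rewrite /H e.
  rewrite /H (exchange_big_dep predT) //= /units_sum [RHS]big_mkcond; apply: eq_bigr => i _.
  have ilt : (i %% p ^ N.+1 < p ^ N.+1)%N by rewrite ltn_pmod.
  rewrite (eq_bigl (fun x : 'I_(p ^ N.+1) => (~~ (p %| i)%N) && (x == Ordinal ilt))); last first.
    move=> x; rewrite digits_nat (modn_small (ltn_ord x)) [(i %% _)%N == _]eq_sym.
    rewrite -[x == Ordinal ilt]/(x == (i %% p ^ N.+1)%N :> nat) andbC [RHS]andbC.
    case: eqP => //= ->; rewrite /dvdn modn_dvdm //.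
    by rewrite expnS dvdn_mulr.
  by case: (p %| i)%N; rewrite /= ?big_pred0_eq // big_pred1_eq.
have -> : m.+1%:R * ((d * p ^ N.+1)%:R * interp m N) =
   - \sum_(k < p.-1) \sum_(y < p ^ N) m.+1%:R * (Asum d c N.+1 (zeta' ^+ k * kinv y) * emb (zeta' ^+ k * kinv y) ^+ m).
  rewrite exchange_big /= -sumrN /interp !mulr_sumr; apply: eq_bigr => y _.
  rewrite [_%:R * (Beta _ _ * _)]mulrA (betaE d_gt0 p_ndvd_d zz prim_zeta c_per HC1).
  rewrite /betaS mulNr mulrN mulr_suml mulr_sumr; congr (- _); apply: eq_bigr => k _.
  congr (_ * _); rewrite emb_expM.
  rewrite (@zetaV_expr (k * delta) (k * m)); first by ring.
  by rewrite -modnMmr -md modnMmr.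
have e0 : \sum_(k < p.-1) \sum_(y < p ^ N) m%:R * emb (zeta' ^+ k * kinv y) ^+ m.+1 * C0 = 0.
  transitivity (\sum_(y < p ^ N) m%:R * emb (kinv y) ^+ m.+1 *
      (C0 * \sum_(k < p.-1) emb (zeta' ^+ (k * delta.+1)))).
    rewrite exchange_big /=; apply: eq_bigr => y _; rewrite !mulr_sumr.
    apply: eq_bigr => k _; rewrite emb_expM.
    rewrite (@zetaV_expr (k * delta.+1) (k * m.+1)); first by ring.
    by rewrite -modnMmr -md1 modnMmr.
  by rewrite big1 // => y _; rewrite (C0_sum zz prim_zeta HC1) mulr0.
apply: eqON; rewrite -[units_sum m.+1 N]addr0 -eH -[X in eqO _ _ (_ + X)]e0.
rewrite -big_split /=; apply: eqO_sum => k _; rewrite -big_split /=; apply: eqO_sum => y _.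
exact: Asum_interp.
Qed.

Definition power_sum (n N : nat) : O := \sum_(i < p ^ N * d) c i.+1 * i.+1%:R ^+ n.

Lemma sum_shift (V : zmodType) (G : nat -> V) n :
  \sum_(i < n) G i.+1 = \sum_(i < n) G i + G n - G 0%N.
Proof.
have <- : \sum_(i < n.+1) G i = \sum_(i < n) G i + G n by rewrite big_ord_recr.
by rewrite big_ord_recl /= addrAC subrr add0r.
Qed.

(** Removing the multiples of [p] produces the Euler factor of [L]. *)
Lemma units_power_sum n N : (0 < n)%N ->
  units_sum n N = power_sum n N.+1 - c p * p%:R ^+ n * power_sum n N.
Proof.
move=> n0; pose G i : O := c i * i%:R ^+ n.
have Gp i : G (p * i)%N = c p * p%:R ^+ n * G i by rewrite /G c_mul natrM exprMn; ring.
have G0 : G 0%N = 0 by rewrite /G expr0n gtn_eqF // mulr0.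
have e : \sum_(i < d * p ^ N.+1) G i = units_sum n N + c p * p%:R ^+ n * \sum_(i < d * p ^ N) G i.
  rewrite (bigID (fun i : 'I__ => (p %| i)%N)) /= addrC; congr (_ + _).
  rewrite expnSr mulnA (sum_residues (r := 0) (d * p ^ N) G) // mulr_sumr.
  by apply: eq_bigr => l _; rewrite addn0 mulnC Gp.
rewrite /power_sum !(sum_shift G) G0 !subr0 ![(p ^ _ * d)%N]mulnC e.
have -> : (d * p ^ N.+1 = p * (d * p ^ N))%N by rewrite expnS; lia.
by rewrite Gp; ring.
Qed.

Variable chi : int -> K.
Hypothesis cE : forall i : nat, int_val (c i) = chi i%:Z.
Hypothesis chi_per : forall a, chi (a + d%:Z) = chi a.

Lemma interp_cvg m (Lv : K) : m = delta %[mod p.-1] ->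
  Lv = - (1 - chi p%:Z * p%:R ^+ m) * (gen_bernoulli d chi m.+1 / m.+1%:R) ->
  exists a, forall N, (a <= N)%N -> exists w : O, int_val (interp m N) - Lv = p%:R ^+ (N - a) * int_val w.
Proof.
move=> md eL; have [C C0' hC] := gen_bernoulli_sum (@natrK_eq0 p p_pr K) d_gt0 chi_per m.+1.
set B := gen_bernoulli _ _ _ in eL hC.
have hS N : exists z : O, C%:R * int_val (power_sum m.+1 N) =
    C%:R * (p ^ N * d)%:R * B + p%:R ^+ (N * 2) * int_val z.
  have [z hz] := hC (p ^ N)%N; exists (\sum_(a < d) c a.+1 * (z a)%:~R).
  rewrite /power_sum !rmorph_sum exprM -natrX.
  rewrite (_ : \sum_(i < d) _ = \sum_(a < d) chi a.+1%:Z * (z a)%:~R); last first.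
    by apply: eq_bigr => i _; rewrite rmorphM rmorph_int /= cE.
  rewrite -hz; congr (_ * _); apply: eq_bigr => i _.
  by rewrite rmorphM rmorphXn rmorph_nat /= cE.
(* [a] is the valuation of the constant by which the error is divided; it depends on [m] but not on
   [N]. *)
have [a [m' pm' ea]] : exists a, exists2 m', coprime p m' & (C * (m.+1 * (d * p)) = m' * p ^ a)%N.
  have [|m' pm' e] := @pfactor_coprime p (C * (m.+1 * (d * p))) p_pr.
    by rewrite !muln_gt0 C0' d_gt0 p_gt0.
  by exists (logn p (C * (m.+1 * (d * p)))), m'.
exists a => N aN; have [z1 ez1] := hS N.+1; have [z0 ez0] := hS N.
have [u eu] := interp_units_sum N md.
have um' : (m'%:R : Zp) \is a GRing.unit.
  rewrite padic_unit1 digits_nat expn1; apply: contraL pm' => /eqP e'.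
  by rewrite prime_coprime // negbK /dvdn e'.
have := congr1 (@int_val _ _ K) eu; rewrite units_power_sum // opprK.
move=> {}eu.
pose w := C%:R * u * p%:R ^+ 2 - z1 * p%:R ^+ 2 + c p * p%:R ^+ m.+1 * z0.
exists (emb (m'%:R^-1) * w).
have unitK : int_val (emb (m'%:R^-1)) * m'%:R = 1.
  by rewrite -(rmorph_nat (@int_val _ _ K)) -(rmorph_nat emb) -!rmorphM mulVr // !rmorph1.
have nz : (C * (m.+1 * (d * p)))%:R != 0 :> K.
  by rewrite natrK_eq0 -lt0n !muln_gt0 C0' d_gt0 p_gt0.
have key : (C * (m.+1 * (d * p)))%:R * (int_val (interp m N) - Lv) = p%:R ^+ N * int_val w.
  apply: (mulfI (pXK_neq0 K N)); rewrite eL.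
  have m0 : m.+1%:R != 0 :> K by rewrite natrK_eq0.
  rewrite !natrM /w; move: eu ez1 ez0.
  rewrite !(rmorphB (@int_val _ _ K), rmorphD (@int_val _ _ K), rmorphM (@int_val _ _ K),
    rmorphXn (@int_val _ _ K), rmorph_nat (@int_val _ _ K)) -(cE p) !natrM !natrX.
  rewrite !exprM !(exprSr p%:R N) !(exprSr p%:R m); exact: interp_algebra.
apply: (mulfI nz); rewrite key ea natrM natrX rmorphM.
have -> : p%:R ^+ N = p%:R ^+ a * p%:R ^+ (N - a) :> K by rewrite -exprD subnKC.
transitivity (p%:R ^+ a * p%:R ^+ (N - a) * ((int_val (emb (m'%:R^-1)) * m'%:R) * int_val w)); last by ring.
by rewrite unitK mul1r.
Qed.

End Interpolation.

Section Newton.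
Variables (p : nat) (p_pr : prime p) (K : fieldExtType (padic_field p_pr)).
Local Notation O := (int_ring K).

(* Newton interpolation: each divided difference costs at most p^A. *)
Lemma newton_coef (A n : nat) (t : nat -> O) (r : {poly O}) :
  (forall i, eqO 1 (t i) 0) ->
  (forall i j, (i < j < n)%N -> exists u, (t j - t i) * u = p%:R ^+ A) ->
  (forall i, (i < n)%N -> eqO (A * n).+1 r.[t i] 0) ->
  forall k, (k < n)%N -> eqO 1 r`_k 0.
Proof.
elim: n t r => [//|n IH] t r t0 tA rt k kn.
have [q eq] : exists q, r - (r.[t 0%N])%:P = q * ('X - (t 0%N)%:P).
  by apply/factor_theorem; rewrite /root !hornerE subrr.
have r0 : eqO 1 r.[t 0%N] 0 by apply: eqO_le (rt 0%N _).
have er : r = q * 'X - (t 0%N) *: q + (r.[t 0%N])%:P.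
  by rewrite -[LHS](subrK (r.[t 0%N])%:P) eq mulrBr [_ * _%:P]mulrC mul_polyC.
have qk j : (j < n)%N -> eqO 1 q`_j 0.
  apply: (IH (fun i => t i.+1)) => [i|i j' /andP[ij jn]|i iN]; first exact: t0.
    by apply: tA; rewrite !ltnS ij jn.
  have [u eu] := tA 0%N i.+1 ltac:(lia).
  have [v ev] := rt i.+1 iN; have [v0 ev0] := rt 0%N isT.
  exists (u * (v - v0)); rewrite subr0.
  have pA : int_val (p%:R ^+ A : O) != 0 by rewrite rmorphXn rmorph_nat pXK_neq0.
  apply: (int_mulfI pA); rewrite -{1}eu.
  have := congr1 (fun P : {poly O} => P.[t i.+1]) eq; rewrite hornerM !hornerE => e.
  rewrite !subr0 in ev ev0; rewrite ev ev0 in e.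
  transitivity (u * (q.[t i.+1] * (t i.+1 - t 0%N))); first by ring.
  rewrite -e (_ : (A * n.+1).+1 = (A + (A * n).+1)%N); last lia.
  have h (X Y : O) : u * (X * Y * v - X * Y * v0) = X * Y * u * (v - v0) by ring.
  rewrite exprD; exact: h.
have D0 (x y : O) : eqO 1 x 0 -> eqO 1 y 0 -> eqO 1 (x + y) 0.
  by move=> hx hy; rewrite -[X in eqO _ _ X](addr0 0); apply: eqOD.
rewrite er !coefD coefN coefZ coefMX coefC; apply: (D0); last first.
  by case: k {kn} => [|k]; [exact: r0|exact: eqOrefl].
apply: D0.
  by case: k kn => [|k] kn; [exact: eqOrefl|apply: qk].
have [v ev] := t0 0%N; exists (- (v * q`_k)); rewrite !subr0 in ev *.
by rewrite ev; ring.
Qed.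
End Newton.

(** * The reduction of [f] in terms of the measure *)

Section IwasawaMod.
Variables (p : nat) (p_pr : prime p) (p_odd : odd p).
Variables (d : nat) (d_gt0 : (0 < d)%N) (p_ndvd_d : ~~ (p %| d)%N).
Variables (K : fieldExtType (padic_field p_pr)).
Local Notation Zp := (padic_int p_pr).
Local Notation O := (int_ring K).
Local Notation emb := (@padic_int_emb p p_pr K).
Variables (zeta zeta' : Zp) (delta : nat).
Hypotheses (zz : zeta' * zeta = 1) (prim_zeta : p.-1.-primitive_root zeta).
Hypothesis (prim_resF : p.-1.-primitive_root (resF zeta)).
Variable c : nat -> O.
Hypotheses (c_per : forall i, c (i + d)%N = c i) (c_mul : forall i, c (p * i)%N = c p * c i).
Let C0 := \sum_(l < d) c l.
Hypotheses (HC1 : C0 = 0 \/ ~~ (p.-1 %| delta.+1)%N) (HC2 : C0 = 0 \/ ~~ (p.-1 %| delta)%N).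
Local Notation Beta := (@beta p p_pr d K zeta' delta c).
Local Notation kinv := (@kinv p p_pr d).
Variable chi : int -> K.
Hypothesis cE : forall i : nat, int_val (c i) = chi i%:Z.
Hypothesis chi_per : forall a, chi (a + d%:Z) = chi a.
Variables (L : Zp -> K) (f : {fps O}).
Hypothesis L_val : forall m, m = delta %[mod p.-1] ->
  L (1 - m.+1%:R) = - (1 - chi p%:Z * p%:R ^+ m) * (gen_bernoulli d chi m.+1 / m.+1%:R).
Hypothesis f_L : iwasawa_series d L f.
Variable pi : uniformizer K.
Local Notation F := (residue_field pi).
Local Notation red := (@reduction p p_pr K pi).

Let p_gt0 : (0 < p)%N. Proof. exact: prime_gt0. Qed.
Let p1_gt0 : (0 < p.-1)%N. Proof. by have := prime_gt1 p_pr; lia. Qed.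

Lemma kinv_sub1 m : exists t, kinv m - 1 = p%:R * t.
Proof.
have /padic_eqP [t ->] : (kinv m) 1%N = (1 : Zp) 1%N.
  apply/eqP; rewrite -resF_eq rmorph1; exact/eqP/(padic_pow1 p_odd p_ndvd_d).
by exists t; rewrite addrAC subrr add0r expr1.
Qed.

Lemma kinv_exp m y : kinv m ^+ y = kinv y ^+ m.
Proof.
rewrite /kinv -!(padic_powMn p_odd p_ndvd_d) !mulNrn -!mulrnA.
by rewrite mulnC.
Qed.

(** The point [kinv m - 1] is divisible by [p], so all terms from index [E] on are multiples of
    [p^E]; the limit is reached through a partial sum long enough to be within [p^E] of it. *)
Lemma partial_sum_near m E : exists u : O,
  int_val (\sum_(i < E) f i * (emb (kinv m) - 1) ^+ i) - L (1 - m.+1%:R) = p%:R ^+ E * int_val u.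
Proof.
have [t et] := kinv_sub1 m.
have em : emb (kinv m) - 1 = p%:R * emb t.
  by rewrite -(rmorph_nat emb) -rmorphM -et rmorphB rmorph1.
have := f_L (1 - m.+1%:R); rewrite (_ : 1 - m.+1%:R = - m%:R); last first.
  by rewrite -[m.+1%:R]natr1 opprD addrCA subrr addr0.
move=> /(_ E) [N0 /(_ (E + N0)%N (leq_addl _ _)) [u eu]].
exists (u - \sum_(j < N0) f (E + j)%N * (p%:R ^+ j * emb t ^+ (E + j))).
have -> : \sum_(i < E) f i * (emb (kinv m) - 1) ^+ i =
    \sum_(i < E + N0) f i * (emb (kinv m) - 1) ^+ i -
    p%:R ^+ E * \sum_(j < N0) f (E + j)%N * (p%:R ^+ j * emb t ^+ (E + j)).
  rewrite big_split_ord /= mulr_sumr -addrA -sumrB [X in _ = _ + X]big1 ?addr0 // => j _.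
  by rewrite em exprMn [p%:R ^+ (E + j)]exprD; ring.
rewrite [int_val (_ - _)]rmorphB addrAC.
have -> : int_val (\sum_(i < E + N0) f i * (emb (kinv m) - 1) ^+ i) - L (- m%:R) = p%:R ^+ E * int_val u.
  rewrite -eu rmorph_sum; congr (_ - _); apply: eq_bigr => i _.
  by rewrite rmorphM rmorphXn rmorphB rmorph1.
rewrite (rmorphM (@int_val _ _ K)) (rmorphXn (@int_val _ _ K)) (rmorph_nat (@int_val _ _ K)) -mulrBr.
by congr (_ * _); rewrite rmorphB.
Qed.

(** A Riemann sum of [(1 + T)^y] at the points [kappa^(-y)]. Since [kinv m ^+ y = kinv y ^+ m], its
    value at [kinv m - 1] is the moment [interp m]. *)
Definition level_poly N : {poly O} := \sum_(y < p ^ N) Beta N.+1 (kinv y) *: (1 + 'X) ^+ y.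

Lemma level_poly_eval m N : (level_poly N).[emb (kinv m) - 1] = interp d zeta' delta c m N.
Proof.
rewrite horner_sum; apply: eq_bigr => y _.
rewrite hornerZ horner_exp hornerD hornerX (hornerC 1) addrC subrK.
by rewrite -(rmorphXn emb) kinv_exp (rmorphXn emb).
Qed.

Definition level_fps N : {fps F} :=
  \sum_(y < p ^ N) fps_poly (red (Beta N.+1 (kinv y)))%:P * onepT_pow pi y%:R.

Lemma level_fpsE N k : level_fps N k = red (level_poly N)`_k.
Proof.
rewrite /level_fps /level_poly fps_sum coef_sum rmorph_sum; apply: eq_bigr => y _.
rewrite fpsCM onepT_pow_nat fps_polyE coefZ rmorphM; congr (_ * _).
by rewrite -(coef_map red) rmorphXn rmorphD rmorph1 /= map_polyX.
Qed.

(** The nodes come from the exponents [delta + (p-1) j], at which [L_val] gives the values of [L];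
    they are distinct, so their differences divide powers of [p]. *)
Lemma Newton_points n : exists A, forall i j, (i < j < n)%N -> exists u : O,
  ((emb (kinv (delta + p.-1 * j)) - 1) - (emb (kinv (delta + p.-1 * i)) - 1)) * u = p%:R ^+ A.
Proof.
have ex i j : exists A, (i < j)%N -> exists u : O,
    ((emb (kinv (delta + p.-1 * j)) - 1) - (emb (kinv (delta + p.-1 * i)) - 1)) * u = p%:R ^+ A.
  case: (ltnP i j) => ij; last by exists 0%N.
  have nz : kinv (delta + p.-1 * j) - kinv (delta + p.-1 * i) != 0.
    rewrite subr_eq0; apply/eqP => /(padic_pow_inj p_odd p_ndvd_d)/oppr_inj/eqP.
    rewrite -subr_eq0 -natrB ?leq_add2l ?leq_mul2l ?(ltnW ij) ?orbT // padic_natr_eq0.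
    by rewrite subnDl -mulnBr muln_eq0 (gtn_eqF p1_gt0) subn_eq0 leqNgt ij.
  have [A [u eu]] := padic_neq0_dvd nz; exists A => _; exists (emb u).
  have := congr1 emb eu; rewrite rmorphM rmorphB rmorphXn rmorph_nat => <-.
  by ring.
pose A i := projT1 (choice (ex i)); have hA i := projT2 (choice (ex i)).
exists (\max_(ij : 'I_n * 'I_n) A ij.1 ij.2) => i j /andP[ij jn].
have [u eu] := hA i j ij; set M := \max_ij _.
have AM : (A i j <= M)%N.
  exact: (leq_bigmax (F := fun ij : 'I_n * 'I_n => A ij.1 ij.2) (Ordinal (ltn_trans ij jn), Ordinal jn)).
by exists (u * p%:R ^+ (M - A i j)); rewrite mulrA eu -exprD subnKC.
Qed.

(** The truncated [f] and [level_poly N] take close values at [n] nodes, so their first [n]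
    coefficients agree modulo [p] by Newton interpolation. The level is not explicit here;
    [level_step] makes it so afterwards. *)
Lemma f_level_large n : exists N0, forall N, (N0 <= N)%N -> eqT n (fps_map red f) (level_fps N).
Proof.
(* [E] is the truncation order: [A n + 1] is the precision that [newton_coef] asks for, and the
   added [n] keeps the first [n] coefficients. *)
have [A hA] := Newton_points n; pose E := ((A * n).+1 + n)%N.
pose mm j := (delta + p.-1 * j)%N.
have mmE j : mm j = delta %[mod p.-1] by rewrite /mm addnC mulnC modnMDl.
have ex j : exists a, forall N, (a <= N)%N -> exists w : O,
    int_val (interp d zeta' delta c (mm j) N) - L (1 - (mm j).+1%:R) = p%:R ^+ (N - a) * int_val w.
  exact: (interp_cvg p_odd d_gt0 p_ndvd_d zz prim_zeta prim_resF c_per c_mul HC1 HC2 cE chi_per (mmE j) (L_val (mmE j))).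
have [a ha] := choice ex.
exists (E + \max_(j < n) a j)%N => N hN k kn.
pose r : {poly O} := \poly_(i < E) f i - level_poly N.
have rk : eqO 1 r`_k 0.
  apply: (@newton_coef _ _ _ A n (fun j => emb (kinv (mm j)) - 1)) => // [i|i iN].
    have [t et] := kinv_sub1 (mm i); exists (emb t).
    by rewrite subr0 expr1 -(rmorph_nat emb) -rmorphM -et rmorphB rmorph1.
  have aN : (E + a i <= N)%N.
    apply: leq_trans hN; rewrite leq_add2l.
    exact: (leq_bigmax (F := fun j : 'I_n => a j) (Ordinal iN)).
  have [w ew] := ha i N ltac:(lia); have [u eu] := partial_sum_near (mm i) E.
  apply: (@eqO_le _ _ _ _ E); first by rewrite /E leq_addr.
  exists (u - p%:R ^+ (N - a i - E) * w); rewrite subr0; apply: int_val_inj.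
  rewrite /r hornerD hornerN level_poly_eval horner_poly.
  transitivity ((int_val (\sum_(i0 < E) f i0 * (emb (kinv (mm i)) - 1) ^+ i0) - L (1 - (mm i).+1%:R))
     - (int_val (interp d zeta' delta c (mm i) N) - L (1 - (mm i).+1%:R))).
    by rewrite [int_val (_ - _)]rmorphB; ring.
  rewrite eu ew (rmorphM (@int_val _ _ K)) (rmorphB (@int_val _ _ K)) (rmorphM (@int_val _ _ K)).
  rewrite !(rmorphXn (@int_val _ _ K)) !(rmorph_nat (@int_val _ _ K)) mulrBr mulrA -exprD.
  by congr (_ - _ ^+ _ * _); lia.
rewrite level_fpsE /fps_map /=; apply/eqP; rewrite -subr_eq0 -rmorphB.
have -> : f k - (level_poly N)`_k = r`_k.
  by rewrite /r coefB coef_poly (_ : (k < E)%N) // /E; lia.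
case: rk => u; rewrite subr0 => ->.
by rewrite (rmorphM red) (rmorphXn red) (rmorph_nat red) red_p expr1 mul0r.
Qed.

Lemma kinvD y z : kinv (y + z) = kinv y * kinv z.
Proof. by rewrite /kinv natrD opprD (padic_powD p_odd p_ndvd_d). Qed.

(** For [l < p] the points [kinv (y + l p^N)] are the [p] lifts of [kinv y], spaced by a unit
    multiple of [p^(N+1)], so [beta_dist] sums their masses; meanwhile [(1 + T)^(l p^N)] is 1 modulo
    [T^(p^N)]. *)
Lemma level_step N : eqT (p ^ N) (level_fps N.+1) (level_fps N).
Proof.
rewrite /level_fps expnS.
rewrite (sum_mul p (p ^ N) (fun y => fps_poly (red (Beta N.+2 (kinv y)))%:P * onepT_pow pi y%:R)).
rewrite exchange_big /=; apply: eqT_sum => y _.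
apply: (@eqTtrans _ _ _ (\sum_(l < p) fps_poly (red (Beta N.+2 (kinv (l * p ^ N + y))))%:P * onepT_pow pi y%:R)).
  apply: eqT_sum => l _; apply: eqTMl; apply: onepT_pow_eqT.
  by rewrite !digits_nat modnMDl.
rewrite -mulr_suml -!rmorph_sum; apply: eqTMr; rewrite (_ : \sum_(l < p) _ = Beta N.+1 (kinv y)) //.
have [u [u1 eu]] := kappa_pX p_pr p_odd p_ndvd_d N.
have [q [q1 eq]] : exists q : Zp, q \is a GRing.unit /\ kinv (p ^ N) = 1 + p%:R ^+ N.+1 * q.
  have epow : padic_pow d (p ^ N)%:R = 1 + p%:R ^+ N.+1 * u :> Zp.
    rewrite -eu; apply: padic_ext => n; rewrite (padic_pow_digits p_odd p_ndvd_d).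
    by apply: kappa_pow_mod => //; rewrite digits_nat modn_mod.
  have inv := padic_powNV p_odd p_ndvd_d ((p ^ N)%:R : Zp); rewrite epow in inv.
  exists (- (kinv (p ^ N) * u)); split.
    rewrite unitrN unitrM (padic_unit1 u) u1 andbT.
    by apply/unitrP; exists (1 + p%:R ^+ N.+1 * u); rewrite [_ * kinv _]mulrC.
  have {}inv : kinv (p ^ N) * (1 + p%:R ^+ N.+1 * u) = 1 := inv.
  apply/eqP; rewrite -subr_eq0; apply/eqP; rewrite -[X in _ - (X + _)]inv; ring.
have ku : kinv y \is a GRing.unit.
  apply/unitrP; exists (padic_pow d y%:R); rewrite mulrC.
  by split; exact: (padic_powNV p_odd p_ndvd_d).
have vu : (kinv y * q)^-1 * (kinv y * q) = 1 by rewrite mulVr // unitrM ku q1.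
rewrite -(beta_dist p_odd d_gt0 p_ndvd_d zz prim_zeta c_per HC1 HC2 N.+1 (kinv y) vu).
apply: eq_bigr => l _; apply: beta_mod.
have [w ew] : exists w, kinv (l * p ^ N) = 1 + p%:R ^+ N.+1 * q * l%:R + p%:R ^+ N.+2 * w.
  elim: {+}(nat_of_ord l) => [|j [w IH]].
    by exists 0; rewrite mul0n /kinv oppr0 padic_pow0 //; ring.
  rewrite mulSn kinvD IH eq -[j.+1%:R]natr1.
  exists (w + w * (p%:R ^+ N.+1 * q) + p%:R ^+ N * q ^+ 2 * j%:R); rewrite !exprS; ring.
by apply/padic_eqP; exists (w * kinv y); rewrite kinvD ew; ring.
Qed.

Theorem fbar_level N : eqT (p ^ N) (fps_map red f) (level_fps N).
Proof.
have [N0 hN0] := f_level_large (p ^ N).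
apply: eqTtrans (hN0 (N0 + N)%N (leq_addr _ _)) _.
elim: N0 {hN0} => [|j IH]; first exact: eqTrefl.
rewrite addSn; apply: eqTtrans IH; apply: (@eqT_le _ (p ^ N) (p ^ (j + N))); last exact: level_step.
by rewrite leq_exp2l ?prime_gt1 // leq_addl.
Qed.

End IwasawaMod.

(** * Finite differences *)

Lemma big_ord_head0 (V : nmodType) n (G : nat -> V) : G 0%N = 0 ->
  \sum_(i < n.+1) G i = \sum_(i < n) G i.+1.
Proof. by move=> G0; rewrite big_ord_recl G0 add0r. Qed.

Section Delta.
Variables (p : nat) (p_pr : prime p).
Local Notation Zp := (padic_int p_pr).

Section Ring.
Variable R : comNzRingType.
Implicit Types (b : Zp -> R) (a : Zp).

Definition Delta a b : Zp -> R := fun x => b x - b (x - a).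
Definition Dl (s : seq Zp) b : Zp -> R := foldr Delta b s.

Lemma Delta_ext a b b' : b =1 b' -> Delta a b =1 Delta a b'.
Proof. by move=> e x; rewrite /Delta !e. Qed.
Lemma Dl_ext s b b' : b =1 b' -> Dl s b =1 Dl s b'.
Proof. by move=> e; elim: s => //= a s IH; apply: Delta_ext. Qed.
Lemma DlC s a b : Dl s (Delta a b) =1 Delta a (Dl s b).
Proof.
elim: s => //= a' s IH x; rewrite (Delta_ext _ IH) /Delta [x - a' - a]addrAC.
by ring.
Qed.
Lemma Dl_rem (T : eqType) (f : T -> Zp) (s : seq T) k b : k \in s ->
  Dl (map f s) b =1 Dl (map f (rem k s)) (Delta (f k) b).
Proof.
elim: s => //= x s IH; rewrite inE eq_sym; case: eqP => [-> _|xk /= ks].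
  by move=> y; rewrite DlC.
by apply: Delta_ext; apply: IH.
Qed.
Lemma Dl_sum s (I : finType) (t : I -> R) (g : I -> Zp -> R) :
  Dl s (fun x => \sum_i t i * g i x) =1 fun x => \sum_i t i * Dl s (g i) x.
Proof.
elim: s => //= a s IH x; rewrite (Delta_ext _ IH) /Delta -sumrB.
by apply: eq_bigr => i _; rewrite mulrBr.
Qed.
Lemma Dl_lin s (t t' : R) (g g' : Zp -> R) :
  Dl s (fun x => t * g x + t' * g' x) =1 fun x => t * Dl s g x + t' * Dl s g' x.
Proof. by elim: s => //= a s IH x; rewrite (Delta_ext _ IH) /Delta; ring. Qed.
Lemma Dl_const0 s : Dl s (fun=> 0) =1 fun=> 0.
Proof. by elim: s => //= a s IH x; rewrite (Delta_ext _ IH) /Delta subrr. Qed.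
Lemma Dl_inv (T : eqType) (f : T -> Zp) (s : seq T) k b : k \in s ->
  (forall x, b (x - f k) = b x) -> Dl (map f s) b =1 fun=> 0.
Proof.
move=> ks h x; rewrite (Dl_rem _ _ ks) (@Dl_ext _ _ (fun=> 0)) ?Dl_const0 // => y.
by rewrite /Delta h subrr.
Qed.
Lemma Dl_mod s N b : (forall x y : Zp, x N = y N -> b x = b y) ->
  forall x y : Zp, x N = y N -> Dl s b x = Dl s b y.
Proof.
move=> h; elim: s => //= a s IH x y e; rewrite /Delta (IH _ _ e); congr (_ - _); apply: IH.
by rewrite ![_ - a]addrC; apply: digitsDl.
Qed.
End Ring.

Lemma Dl_morph (R S : comNzRingType) (g : {rmorphism R -> S}) s (b : Zp -> R) x :
  g (Dl s b x) = Dl s (g \o b) x.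
Proof. by elim: s x => //= a s IH x; rewrite /Delta rmorphB !IH. Qed.
End Delta.

(** * Transforms of functions on [Z_p / p^N] *)

Section Transform.
Variables (p : nat) (p_pr : prime p) (K : fieldExtType (padic_field p_pr)).
Variable pi : uniformizer K.
Local Notation Zp := (padic_int p_pr).
Local Notation F := (residue_field pi).
Local Notation X := (onepT_pow pi).
Implicit Types (b : Zp -> F) (u a : Zp).

(** The transform of [b] in the variable [(1 + T)^u], meaningful modulo [T^(p^N)]. *)
Definition Tr N u b : {fps F} := \sum_(x < p ^ N) fps_poly (b x%:R)%:P * X (x%:R * u).

Lemma Tr_ext N u b b' : b =1 b' -> Tr N u b = Tr N u b'.
Proof. by move=> e; apply: eq_bigr => x _; rewrite e. Qed.

Lemma Tr_sum N u (I : finType) (t : I -> F) (g : I -> Zp -> F) :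
  Tr N u (fun x => \sum_i t i * g i x) = \sum_i fps_poly (t i)%:P * Tr N u (g i).
Proof.
rewrite /Tr; under [RHS]eq_bigr => i _ do rewrite mulr_sumr.
rewrite exchange_big /=; apply: eq_bigr => x _.
rewrite rmorph_sum rmorph_sum mulr_suml; apply: eq_bigr => i _.
by rewrite (rmorphM (@polyC F)) (rmorphM (@fps_poly F)) mulrA.
Qed.

Lemma Tr_reindex N (s : Zp -> Zp) (b : Zp -> F) (w : Zp -> Zp) :
  (forall x y : Zp, x N = y N -> b x = b y) ->
  (forall x y : Zp, x N = y N -> (w x) N = (w y) N) ->
  (forall x y : Zp, (s x) N = (s y) N -> x N = y N) ->
  eqT (p ^ N) (\sum_(x < p ^ N) fps_poly (b (s x%:R))%:P * X (w (s x%:R)))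
    (\sum_(x < p ^ N) fps_poly (b x%:R)%:P * X (w x%:R)).
Proof.
move=> hb hw hs k kN; rewrite !fps_sum.
pose G (x : Zp) := (fps_poly (b x)%:P * X (w x)) k.
have hG (x y : Zp) : x N = y N -> G x = G y.
  move=> e; rewrite /G [LHS]fpsCM [RHS]fpsCM.
  congr (_ * _); first exact: hb.
  exact: (onepT_pow_eqT pi (hw _ _ e)) kN.
exact: (@padic_reindex p p_pr N F G s hG hs).
Qed.

(** Translation by [a] multiplies the transform by [(1 + T)^(a u)]. *)
Lemma Tr_Delta N u a b : (forall x y : Zp, x N = y N -> b x = b y) ->
  eqT (p ^ N) (Tr N u (Delta a b)) ((1 - X (a * u)) * Tr N u b).
Proof.
move=> hb; rewrite mulrBl mul1r.
have -> : Tr N u (Delta a b) = Tr N u b - \sum_(x < p ^ N) fps_poly (b (x%:R - a))%:P * X (x%:R * u).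
  rewrite /Tr -sumrB; apply: eq_bigr => x _.
  by rewrite (rmorphB (@polyC F)) (rmorphB (@fps_poly F)) mulrBl.
apply: eqTB => //.
have -> : X (a * u) * Tr N u b = \sum_(x < p ^ N) fps_poly (b x%:R)%:P * X ((x%:R + a) * u).
  rewrite /Tr mulr_sumr; apply: eq_bigr => x _.
  by rewrite mulrDl onepT_powD mulrCA [X (a * u) * _]mulrC.
have := @Tr_reindex N (fun x => x - a) b (fun x => (x + a) * u) hb.
move=> h k kN; rewrite -(h _ _ k kN).
- congr ((_ : {fps F}) k); apply: eq_bigr => x _; by rewrite subrK.
- by move=> x y e; rewrite mulrC [(y + a) * u]mulrC; apply: digitsMl; rewrite ![_ + a]addrC; apply: digitsDl.
- by move=> x y; apply: digits_addI.
Qed.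

Lemma Tr_Dl N u s b : (forall x y : Zp, x N = y N -> b x = b y) ->
  eqT (p ^ N) (Tr N u (Dl s b)) (\prod_(a <- s) (1 - X (a * u)) * Tr N u b).
Proof.
move=> hb; elim: s => [|a s IH] /=; first by rewrite big_nil mul1r.
rewrite big_cons -[X in eqT _ _ X]mulrA.
apply: eqTtrans (Tr_Delta _ _ (Dl_mod s hb)) _; exact: eqTMl.
Qed.

Lemma Tr_scale N u rho tau b : tau * rho = 1 -> (forall x y : Zp, x N = y N -> b x = b y) ->
  eqT (p ^ N) (Tr N u (fun x => b (tau * x))) (Tr N (rho * u) b).
Proof.
move=> tr hb.
have := @Tr_reindex N (fun x => tau * x) b (fun x => x * (rho * u)) hb.
move=> h k kN; rewrite /Tr -(h _ _ k kN).
- congr ((_ : {fps F}) k); apply: eq_bigr => x _; congr (_ * X _).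
  by rewrite -[x%:R * u]mul1r -tr; ring.
- by move=> x y e; rewrite mulrC [y * _]mulrC; apply: digitsMl.
- by move=> x y; apply: (@digits_mulI _ _ tau rho); rewrite mulrC.
Qed.

(** The measure with transform [num2]: point masses [c i] at [0 <= i < e], and again at
    [1 <= i <= e]. *)
Definition residues2 (c : nat -> F) (e N : nat) (x : Zp) : F :=
  \sum_(i < e | (i %% p ^ N == x N)%N) c i + \sum_(i < e | (i.+1 %% p ^ N == x N)%N) c i.+1.

Lemma Tr_residues2 N u c e : eqT (p ^ N) (Tr N u (residues2 c e N)) (ev u (num2 c e)).
Proof.
have half (g : nat -> nat) : eqT (p ^ N)
    (\sum_(x < p ^ N) fps_poly (\sum_(i < e | (g i %% p ^ N == (x%:R : Zp) N)%N) c (g i))%:P * X (x%:R * u))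
    (\sum_(i < e) fps_poly (c (g i))%:P * X (u *+ g i)).
  have pN : (0 < p ^ N)%N by rewrite expn_gt0 prime_gt0.
  apply: (@eqTtrans _ _ _ (\sum_(i < e) fps_poly (c (g i))%:P * X ((g i %% p ^ N)%:R * u))).
    apply: (@eqTtrans _ _ _ (\sum_(x < p ^ N) \sum_(i < e | (g i %% p ^ N == x)%N)
        fps_poly (c (g i))%:P * X ((g i %% p ^ N)%:R * u))).
      apply: eqT_sum => x _; rewrite digits_nat modn_small // rmorph_sum rmorph_sum mulr_suml.
      by apply: eqT_sum => i /eqP ->.
    rewrite (exchange_big_dep predT) //=; apply: eqT_sum => i _.
    have lt : (g i %% p ^ N < p ^ N)%N by rewrite ltn_pmod.
    by rewrite (big_pred1 (Ordinal lt)) // => x; rewrite -val_eqE eq_sym.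
  apply: eqT_sum => i _; apply: eqTMl; apply: onepT_pow_eqT.
  rewrite -(mulr_natl u) ![_ * u]mulrC; apply: digitsMl.
  by rewrite !digits_nat modn_mod.
have -> : ev u (num2 c e) = \sum_(i < e) fps_poly ((\poly_(j < e) c j)`_i)%:P * X (u *+ i) +
    \sum_(i < e.+1) fps_poly ((\poly_(j < e.+1) (if j == 0%N then 0 else c j))`_i)%:P * X (u *+ i).
  rewrite -(ev_wide u (size_poly e c)).
  rewrite -(ev_wide u (size_poly e.+1 (fun i => if i == 0%N then 0 else c i))).
  exact: (rmorphD (ev u)).
have -> : \sum_(i < e.+1) fps_poly ((\poly_(j < e.+1) (if j == 0%N then 0 else c j))`_i)%:P * X (u *+ i) =
    \sum_(i < e) fps_poly (c i.+1)%:P * X (u *+ i.+1).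
  pose G i := fps_poly ((\poly_(j < e.+1) (if j == 0%N then 0 else c j))`_i)%:P * X (u *+ i).
  have G0 : G 0%N = 0 by apply: eqT_all => n k _; rewrite [LHS]fpsCM coef_poly mul0r fps0.
  apply: etrans (big_ord_head0 e G0) _.
  by apply: eq_bigr => i _; rewrite /G coef_poly ltnS ltn_ord.
have -> : Tr N u (residues2 c e N) =
    \sum_(x < p ^ N) fps_poly (\sum_(i < e | (i %% p ^ N == (x%:R : Zp) N)%N) c i)%:P * X (x%:R * u) +
    \sum_(x < p ^ N) fps_poly (\sum_(i < e | (i.+1 %% p ^ N == (x%:R : Zp) N)%N) c i.+1)%:P * X (x%:R * u).
  rewrite /Tr -big_split /=; apply: eq_bigr => x _.
  by rewrite /residues2 (rmorphD (@polyC F)) (rmorphD (@fps_poly F)) mulrDl.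
apply: eqTD; [apply: eqTtrans (half id) _|exact: (half S)].
by apply: eqT_sum => i _; rewrite coef_poly ltn_ord.
Qed.

End Transform.

(** * The transform of the measure as a sum of rational functions *)

Section Difference.
Variables (p : nat) (p_pr : prime p).
Variables (d : nat) (K : fieldExtType (padic_field p_pr)).
Local Notation Zp := (padic_int p_pr).
Local Notation O := (int_ring K).
Local Notation emb := (@padic_int_emb p p_pr K).
Variables (zeta zeta' : Zp) (delta : nat) (c : nat -> O) (e N : nat).
Hypotheses (d_gt0 : (0 < d)%N) (zz : zeta' * zeta = 1).
Hypothesis c_per : forall i, c (i + e)%N = c i.
Hypothesis e_dvd : (e %| d * p ^ N)%N.
Variable sg : O.
Hypothesis c_sym : forall i, (i <= e)%N -> c (e - i)%N = sg * c i.
Hypothesis sg_delta : sg * (-1) ^+ delta.+1 = 1.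
Variable h : nat.
Hypotheses (p_h : p.-1 = (h + h)%N) (zeta_h : zeta' ^+ h = -1).
Variable sgn : 'I_h -> bool.
Let rho k := (-1) ^+ sgn k * zeta ^+ k.
Let tau k := (-1) ^+ sgn k * zeta' ^+ k.
Local Notation A := (Asum d c N).
Local Notation C := (Csum d c N).
Hypothesis HR : (1 < h)%N \/ forall x, C x = 0.
Let M := (d * p ^ N)%N.

Lemma tau_rho k : tau k * rho k = 1.
Proof. by rewrite /tau /rho mulrACA -expr2 sqrr_sign mul1r -exprMn zz expr1n. Qed.

Lemma shift_residue i (x : Zp) :
  (i %% p ^ N == (x - e%:R)%R N)%N = ((e + i) %% p ^ N == x N)%N.
Proof.
rewrite -(digits_nat p_pr i) -(digits_nat p_pr (e + i)) -!digits_sub0 natrD.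
by rewrite (_ : i%:R - (x - e%:R) = e%:R + i%:R - x) //; ring.
Qed.

Lemma sum_shift_residue (V : zmodType) (G : nat -> V) (x : Zp) :
  \sum_(i < M | ((e + i) %% p ^ N == x N)%N) G (e + i)%N =
  \sum_(i < M | (i %% p ^ N == x N)%N) G i - \sum_(i < e | (i %% p ^ N == x N)%N) G i +
  \sum_(i < e | (i %% p ^ N == x N)%N) G (M + i)%N.
Proof.
pose H i := if (i %% p ^ N == x N)%N then G i else 0.
have E1 : \sum_(i < M + e) H i = \sum_(i < M) H i + \sum_(i < e) H (M + i)%N.
  exact: big_split_ord.
have E2 : \sum_(i < e + M) H i = \sum_(i < e) H i + \sum_(i < M) H (e + i)%N.
  exact: big_split_ord.
rewrite addnC in E1; have E := etrans (esym E2) E1.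
have S0 n : \sum_(i < n | (i %% p ^ N == x N)%N) G i = \sum_(i < n) H i by rewrite big_mkcond.
have S1 : \sum_(i < e | (i %% p ^ N == x N)%N) G (M + i)%N = \sum_(i < e) H (M + i)%N.
  by rewrite big_mkcond; apply: eq_bigr => i _; rewrite /H modnMDl.
rewrite !S0 S1 [LHS]big_mkcond; apply: (addrI (\sum_(i < e) H i)).
by rewrite [LHS]E addrA [_ + (_ - _)]addrC subrK.
Qed.

Lemma Csum_shift1 x : C (x - e%:R) = C x.
Proof.
rewrite /Csum; under eq_bigl => i do rewrite shift_residue.
under eq_bigr => i _ do rewrite -c_per addnC.
rewrite sum_shift_residue (_ : \sum_(i < e | _) c (M + i)%N = \sum_(i < e | (i %% p ^ N == x N)%N) c i) ?subrK //.
by apply: eq_bigr => i _; have /dvdnP [l el] := e_dvd; rewrite /M el periodicMn.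
Qed.

Lemma Csum_shift x w : C (x - e%:R * w) = C x.
Proof.
have -> : C (x - e%:R * w) = C (x - e%:R * (w N)%:R).
  rewrite /Csum; have -> // : (x - e%:R * w) N = (x - e%:R * (w N)%:R) N.
  have [t et] : exists t, w = (w N)%:R + p%:R ^+ N * t by apply/padic_eqP; rewrite digits_natE.
  by apply/padic_eqP; exists (- (e%:R * t)); rewrite {1}et; ring.
elim: (w N) => [|j IH]; first by rewrite mulr0 subr0.
by rewrite -IH -natr1 mulrDr mulr1 opprD addrA Csum_shift1.
Qed.

Definition nu x := \sum_(i < e | (i %% p ^ N == (x : Zp) N)%N) c i.

(** As [c] has period [e], a shift by [e] moves the window of summation: the terms entering and
    leaving differ by [M] in the weight [i], whence [nu], and the change of the weight by [e] gives
    [C]. *)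
Lemma Asum_diff x : A x - A (x - e%:R) = - (M%:R * nu x) + e%:R * C x.
Proof.
have -> : A (x - e%:R) = \sum_(i < M | ((e + i) %% p ^ N == x N)%N) (e + i)%:R * c (e + i)%N
    - e%:R * C (x - e%:R).
  rewrite /Asum /Csum mulr_sumr; under eq_bigl => i do rewrite shift_residue.
  under [X in _ - X]eq_bigl => i do rewrite shift_residue.
  rewrite -sumrB; apply: eq_bigr => i _.
  by rewrite natrD [(e + i)%N]addnC c_per; ring.
rewrite Csum_shift1 (sum_shift_residue (fun i => i%:R * c i)).
have -> : \sum_(i < e | (i %% p ^ N == x N)%N) (M + i)%:R * c (M + i)%N =
    M%:R * nu x + \sum_(i < e | (i %% p ^ N == x N)%N) i%:R * c i.
  rewrite /nu mulr_sumr -big_split /=; apply: eq_bigr => i _.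
  have /dvdnP [l el] := e_dvd; rewrite natrD /M el periodicMn // -el; ring.
rewrite -/(A x); ring.
Qed.

(** The terms of [betaS] at [k] and [k + h], grouped by means of [zeta'^h = -1]. *)
Definition En x := A x + (-1) ^+ delta * A (- x).
Definition Rn x := C x - (-1) ^+ delta * C (e%:R - x).
Definition res2 (x : Zp) :=
  \sum_(i < e | (i %% p ^ N == x N)%N) c i + \sum_(i < e | (i.+1 %% p ^ N == x N)%N) c i.+1.

Lemma nu_neg x : nu (e%:R - x) = sg * \sum_(i < e | (i.+1 %% p ^ N == (x : Zp) N)%N) c i.+1.
Proof.
rewrite /nu (reindex_inj rev_ord_inj) /= mulr_sumr; apply: eq_big => [i|i _].
  rewrite -(digits_nat p_pr (e - i.+1)) -(digits_nat p_pr i.+1) -digits_sub0 natrB //.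
  rewrite (_ : _ - _ = x - i.+1%:R); last by ring.
  by rewrite digits_sub0 eq_sym.
by rewrite c_sym.
Qed.

(** By the parity [sg_delta] the reflected masses have the same sign as the direct ones, so they add
    up to [res2]. *)
Lemma En_diff x : En x - En (x - e%:R) = - (M%:R * res2 x) + e%:R * Rn x.
Proof.
have E := Asum_diff (e%:R - x); rewrite addrAC subrr add0r in E.
have E0 := Asum_diff x.
have -> : En x - En (x - e%:R) = (A x - A (x - e%:R)) - (-1) ^+ delta * (A (e%:R - x) - A (- x)).
  by rewrite /En opprB; ring.
have s1 : (-1) ^+ delta * sg = -1.
  by have e1 := sg_delta; rewrite exprS mulN1r mulrN in e1; rewrite mulrC -[LHS]opprK e1.
rewrite E E0 nu_neg /Rn /res2 /nu; set S1 := \sum_(i < e | _) _; set S2 := \sum_(i < e | _) _.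
rewrite !mulrDr; have -> : (-1) ^+ delta * - (M%:R * (sg * S2)) = M%:R * S2.
  by rewrite mulrN mulrCA mulrA mulrA -[M%:R * _ * sg]mulrA s1; ring.
ring.
Qed.

(** [En] has the parity of [delta], so each root of unity may be replaced by its negative: this
    frees the signs [sgn]. *)
Lemma En_sign (b : bool) x : emb (((-1) ^+ b) ^+ delta) * En ((-1) ^+ b * x) = En x.
Proof.
case: b; last by rewrite expr0 expr1n rmorph1 !mul1r.
rewrite expr1 mulN1r /En opprK (rmorphXn emb) (rmorphN emb) rmorph1 mulrDr mulrA -expr2 sqrr_sign mul1r.
by rewrite addrC.
Qed.

Lemma betaS_En x : betaS d zeta' delta c N x = \sum_k emb (tau k ^+ delta) * En (tau k * x).
Proof.
rewrite /betaS p_h [LHS]big_split_ord /= -big_split; apply: eq_bigr => k _.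
transitivity (emb (zeta' ^+ (k * delta)) * En (zeta' ^+ k * x)); last first.
  rewrite /tau exprMn (rmorphM emb) -[_ * _ * x]mulrA -[(zeta' ^+ k) ^+ _]exprM.
  by rewrite [emb _ * emb _]mulrC -[RHS]mulrA En_sign.
rewrite /En mulrDr; congr (_ + _).
rewrite [zeta' ^+ (h + k)]exprD zeta_h mulN1r mulNr mulnDl exprD exprM zeta_h (rmorphM emb).
have e1 : emb ((-1) ^+ delta) = (-1) ^+ delta by rewrite (rmorphXn emb) (rmorphN emb) rmorph1.
by rewrite -[LHS]mulrA mulrCA; congr (_ * (_ * _)); exact: e1.
Qed.

Variable b : Zp -> O.
Hypothesis bE : forall x, M%:R * b x = - betaS d zeta' delta c N x.
Hypothesis M_gt0 : (0 < M)%N.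
Let s (k : 'I_h) : Zp := e%:R * rho k.

(** The difference of step [s k] turns the [k]-th term into masses with the factor [M] plus a
    multiple of [Rn]. [Rn] is invariant under shifts by multiples of [e], so the difference of any
    other step removes it; when [h = 1] there is no other step, and [C = 0] is used instead. *)
Lemma Dl_beta x : Dl (map s (enum 'I_h)) b x =
  \sum_k emb (tau k ^+ delta) * Dl (map s (rem k (enum 'I_h))) (fun y => res2 (tau k * y)) x.
Proof.
apply: (natrO_inj M_gt0).
have -> : M%:R * Dl (map s (enum 'I_h)) b x =
    \sum_k - emb (tau k ^+ delta) * Dl (map s (enum 'I_h)) (fun y => En (tau k * y)) x.
  transitivity (Dl (map s (enum 'I_h)) (fun y => M%:R * b y + 0 * b y) x).
    by rewrite Dl_lin mul0r addr0.
  rewrite -(Dl_sum _ _ (fun k y => En (tau k * y))).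
  apply: Dl_ext => y; rewrite mul0r addr0 bE betaS_En -sumrN.
  by apply: eq_bigr => k _; rewrite mulNr.
rewrite mulr_sumr; apply: eq_bigr => k _.
rewrite (@Dl_rem _ _ _ _ s _ k) ?mem_enum //.
have -> : Dl (map s (rem k (enum 'I_h))) (Delta (s k) (fun y => En (tau k * y))) x =
   - M%:R * Dl (map s (rem k (enum 'I_h))) (fun y => res2 (tau k * y)) x +
   e%:R * Dl (map s (rem k (enum 'I_h))) (fun y => Rn (tau k * y)) x.
  rewrite -Dl_lin; apply: Dl_ext => y; rewrite /Delta mulrBr.
  by rewrite /s [tau k * (e%:R * _)]mulrCA tau_rho mulr1 En_diff mulNr.
have -> : Dl (map s (rem k (enum 'I_h))) (fun y => Rn (tau k * y)) x = 0; last by ring.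
case: HR => [h1|C0]; last first.
  rewrite (@Dl_ext _ _ _ _ _ (fun=> 0)) ?Dl_const0 // => y.
  by rewrite /Rn !C0 mulr0 subr0.
have [l lk] : exists l : 'I_h, l != k.
  have h0 : (0 < h)%N by apply: ltnW.
  have [k0|k0] := eqVneq (k : nat) 0%N.
    by exists (Ordinal h1); rewrite -val_eqE /= k0.
  by exists (Ordinal h0); rewrite -val_eqE /= eq_sym.
apply: (@Dl_inv _ _ _ _ _ _ l) => [|y]; first by rewrite mem_rem_uniq ?enum_uniq // inE lk mem_enum.
rewrite mulrBr /s [tau k * (e%:R * _)]mulrCA /Rn Csum_shift; congr (_ - _ * _).
rewrite -[RHS](Csum_shift _ (- (tau k * rho l))); congr C; ring.
Qed.

Variable pi : uniformizer K.
Local Notation F := (residue_field pi).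
Local Notation red := (@reduction p p_pr K pi).
Local Notation X := (onepT_pow pi).
Hypothesis b_mod : forall x y : Zp, x N = y N -> b x = b y.

Lemma big_rem_enum (V : comNzRingType) (G : Zp -> V) k :
  \prod_(a <- map s (rem k (enum 'I_h))) G a = \prod_(l | l != k) G (s l).
Proof. by rewrite big_map rem_filter ?enum_uniq // big_filter big_enum_cond. Qed.

Lemma res2_mod (x y : Zp) : x N = y N -> red (res2 x) = red (res2 y).
Proof. by rewrite /res2 => ->. Qed.

(** With denominators cleared: the transform is the sum of the [num2 / (1 - X^e)] evaluated at the
    [(1 + T)^(rho k * u)]. *)
Theorem Tr_beta u : eqT (p ^ N)
  (\prod_k (1 - X (e%:R * rho k * u)) * Tr N u (red \o b))
  (\sum_k fps_poly (red (emb (tau k ^+ delta)))%:P *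
     (ev (rho k * u) (num2 (red \o c) e) * \prod_(l | l != k) (1 - X (e%:R * rho l * u)))).
Proof.
have b_mod' (x y : Zp) : x N = y N -> (red \o b) x = (red \o b) y by move=> xy /=; rewrite (b_mod xy).
have E1 := eqTsym (Tr_Dl u (map s (enum 'I_h)) b_mod').
rewrite big_map big_enum /= in E1; apply: eqTtrans E1 _.
have -> : Tr N u (Dl (map s (enum 'I_h)) (red \o b)) = Tr N u (fun x => \sum_k
    red (emb (tau k ^+ delta)) * Dl (map s (rem k (enum 'I_h))) (fun y => red (res2 (tau k * y))) x).
  apply: Tr_ext => x; rewrite -Dl_morph Dl_beta rmorph_sum; apply: eq_bigr => k _.
  by rewrite (rmorphM red) Dl_morph.
rewrite Tr_sum; apply: eqT_sum => k _; apply: eqTMl.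
have hm (x y : Zp) : x N = y N -> red (res2 (tau k * x)) = red (res2 (tau k * y)).
  by move=> xy; apply/res2_mod/digitsMl.
apply: eqTtrans (Tr_Dl u _ hm) _.
rewrite (big_rem_enum (fun a => 1 - X (a * u))) [X in eqT _ X _]mulrC.
apply: eqTMr; apply: eqTtrans (Tr_scale u (tau_rho k) res2_mod) _.
have -> : Tr N (rho k * u) (fun x => red (res2 x)) = Tr N (rho k * u) (residues2 (red \o c) e N).
  by apply: Tr_ext => x; rewrite /res2 rmorphD !rmorph_sum.
exact: Tr_residues2.
Qed.
End Difference.

(** * Relations between rational functions, and their one-variable specialization *)

Section GenericRing.
Variables (R : comNzRingType) (G T : finType).

Lemma prod_if (I : finType) (k : I) (x : R) (y : I -> R) :
  \prod_l (if l == k then x else y l) = x * \prod_(l | l != k) y l.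
Proof.
rewrite (bigD1 k) //= eqxx; congr (_ * _).
by apply: eq_bigr => l /negPf ->.
Qed.

(** Every term of a relation is written as a product over one index set, the shape that [transfer]
    takes: [inl (inl l)] is the variable of the [l]-th rational function, [inl (inr t)] that of the
    [t]-th monomial, and [inr _] that of the clearing monomial. *)
Definition relation_factor (num den : G -> R) (x0 : R) (xt : T -> R)
    (t : G + T) (g : G + T + 'I_1) : R :=
  match t, g with
  | inl k, inl (inl l) => if l == k then num l else den l
  | inl _, inl (inr _) => 1
  | inl _, inr _ => x0
  | inr _, inl (inl l) => den l
  | inr t, inl (inr t') => if t' == t then xt t' else 1
  | inr _, inr _ => 1
  end.

Lemma relation_product (num den : G -> R) x0 xt t :
  \prod_g relation_factor num den x0 xt t g =
  match t with
  | inl k => (num k * \prod_(l | l != k) den l) * x0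
  | inr t => xt t * \prod_l den l
  end.
Proof.
rewrite !big_sumType /= big_ord1; case: t => [k|t] /=.
  rewrite [X in _ * X * _]big1 // mulr1; congr (_ * _).
  rewrite -(prod_if k (num k)); apply: eq_bigr => l _.
  by case: eqP => // ->.
rewrite mulr1 [LHS]mulrC; congr (_ * _).
rewrite (eq_bigr (fun l => if l == t then xt t else 1)) => [|l _].
  by rewrite prod_if big1 ?mulr1.
by case: eqP => // ->.
Qed.

Lemma relation_sum (w : G -> R) (D : T -> R) num den x0 xt :
  \sum_(t : G + T) (match t with inl k => w k | inr t => - D t end) *
    \prod_g relation_factor num den x0 xt t g =
  (\sum_k w k * (num k * \prod_(l | l != k) den l)) * x0 -
  (\sum_t D t * xt t) * \prod_l den l.
Proof.
rewrite big_sumType !mulr_suml -sumrN; congr (_ + _); apply: eq_bigr => k _.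
  by rewrite relation_product; ring.
by rewrite relation_product; ring.
Qed.
End GenericRing.

Section PolynomialRelation.
Variables (F : fieldType) (G T : finType) (r : G -> nat) (s : T -> nat) (z : nat) (num den : {poly F}).

Definition relation_exp (g : G + T + 'I_1) : nat :=
  match g with inl (inl k) => r k | inl (inr t) => s t | inr _ => z end.

Lemma comp_factor t g :
  relation_factor (fun=> num) (fun=> den) 'X (fun=> 'X) t g \Po 'X^(relation_exp g) =
  relation_factor (fun k => num \Po 'X^(r k)) (fun k => den \Po 'X^(r k)) 'X^z (fun t => 'X^(s t)) t g.
Proof.
case: t g => [k|t] [[l|t']|i] /=; rewrite ?comp_polyX ?comp_polyC //.
  by case: ifP.
by case: ifP; rewrite ?comp_polyX ?comp_polyC.
Qed.

Lemma relation_poly (w : G -> F) (D : T -> F) :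
  \sum_t (match t with inl k => w k | inr t => - D t end) *: \prod_g
    (relation_factor (fun=> num) (fun=> den) 'X (fun=> 'X) t g \Po 'X^(relation_exp g)) = 0 ->
  (\sum_k w k *: ((num \Po 'X^(r k)) * \prod_(l | l != k) (den \Po 'X^(r l)))) * 'X^z =
  (\sum_t D t *: 'X^(s t)) * \prod_l (den \Po 'X^(r l)).
Proof.
move=> E; apply/eqP; rewrite -subr_eq0; apply/eqP; rewrite -[RHS]E.
pose num' k := num \Po 'X^(r k); pose den' k := den \Po 'X^(r k).
have := relation_sum (fun k => (w k)%:P) (fun t => (D t)%:P) num' den' 'X^z (fun t => 'X^(s t)).
under [X in _ = X * _ - _]eq_bigr do rewrite mul_polyC.
under [X in _ = _ - X * _]eq_bigr do rewrite mul_polyC.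
move=> <-; apply: eq_bigr => t _; rewrite -mul_polyC; congr (_ * _).
  by case: t => [//|t]; rewrite polyCN.
by apply: eq_bigr => i _; rewrite -comp_factor.
Qed.
End PolynomialRelation.

Section Relations.
Variables (p : nat) (p_pr : prime p).
Local Notation Zp := (padic_int p_pr).

(** A form that avoids 0 on all [g k], [g k - g l] and [g k + g l] takes values of distinct absolute
    values; the signs then make them positive. *)
Lemma form_signs (G : finType) (g : G -> Zp) (extra : seq Zp) :
  (forall k, g k != 0) ->
  (forall k l, k != l -> g k - g l != 0 /\ g k + g l != 0) ->
  exists (A : Zp -> Prop) (f : Zp -> int) (sgn : G -> bool),
    [/\ subgroup A, additive_on A f, forall k, A (g k), forall x, x \in extra -> A x &
     (forall k, 0 < f ((-1) ^+ sgn k * g k)) /\ injective (fun k => f ((-1) ^+ sgn k * g k))].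
Proof.
move=> g0 gd; have [A [sA gA hA]] := generic_form ([seq g k | k : G] ++ extra).
have Ag k : A (g k) by apply: gA; rewrite mem_cat map_f ?mem_enum.
pose T := [seq g k | k : G] ++ [seq g kl.1 - g kl.2 | kl <- enum {: G * G} & kl.1 != kl.2] ++
  [seq g kl.1 + g kl.2 | kl <- enum {: G * G} & kl.1 != kl.2].
have [f [addf fT]] : exists f, additive_on A f /\ forall t, t \in T -> f t != 0.
  apply: hA => t; rewrite !mem_cat => /or3P[/mapP [k _ ->]|/mapP [[k l]]|/mapP [[k l]]].
  - by split.
  - by rewrite mem_filter /= => /andP[kl _] ->; split; [apply: (proj2 sA)|case: (gd _ _ kl)].
  by rewrite mem_filter /= => /andP[kl _] ->; split; [apply: subgroupD|case: (gd _ _ kl)].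
have fk k : f (g k) != 0 by apply: fT; rewrite mem_cat map_f ?mem_enum.
have fs (b : bool) x : A x -> f ((-1) ^+ b * x) = (-1) ^+ b * f x.
  by case: b => Ax; rewrite ?mul1r // expr1 !mulN1r (additive_onN sA addf).
exists A, f, (fun k => f (g k) < 0); have fE k : f ((-1) ^+ (f (g k) < 0)%R * g k) = `|f (g k)|.
  by rewrite fs // -normrEsign.
split=> // [x xe|]; first by apply: gA; rewrite mem_cat xe orbT.
split=> [k|k l]; first by rewrite fE normr_gt0.
rewrite !fE => e; apply/eqP; apply: contraTT isT => kl.
have [e1|e1] : f (g k) = f (g l) \/ f (g k) = - f (g l) by move: e; lia.
  have := fT (g k - g l); rewrite addf // e1 subrr eqxx => -> //.
  rewrite !mem_cat; apply/or3P; apply: Or32.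
  by apply/mapP; exists (k, l) => //; rewrite mem_filter /= kl mem_enum.
have := fT (g k + g l); rewrite (additive_onD sA addf) // e1 addNr eqxx => -> //.
rewrite !mem_cat; apply/or3P; apply: Or33.
by apply/mapP; exists (k, l) => //; rewrite mem_filter /= kl mem_enum.
Qed.

Variables (K : fieldExtType (padic_field p_pr)) (pi : uniformizer K).
Local Notation F := (residue_field pi).
Local Notation X := (onepT_pow pi).

Lemma ev_factor (G T : finType) (gs : G -> Zp) (dl : T -> Zp) (a0 : Zp) (num den : {poly F}) t g :
  ev (match g with inl (inl k) => gs k | inl (inr t) => dl t | inr _ => a0 end)
    (relation_factor (fun=> num) (fun=> den) 'X (fun=> 'X) t g) =
  relation_factor (fun k => ev (gs k) num) (fun k => ev (gs k) den) (X a0) (fun t => X (dl t)) t g.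
Proof.
case: t g => [k|t] [[l|t']|i] /=; rewrite ?evX ?(rmorph1 (ev _)) //.
  by case: ifP.
by case: ifP; rewrite ?evX ?(rmorph1 (ev _)).
Qed.

(* The factor X^(a0) clears the negative exponents. *)
Lemma rational_relation (G T : finType) (gs : G -> Zp) (dl : T -> Zp) (D : T -> F) (w : G -> F)
    (num den : {poly F}) (k0 : G) (A : Zp -> Prop) (f : Zp -> int) :
  subgroup A -> additive_on A f -> (forall k, A (gs k)) -> (forall t, A (dl t)) ->
  (forall k, 0 < f (gs k)) ->
  (forall M, exists N, (M <= N)%N /\ eqT (p ^ N)
    (\sum_k fps_poly (w k)%:P * (ev (gs k) num * \prod_(l | l != k) ev (gs l) den))
    ((\sum_t fps_poly (D t)%:P * X (dl t)) * \prod_l ev (gs l) den)) ->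
  exists Z Q, (\sum_k w k *: ((num \Po 'X^`|f (gs k)|) *
      \prod_(l | l != k) (den \Po 'X^`|f (gs l)|))) * 'X^Z
    = Q * \prod_l (den \Po 'X^`|f (gs l)|).
Proof.
move=> sA addf Ag Ad fpos rel.
(* [Z] bounds every [|f (dl t)|] and [f (gs k0)] is at least 1, so adding [gs k0] [Z] times makes
   all exponents non-negative. *)
pose Z := (\sum_t `|f (dl t)|)%N.
pose dz t := dl t + gs k0 *+ Z; pose a0 := gs k0 *+ Z.
have fdz t : 0 <= f (dz t).
  rewrite /dz (additive_onD sA addf) //; last exact: subgroupMn.
  rewrite (additive_onMn sA addf (x := gs k0)) //.
  have : (`|f (dl t)| <= Z)%N by rewrite /Z (bigD1 t) //= leq_addr.
  have := fpos k0; set x := f (dl t); set y := f (gs k0) => y0 xZ.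
  have : (Z%:Z <= y *+ Z) by rewrite -mulr_natr natz; move: y0; clear; nia.
  by move: xZ; lia.
pose J : finType := (G + T + 'I_1)%type.
pose a (i : J) := match i with inl (inl k) => gs k | inl (inr t) => dz t | inr _ => a0 end.
pose phi : J -> nat := relation_exp (fun k => `|f (gs k)|%N) (fun t => `|f (dz t)|%N) `|f a0|%N.
have Aa i : A (a i).
  by case: i => [[k|t]|i] //=; [apply: subgroupD => //; apply: subgroupMn | apply: subgroupMn].
have fa i : f (a i) = phi i.
  case: i => [[k|t]|i] /=; rewrite gez0_abs //; first exact: ltW.
  by rewrite /a0 (additive_onMn sA addf) // mulrn_wge0 // ltW.
pose P (t : G + T) (i : J) : {poly F} := relation_factor (fun=> num) (fun=> den) 'X (fun=> 'X) t i.
pose B := (\max_(ti : (G + T) * J) size (P ti.1 ti.2))%N.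
have PB t i : (size (P t i) <= B.+1)%N.
  by apply: leqW; apply: (leq_bigmax (F := fun ti : (G + T) * J => size (P ti.1 ti.2)) (t, i)).
(* The box is finite, so its exponents are separated from some level [M] on, and [rel] holds at some
   level beyond it. *)
have [M hM] := padic_separate (fun j : {ffun J -> 'I_B.+1} => \sum_i a i *+ j i).
have {rel} [N' [MN rel]] := rel M.
pose e (t : G + T) := match t with inl k => w k | inr t => - D t end.
have E : \sum_t e t *: \prod_g (P t g \Po 'X^(phi g)) = 0.
apply: (@transfer p p_pr K pi J _ a phi e P B N' PB) => [j j' /(hM _ MN) /(congr1 f)|].
- rewrite !(additive_on_sum sA addf) => [|i _|i _]; try exact: subgroupMn.
  have fM (v : {ffun J -> 'I_B.+1}) : \sum_i f (a i *+ v i) = (\sum_g phi g * v g)%N%:R.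
    rewrite natr_sum; apply: eq_bigr => i _.
    by apply: etrans (additive_onMn sA addf (v i) (Aa i)) _; rewrite fa natrM natz mulr_natr.
  by rewrite !fM => /eqP; rewrite eqr_nat => /eqP.
- pose num' k := ev (gs k) num; pose den' k := ev (gs k) den.
  pose w' (t : G + T) : {fps F} := match t with inl k => fps_poly (w k)%:P | inr t => - fps_poly (D t)%:P end.
  have -> : \sum_t fps_poly (e t)%:P * \prod_g ev (a g) (P t g) =
      \sum_t w' t * \prod_g relation_factor num' den' (X a0) (fun t => X (dz t)) t g.
    apply: eq_bigr => t _; congr (_ * _).
      by case: t => [//|t]; rewrite /w' /e (rmorphN (@polyC F)) (rmorphN (@fps_poly F)).
    by apply: eq_bigr => i _; exact: ev_factor.
  have -> := relation_sum (fun k => fps_poly (w k)%:P) (fun t => fps_poly (D t)%:P) num' den' (X a0) (fun t => X (dz t)).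
  apply: eqT_subr0'; apply: eqTtrans (eqTMr (X a0) rel) _.
  have -> : \sum_t fps_poly (D t)%:P * X (dz t) = (\sum_t fps_poly (D t)%:P * X (dl t)) * X a0.
    rewrite [RHS]mulr_suml; apply: eq_bigr => t _; rewrite -[RHS]mulrA; congr (_ * _); exact: onepT_powD.
  by rewrite [X in eqT _ _ X]mulrAC; exact: eqTrefl.
exists `|f a0|%N, (\sum_t D t *: 'X^`|f (dz t)|).
exact: (relation_poly (s := fun t => `|f (dz t)|%N) (z := `|f a0|%N) E).
Qed.
End Relations.

(** * Quotients of pseudo-polynomials *)

Lemma prod_pair_neq (R : comNzRingType) (I H : finType) (y : I -> H -> R) (i : I) (k : H) :
  (\prod_(j | j != i) \prod_l y j l) * \prod_(l | l != k) y i l =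
  \prod_(g : I * H | g != (i, k)) y g.1 g.2.
Proof.
rewrite pair_big_dep /= [RHS](bigID (fun g : I * H => g.1 != i)) /=; congr (_ * _).
  apply: eq_bigl => -[j l] /=; rewrite andbT xpair_eqE.
  by case: (j == i); rewrite ?andbF ?andbT.
rewrite (reindex_onto (fun l => (i, l)) snd) /= => [|[j l] /= /andP[_ /negPn /eqP -> //]].
by apply: eq_bigl => l; rewrite xpair_eqE !eqxx /= !andbT.
Qed.

Lemma mul_double_sum (R : comNzRingType) (I H : finType) (b y : H -> R) (q a : I -> R) :
  (\sum_l b l * y l) * (\sum_i q i * a i) = \sum_i \sum_l (q i * b l) * (y l * a i).
Proof.
rewrite mulr_sumr; apply: eq_bigr => i _; rewrite mulr_suml.
by apply: eq_bigr => l _; ring.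
Qed.

Lemma swap_sums (R : comNzRingType) (I H L : finType) (q : I -> R) (z : H -> R) (b : H -> L -> R)
    (x : I -> H -> L -> R) (C : H -> L -> R) (D : I -> H -> L -> R) :
  (forall k y, C k y = z k * b k y) -> (forall i k y, D i k y = q i * b k y) ->
  \sum_i q i * \sum_k \sum_y C k y * x i k y = \sum_k z k * \sum_i \sum_y D i k y * x i k y.
Proof.
move=> hC hD; under eq_bigr do rewrite mulr_sumr.
rewrite exchange_big; apply: eq_bigr => k _; rewrite mulr_sumr; apply: eq_bigr => i _.
by rewrite !mulr_sumr; apply: eq_bigr => y _; rewrite hC hD; ring.
Qed.

Lemma sum_pair (R : comNzRingType) (I H : finType) (r : I -> R) (z : H -> R) (D Y : I * H -> R) :
  (forall t k, D (t, k) = r t * z k) ->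
  \sum_k z k * \sum_t r t * Y (t, k) = \sum_tk D tk * Y tk.
Proof.
move=> hD; transitivity (\sum_t \sum_k D (t, k) * Y (t, k)); last first.
  by rewrite pair_bigA; apply: eq_bigr => -[].
rewrite [RHS]exchange_big; apply: eq_bigr => k _; rewrite mulr_sumr; apply: eq_bigr => t _.
by rewrite hD; ring.
Qed.

Lemma clear_den1 (R : comNzRingType) (I H : finType) (q t : I -> R) (y : I -> H -> R) :
  (\sum_i q i * t i) * \prod_(g : I * H) y g.1 g.2 =
  \sum_i q i * (\prod_(j | j != i) \prod_l y j l) * (\prod_k y i k * t i).
Proof.
rewrite mulr_suml; apply: eq_bigr => i _.
by rewrite -(pair_bigA _ y) /= (bigD1 i) //=; ring.
Qed.

Lemma clear_den2 (R : comNzRingType) (I H : finType) (q : I -> R) (y v E : I -> H -> R) (w : I * H -> R) :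
  (forall i k, w (i, k) = q i * v i k) ->
  \sum_i q i * (\prod_(j | j != i) \prod_l y j l) *
    (\sum_k v i k * (E i k * \prod_(l | l != k) y i l)) =
  \sum_g w g * (E g.1 g.2 * \prod_(g' | g' != g) y g'.1 g'.2).
Proof.
move=> hw; transitivity (\sum_i \sum_k w (i, k) * (E i k * \prod_(g' | g' != (i, k)) y g'.1 g'.2)).
  apply: eq_bigr => i _; rewrite mulr_sumr; apply: eq_bigr => k _.
  by rewrite -prod_pair_neq hw; ring.
by rewrite pair_bigA; apply: eq_bigr => -[].
Qed.

Lemma no_laurent_comp (F : fieldType) (c : nat -> F) (e : nat) (I : finType) (r : I -> nat)
    (w : I -> F) (Z : nat) (D : {poly F}) :
  2%:R != 0 :> F -> (0 < e)%N -> (forall n, c (n + e)%N = c n) -> c 1%N = 1 ->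
  I -> (forall k, 0 < r k)%N -> injective r -> (forall k, w k != 0) ->
  (\sum_k w k *: ((num2 c e \Po 'X^(r k)) * \prod_(l | l != k) ((1 - 'X^e) \Po 'X^(r l)))) * 'X^Z
    <> D * \prod_l ((1 - 'X^e) \Po 'X^(r l)).
Proof.
have comp l : (1 - 'X^e : {poly F}) \Po 'X^(r l) = 1 - 'X^(e * r l).
  by rewrite comp_polyB comp_polyC comp_Xn_poly -exprM mulnC.
have hP (P : pred I) : \prod_(l | P l) ((1 - 'X^e : {poly F}) \Po 'X^(r l)) = \prod_(l | P l) (1 - 'X^(e * r l)).
  by apply: eq_bigr => l _; exact: comp.
move=> two0 e0 per one i0 r0 rinj w0; rewrite hP.
rewrite (eq_bigr (fun k => w k *: ((num2 c e \Po 'X^(r k)) * \prod_(l | l != k) (1 - 'X^(e * r l))))) => [|k _].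
  exact: no_laurent.
by rewrite hP.
Qed.

Section PseudoPolynomials.
Variables (p : nat) (p_pr : prime p) (K : fieldExtType (padic_field p_pr)).
Variable pi : uniformizer K.
Local Notation Zp := (padic_int p_pr).
Local Notation F := (residue_field pi).
Local Notation X := (onepT_pow pi).

Lemma ev_one_sub (z : Zp) e : ev z (1 - 'X^e : {poly F}) = 1 - X (z *+ e).
Proof.
have h := @evXn _ _ _ pi 0 z; rewrite expr0 mulr0n onepT_pow0 in h.
by rewrite (ev_zmod z 1 'X^e) evXn h.
Qed.

Lemma pseudo_polynomial_sum (P : {fps F}) : pseudo_polynomial P ->
  exists n (q : 'I_n -> F) (a : 'I_n -> Zp),
    [/\ P = \sum_i fps_poly (q i)%:P * X (a i), injective a & forall i, q i != 0].
Proof.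
move=> [s ->]; pose q (a : Zp) := \sum_(ca <- s | ca.2 == a) ca.1.
pose r := [seq a <- undup [seq ca.2 | ca <- s] | q a != 0].
have r_uniq : uniq r by rewrite filter_uniq ?undup_uniq.
exists (size r), (fun i => q (tnth (in_tuple r) i)), (tnth (in_tuple r)); split.
- have E (t : seq Zp) : \sum_(i < size t) fps_poly (q (tnth (in_tuple t) i))%:P * X (tnth (in_tuple t) i)
    = \sum_(a <- t) fps_poly (q a)%:P * X a by rewrite [RHS]big_tnth.
  rewrite E; apply: eqT_all => n k _; rewrite !fps_sum big_filter.
  rewrite [RHS]big_mkcond /=.
  rewrite (eq_bigr (fun a => \sum_(ca <- s | ca.2 == a) ca.1 * X ca.2 k)) => [|a _]; last first.
    rewrite (eq_bigr (fun ca => ca.1 * X a k)) => [|ca /eqP -> //].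
    rewrite -mulr_suml -/(q a); case: ifP => [_|/negbFE/eqP ->]; last by rewrite mul0r.
    exact: fpsCM.
  rewrite [RHS](exchange_big_dep predT) // [LHS]big_seq [RHS]big_seq; apply: eq_bigr => ca cas.
  rewrite [LHS]fpsCM -big_filter (_ : filter _ _ = [:: ca.2]) ?big_seq1 //.
  rewrite (eq_filter (a2 := pred1 ca.2)) => [|a]; last by rewrite /= eq_sym.
  by rewrite filter_pred1_uniq ?undup_uniq // mem_undup map_f.
- by apply/tuple_uniqP.
- by move=> i; have := mem_tnth i (in_tuple r); rewrite mem_filter => /andP[].
Qed.
End PseudoPolynomials.

Section NotPseudoRational.
Variables (p : nat) (p_pr : prime p) (p_odd : odd p).
Variables (d : nat) (d_gt0 : (0 < d)%N) (p_ndvd_d : ~~ (p %| d)%N).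
Variables (K : fieldExtType (padic_field p_pr)).
Local Notation Zp := (padic_int p_pr).
Local Notation O := (int_ring K).
Local Notation emb := (@padic_int_emb p p_pr K).
Variables (zeta zeta' : Zp) (delta : nat).
Hypotheses (zz : zeta' * zeta = 1) (prim_zeta : p.-1.-primitive_root zeta).
Hypothesis (prim_resF : p.-1.-primitive_root (resF zeta)).
Variable c : nat -> O.
Hypotheses (c_per : forall i, c (i + d)%N = c i) (c_mul : forall i, c (p * i)%N = c p * c i).
Hypothesis c1 : c 1%N = 1.
Let C0 := \sum_(l < d) c l.
Hypotheses (HC1 : C0 = 0 \/ ~~ (p.-1 %| delta.+1)%N) (HC2 : C0 = 0 \/ ~~ (p.-1 %| delta)%N).
Variable sg : O.
Hypothesis c_sym : forall i j, (d %| i + j)%N -> c j = sg * c i.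
Hypothesis sg_delta : sg * (-1) ^+ delta.+1 = 1.
Hypothesis HR : (3 < p)%N \/ C0 = 0.
Local Notation Beta := (@beta p p_pr d K zeta' delta c).
Local Notation kpow := (@padic_pow p p_pr d).
Variable f : {fps O}.
Variable pi : uniformizer K.
Local Notation F := (residue_field pi).
Local Notation red := (@reduction p p_pr K pi).
Local Notation X := (onepT_pow pi).
Hypothesis f_level : forall N, eqT (p ^ N) (fps_map red f) (level_fps d zeta' delta c pi N).

Let p_gt0 : (0 < p)%N. Proof. exact: prime_gt0. Qed.
Let p1_gt0 : (0 < p.-1)%N. Proof. by have := prime_gt1 p_pr; lia. Qed.
Let p_gt2 : (2 < p)%N. Proof. by have := prime_gt1 p_pr; have := p_odd; case: (p) => [|[|[|]]]. Qed.
Let h := (p.-1)./2.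
Let p_h : p.-1 = (h + h)%N.
Proof. by rewrite addnn halfK; have := p_odd; case: (p) p_gt2 => //= n _ /negPf ->; rewrite subn0. Qed.

Lemma two_neq0 : 2%:R != 0 :> F.
Proof. by rewrite natrF_eq0; apply/negP => /dvdn_leq; lia. Qed.

Lemma zeta_half : zeta ^+ h = -1.
Proof.
have : (zeta ^+ h) ^+ 2 = 1 by rewrite -exprM muln2 -addnn -p_h (prim_expr_order prim_zeta).
move/eqP; rewrite sqrf_eq1 => /orP[|/eqP //].
by rewrite -(prim_order_dvd prim_zeta) => /dvdn_leq; have := p_h; lia.
Qed.

Lemma zetaV_half : zeta' ^+ h = -1.
Proof.
have : zeta' ^+ h * zeta ^+ h = 1 by rewrite -exprMn zz expr1n.
by rewrite zeta_half mulrN1 => e; apply: oppr_inj; rewrite e opprK.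
Qed.

(** [level_fps] involves the measure at units of [Z_p] only. Restricting the measure to units
    amounts to dropping the values of [c] at multiples of [p], at the price of the period [p d]. *)
Definition cstar i := if (p %| i)%N then 0 else c i.
Definition betastar N (x : Zp) := if x 1%N == 0%N then 0 else Beta N x.

Lemma unit_level (x : Zp) N : (0 < N)%N -> (p %| x N)%N = (x 1%N == 0%N).
Proof.
move=> N0; rewrite -(digits_small x 1) expn1 /dvdn.
by have := digits_small_mod x N0; rewrite expn1 => ->.
Qed.

Lemma unit_mul (x : Zp) (k : nat) : ((zeta' ^+ k * x) 1%N == 0%N) = (x 1%N == 0%N).
Proof.
rewrite -!resF_eq0 rmorphM mulf_eq0 rmorphXn expf_eq0.
have : resF zeta' * resF zeta == 1 by rewrite -rmorphM zz rmorph1.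
case: (eqVneq (resF zeta') 0) => [->|_ _]; first by rewrite mul0r eq_sym oner_eq0.
by rewrite andbF.
Qed.

Lemma residue_dvd N (x : Zp) i : (0 < N)%N -> (i %% p ^ N == x N)%N -> (p %| i)%N = (x 1%N == 0%N).
Proof.
move=> N0 /eqP e; rewrite -(unit_level x N0) -e.
by rewrite /dvdn modn_dvdm // -[X in (X %| _)%N]expn1 dvdn_exp2l.
Qed.

Lemma Asum_star N (x : Zp) : (0 < N)%N ->
  Asum d cstar N x = if x 1%N == 0%N then 0 else Asum d c N x.
Proof.
move=> N0; rewrite /Asum; case: ifP => x1; [apply: big1|apply: eq_bigr] => i ix;
  rewrite /cstar (residue_dvd N0 ix) x1 ?mulr0 //.
Qed.

Lemma Csum_star N (x : Zp) : (0 < N)%N ->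
  Csum d cstar N x = if x 1%N == 0%N then 0 else Csum d c N x.
Proof.
move=> N0; rewrite /Csum; case: ifP => x1; [apply: big1|apply: eq_bigr] => i ix;
  rewrite /cstar (residue_dvd N0 ix) x1 //.
Qed.

Lemma betaS_star N (x : Zp) : (0 < N)%N ->
  betaS d zeta' delta cstar N x = if x 1%N == 0%N then 0 else betaS d zeta' delta c N x.
Proof.
move=> N0; rewrite /betaS; case: ifP => x1; [apply: big1|apply: eq_bigr] => k _;
  by rewrite Asum_star // unit_mul x1 ?mulr0.
Qed.

Lemma betastarE N (x : Zp) : (0 < N)%N ->
  (d * p ^ N)%:R * betastar N x = - betaS d zeta' delta cstar N x.
Proof.
move=> N0; rewrite betaS_star // /betastar; case: ifP => _; first by rewrite mulr0 oppr0.
exact: (betaE d_gt0 p_ndvd_d zz prim_zeta c_per HC1).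
Qed.

Lemma betastar_mod N (x y : Zp) : (0 < N)%N -> x N = y N -> betastar N x = betastar N y.
Proof. by move=> N0 e; rewrite /betastar (digits_le N0 e) (beta_mod d zeta' delta c e). Qed.

Lemma cstar_per i : cstar (i + p * d)%N = cstar i.
Proof. by rewrite /cstar dvdn_addl ?dvdn_mulr // addnC periodicMn. Qed.

Lemma cstar_sym i : (i <= p * d)%N -> cstar (p * d - i)%N = sg * cstar i.
Proof.
move=> id; rewrite /cstar; have -> : (p %| p * d - i)%N = (p %| i)%N.
  by rewrite dvdn_subr // dvdn_mulr.
case: ifP => _; first by rewrite mulr0.
by apply: c_sym; rewrite subnKC // dvdn_mull.
Qed.

Definition coefw (sgn : 'I_h -> bool) (k : 'I_h) : F := red (emb (((-1) ^+ sgn k * zeta' ^+ k) ^+ delta)).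

Lemma coefw_neq0 sgn k : coefw sgn k != 0.
Proof.
rewrite /coefw; apply/eqP => e0.
have : red (emb (((-1) ^+ sgn k * zeta' ^+ k) ^+ delta)) * red (emb (((-1) ^+ sgn k * zeta ^+ k) ^+ delta)) = 1.
  by rewrite -(rmorphM red) -(rmorphM emb) -exprMn (tau_rho zz) expr1n !rmorph1.
by rewrite e0 mul0r => /esym/eqP; rewrite oner_eq0.
Qed.

Lemma Tr_betastar N u (sgn : 'I_h -> bool) : (0 < N)%N -> eqT (p ^ N)
  (\prod_k (1 - X ((p * d)%:R * ((-1) ^+ sgn k * zeta ^+ k) * u)) * Tr N u (red \o betastar N))
  (\sum_k fps_poly (coefw sgn k)%:P *
     (ev ((-1) ^+ sgn k * zeta ^+ k * u) (num2 (red \o cstar) (p * d)) *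
      \prod_(l | l != k) (1 - X ((p * d)%:R * ((-1) ^+ sgn l * zeta ^+ l) * u)))).
Proof.
move=> N0; apply: (@Tr_beta p p_pr d K zeta zeta' delta cstar (p * d) N zz cstar_per _ sg cstar_sym sg_delta h p_h zetaV_half sgn).
- by rewrite mulnC dvdn_mul // -[X in (X %| _)%N]expn1 dvdn_exp2l.
- case: HR => [p3|C00]; first by left; have := p_h; lia.
  by right=> x; rewrite Csum_star // (CsumE d_gt0 p_ndvd_d c_per) // -/C0 C00 if_same.
- by move=> x; apply: betastarE.
- by rewrite muln_gt0 d_gt0 expn_gt0 p_gt0.
- by move=> x y; apply: betastar_mod.
Qed.

Section Quotient.
Variables (nq np : nat) (q : 'I_nq -> F) (a : 'I_nq -> Zp) (r : 'I_np -> F) (b : 'I_np -> Zp).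
Hypotheses (a_inj : injective a) (q0 : forall i, q i != 0) (i0 : 'I_nq).
Hypothesis fQ : fps_map red f * (\sum_i fps_poly (q i)%:P * X (a i)) = \sum_t fps_poly (r t)%:P * X (b t).
Let u i := kpow (- a i).

Definition rhs_coef (tk : 'I_np * 'I_p.-1) : F := r tk.1 * red (emb (zeta' ^+ (tk.2 * delta))).
Definition rhs_exp (tk : 'I_np * 'I_p.-1) : Zp := zeta ^+ tk.2 * kpow (- b tk.1).

(** The product [f Q = P] is a relation between powers of [1 + T]; relabelling along
    [x -> (1 + T)^(zeta^k kappa^(-x))], which passes from level [N] to level [N + 1], turns addition
    of exponents into multiplication by [u i]. *)
Lemma level_relation N k : eqT (p ^ N.+1)
  (\sum_i \sum_(y < p ^ N) fps_poly (q i * red (Beta N.+1 (kpow (- y%:R))))%:P * X (zeta ^+ k * kpow (- y%:R) * u i))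
  (\sum_t fps_poly (r t)%:P * X (zeta ^+ k * kpow (- b t))).
Proof.
pose J : finType := ('I_nq * 'I_(p ^ N) + 'I_np)%type.
pose cf (j : J) : F := match j with inl iy => q iy.1 * red (Beta N.+1 (kpow (- iy.2%:R))) | inr t => - r t end.
pose z (j : J) : Zp := match j with inl iy => iy.2%:R + a iy.1 | inr t => b t end.
pose G (x : Zp) := X (zeta ^+ k * kpow (- x)).
have split_J (H : Zp -> {fps F}) : \sum_j fps_poly (cf j)%:P * H (z j) =
    (\sum_i \sum_(y < p ^ N) fps_poly (q i * red (Beta N.+1 (kpow (- y%:R))))%:P * H (y%:R + a i)) -
    (\sum_t fps_poly (r t)%:P * H (b t)).
  rewrite big_sumType /= -(pair_big predT predT (fun i (y : 'I_(p ^ N)) => fps_poly (q i * red (Beta N.+1 (kpow (- y%:R))))%:P * H (y%:R + a i))) /=.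
  rewrite -sumrN; congr (_ + _); apply: eq_bigr => t _.
  by rewrite (rmorphN (@polyC F)) (rmorphN (@fps_poly F)) mulNr.
have hG (x y : Zp) : x N = y N -> eqT (p ^ N.+1) (G x) (G y).
  move=> e; apply: onepT_pow_eqT; apply: digitsMl.
  by apply/(padic_pow_eq p_odd p_ndvd_d); rewrite !digitsN e.
have rel : eqT (p ^ N) (\sum_j fps_poly (cf j)%:P * X (z j)) 0.
  rewrite split_J -fQ; apply: eqT_subr0'.
  have e1 := eqTMr (\sum_i fps_poly (q i)%:P * X (a i)) (@f_level N).
  apply: eqTtrans _ (eqTsym e1).
  rewrite /level_fps mul_double_sum; apply: eqT_sum => i _; apply: eqT_sum => y _ n _.
  congr ((_ * _ : {fps F}) n); last exact: onepT_powD.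
  by rewrite (rmorphM (@polyC F)) (rmorphM (@fps_poly F)).
have := onepT_relabel hG rel; rewrite split_J => /eqT_subr0 e2.
apply: eqTtrans _ e2; apply: eqT_sum => i _; apply: eqT_sum => y _.
by rewrite /G opprD (padic_powD p_odd p_ndvd_d) mulrA.
Qed.

Lemma Tr_betastar_units N v : eqT (p ^ N.+1) (Tr N.+1 v (red \o betastar N.+1))
  (\sum_(k < p.-1) \sum_(y < p ^ N) fps_poly (red (emb (zeta' ^+ (k * delta))) * red (Beta N.+1 (kpow (- y%:R))))%:P *
    X (zeta ^+ k * kpow (- y%:R) * v)).
Proof.
move=> j jN; pose G (x : Zp) := red (Beta N.+1 x) * X (x * v) j.
have hG (x y : Zp) : x N.+1 = y N.+1 -> G x = G y.
  move=> e; rewrite /G (beta_mod d zeta' delta c e); congr (_ * _).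
  by apply: (onepT_pow_eqT pi _) jN; rewrite mulrC [y * v]mulrC; apply: digitsMl.
have E := units_reindex p_odd p_ndvd_d prim_resF hG.
rewrite /Tr [LHS]fps_sum; transitivity (\sum_(x < p ^ N.+1 | ~~ (p %| x)%N) G x%:R).
  rewrite [RHS]big_mkcond; apply: eq_bigr => x _; rewrite [LHS]fpsCM /= /betastar.
  rewrite -(unit_level x%:R (ltn0Sn N)) digits_nat modn_small //.
  by case: ifP => _ //=; rewrite rmorph0 mul0r.
rewrite -E fps_sum; apply: eq_bigr => k _; rewrite fps_sum; apply: eq_bigr => y _.
by rewrite [RHS]fpsCM /G (beta_zeta p_odd d_gt0 p_ndvd_d zz prim_zeta c_per HC1) (rmorphM red).
Qed.

(** The relations for all [k] are added with the weights [zeta'^(k delta)] by which the measure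
    transforms; this assembles the transforms over all units. *)
Lemma Tr_relation N : eqT (p ^ N.+1)
  (\sum_i fps_poly (q i)%:P * Tr N.+1 (u i) (red \o betastar N.+1))
  (\sum_tk fps_poly (rhs_coef tk)%:P * X (rhs_exp tk)).
Proof.
have e1 : eqT (p ^ N.+1) (\sum_i fps_poly (q i)%:P * Tr N.+1 (u i) (red \o betastar N.+1))
  (\sum_(k < p.-1) fps_poly (red (emb (zeta' ^+ (k * delta))))%:P *
    (\sum_i \sum_(y < p ^ N) fps_poly (q i * red (Beta N.+1 (kpow (- y%:R))))%:P * X (zeta ^+ k * kpow (- y%:R) * u i))).
  apply: (@eqTtrans _ _ _ (\sum_i fps_poly (q i)%:P * (\sum_(k < p.-1) \sum_(y < p ^ N)
      fps_poly (red (emb (zeta' ^+ (k * delta))) * red (Beta N.+1 (kpow (- y%:R))))%:P * X (zeta ^+ k * kpow (- y%:R) * u i)))).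
    by apply: eqT_sum => i _; apply: eqTMl; apply: Tr_betastar_units.
  pose bb (_ : 'I_p.-1) (y : 'I_(p ^ N)) := fps_poly (red (Beta N.+1 (kpow (- y%:R))))%:P.
  have hM (x y : F) : fps_poly (x * y)%:P = fps_poly x%:P * fps_poly y%:P.
    by rewrite (rmorphM (@polyC F)) (rmorphM (@fps_poly F)).
  move=> j _; congr ((_ : {fps F}) j).
  apply: (@swap_sums {fps F} _ _ _ (fun i => fps_poly (q i)%:P) _ bb
    (fun i k y => X (zeta ^+ k * kpow (- y%:R) * u i))) => [k y|i k y]; exact: hM.
apply: eqTtrans e1 _.
apply: (@eqTtrans _ _ _ (\sum_(k < p.-1) fps_poly (red (emb (zeta' ^+ (k * delta))))%:P *
    \sum_t fps_poly (r t)%:P * X (zeta ^+ k * kpow (- b t)))).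
  by apply: eqT_sum => k _; apply: eqTMl; apply: level_relation.
move=> j _; congr ((_ : {fps F}) j).
apply: (@sum_pair {fps F} _ _ (fun t => fps_poly (r t)%:P) _ (fun tk => fps_poly (rhs_coef tk)%:P)
  (fun tk => X (rhs_exp tk))) => t k.
by rewrite (rmorphM (@polyC F)) (rmorphM (@fps_poly F)).
Qed.

Lemma resF_kpow i : resF (u i) = 1. Proof. exact: padic_pow1. Qed.

Lemma resF_zu i k : resF (zeta ^+ k * u i) = resF zeta ^+ k.
Proof. by rewrite rmorphM rmorphXn /= resF_kpow mulr1. Qed.

Lemma zeta_u_neq0 i k : zeta ^+ k * u i != 0.
Proof.
apply/eqP => e0; have := resF_zu i k; rewrite e0 rmorph0 => /esym/eqP.
rewrite expf_eq0 => /andP[_ /eqP z0]; have := prim_expr_order prim_resF.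
by rewrite z0 expr0n gtn_eqF // => /esym/eqP; rewrite oner_eq0.
Qed.

(** Only half of the roots of unity occur, so [zeta^k] and [-zeta^l = zeta^(h+l)] never agree modulo
    [p]; for equal [k] and [l], the distinct [a i] give distinct powers of [kappa]. *)
Lemma zeta_u_neq (i j : 'I_nq) (k l : 'I_h) : (i, k) != (j, l) ->
  zeta ^+ k * u i - zeta ^+ l * u j != 0 /\ zeta ^+ k * u i + zeta ^+ l * u j != 0.
Proof.
have kp (m : 'I_h) : (m < p.-1)%N by have := ltn_ord m; have := p_h; lia.
have r_inj m n : (m < p.-1)%N -> (n < p.-1)%N -> resF zeta ^+ m = resF zeta ^+ n -> m = n.
  by move=> hm hn /eqP; rewrite (eq_prim_root_expr prim_resF) !modn_small // => /eqP.
have zu (m : nat) : zeta ^+ m != 0.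
  by apply/eqP => e0; have := zeta_u_neq0 i m; rewrite e0 mul0r eqxx.
move=> ne; split; apply/eqP.
  move/eqP; rewrite subr_eq0 => /eqP e1; have := congr1 (@resF p p_pr) e1; rewrite !resF_zu.
  move=> /r_inj -/(_ (kp _) (kp _)) kl; move: e1 ne; rewrite kl => /(mulfI (zu _)).
  move/(padic_pow_inj p_odd p_ndvd_d)/oppr_inj/a_inj => ->.
  by rewrite (val_inj kl) eqxx.
move/eqP; rewrite addr_eq0 -[- (zeta ^+ l * _)]mulN1r -zeta_half mulrA -exprD => /eqP e1.
have := congr1 (@resF p p_pr) e1; rewrite !resF_zu => /r_inj.
have := ltn_ord k; have := ltn_ord l; have := p_h => ? ? ? /(_ _ _); lia.
Qed.

Lemma quotient_absurd : False.
Proof.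
pose g (ik : 'I_nq * 'I_h) := zeta ^+ ik.2 * u ik.1.
have gd k l : k != l -> g k - g l != 0 /\ g k + g l != 0.
  by case: k l => [i k] [j l]; apply: zeta_u_neq.
have h0 : (0 < h)%N by have := p_h; lia.
have g0 k : g k != 0 by exact: zeta_u_neq0.
have [A [ff [sgn [sA addf Ag Ae [fpos f_inj]]]]] := form_signs (codom rhs_exp) g0 gd.
pose gs ik := (-1) ^+ sgn ik * g ik.
(* The signs depend on the whole pair, so [Tr_betastar] is used with its own choice of signs for
   each [i]. *)
pose w (ik : 'I_nq * 'I_h) := q ik.1 * coefw (fun k => sgn (ik.1, k)) ik.2.
pose num := num2 (red \o cstar) (p * d); pose den : {poly F} := 1 - 'X^(p * d).
have Ags k : A (gs k).
  by rewrite /gs; case: (sgn k); rewrite ?mul1r // expr1 mulN1r; apply: subgroupN.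
have Ar t : A (rhs_exp t) by apply: Ae; apply: codom_f.
pose y i k := 1 - X ((p * d)%:R * ((-1) ^+ sgn (i, k) * zeta ^+ k) * u i).
have yE ik : ev (gs ik) den = y ik.1 ik.2.
  case: ik => i k; rewrite /den ev_one_sub /y; congr (1 - X _).
  by rewrite -(mulr_natl (gs (i, k))) /gs /g /= !mulrA.
have rel M : exists N, (M <= N)%N /\ eqT (p ^ N)
    (\sum_k fps_poly (w k)%:P * (ev (gs k) num * \prod_(l | l != k) ev (gs l) den))
    ((\sum_t fps_poly (rhs_coef t)%:P * X (rhs_exp t)) * \prod_l ev (gs l) den).
  exists M.+1; split; first exact: leqnSn.
  (* Multiplying [Tr_relation] by all denominators at once lets [Tr_betastar] replace each transform
     by its numerators. *)
  have e1 := eqTsym (eqTMr (\prod_g y g.1 g.2) (@Tr_relation M)).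
  rewrite clear_den1 in e1.
  have e2 : eqT (p ^ M.+1)
    (\sum_i fps_poly (q i)%:P * (\prod_(j | j != i) \prod_l y j l) *
       (\prod_k y i k * Tr M.+1 (u i) (red \o betastar M.+1)))
    (\sum_i fps_poly (q i)%:P * (\prod_(j | j != i) \prod_l y j l) *
       (\sum_k fps_poly (coefw (fun k => sgn (i, k)) k)%:P * (ev (gs (i, k)) num * \prod_(l | l != k) y i l))).
    apply: eqT_sum => i _; apply: eqTMl.
    apply: eqTtrans (Tr_betastar (u i) (fun k => sgn (i, k)) (ltn0Sn M)) _.
    by apply: eqT_sum => k _; apply: eqTMl; rewrite /gs /g mulrA.
  have hw i k : fps_poly (w (i, k))%:P = fps_poly (q i)%:P * fps_poly (coefw (fun k => sgn (i, k)) k)%:P.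
    by rewrite (rmorphM (@polyC F)) (rmorphM (@fps_poly F)).
  have e3 := @clear_den2 {fps F} _ _ _ y _ (fun i k => ev (gs (i, k)) num) (fun ik => fps_poly (w ik)%:P) hw.
  have e4 : eqT (p ^ M.+1)
    (\sum_k fps_poly (w k)%:P * (ev (gs k) num * \prod_(l | l != k) ev (gs l) den))
    (\sum_g fps_poly (w g)%:P * (ev (gs (g.1, g.2)) num * \prod_(g' | g' != g) y g'.1 g'.2)).
    apply: eqT_sum => -[i k] _; apply: eqTMl; apply: eqTMl; apply: eqT_prod => l _.
    by rewrite yE.
  have e5 : eqT (p ^ M.+1) (\prod_l y l.1 l.2) (\prod_l ev (gs l) den).
    by apply: eqT_prod => l _; rewrite yE.
  apply: eqTtrans e4 (eqTtrans (eqTsym (eqTtrans e1 _)) (eqTMl _ e5)).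
  by apply: eqTtrans e2 _ => j _; congr ((_ : {fps F}) j); exact: e3.
have [Z [Q]] := rational_relation (i0, Ordinal h0) sA addf Ags Ar fpos rel.
have per n : (red \o cstar) (n + p * d)%N = (red \o cstar) n by rewrite /= cstar_per.
have one : (red \o cstar) 1%N = 1.
  by rewrite /= /cstar dvdn1 (gtn_eqF (prime_gt1 p_pr)) c1 rmorph1.
have pd0 : (0 < p * d)%N by rewrite muln_gt0 p_gt0.
have w0 k : w k != 0 by rewrite mulf_neq0 ?coefw_neq0.
have r_gt0 k : (0 < `|ff (gs k)|)%N by rewrite absz_gt0; apply/eqP => e0; have := fpos k; rewrite -/(gs k) e0 ltxx.
have r_inj : injective (fun k => `|ff (gs k)|%N).
  move=> k l e; apply: f_inj; rewrite -/(gs k) -/(gs l).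
  by have := fpos k; have := fpos l; rewrite -/(gs k) -/(gs l); move: e; clear; lia.
exact: (no_laurent_comp two_neq0 pd0 per one (i0, Ordinal h0) r_gt0 r_inj w0).
Qed.
End Quotient.

Theorem not_pseudo_rational : ~ pseudo_rational (fps_map red f).
Proof.
move=> [P [Q [/pseudo_polynomial_sum [np [r [b [-> _ _]]]] /pseudo_polynomial_sum [nq [q [a [-> a_inj q0]]]] Q0 fQ]]].
case: nq q a a_inj q0 Q0 fQ => [|nq] q a a_inj q0 Q0 fQ; first by rewrite big_ord0 eqxx in Q0.
exact: (quotient_absurd a_inj q0 ord0 fQ).
Qed.
End NotPseudoRational.

(** * The bound on lambda *)

Lemma cancel_factor (R : comNzRingType) (I : finType) (w n dn s : I -> R) (S : R) :
  \sum_k w k * ((n k * s k) * \prod_(l | l != k) (dn l * s l)) - \prod_l (dn l * s l) * S =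
  (\prod_l s l) * (\sum_k w k * (n k * \prod_(l | l != k) dn l) - \prod_l dn l * S).
Proof.
rewrite mulrBr mulr_sumr; congr (_ - _); last by rewrite big_split /=; ring.
apply: eq_bigr => k _; rewrite big_split /= (bigD1 k (P := predT)) //=; ring.
Qed.

Lemma coef_exp_1pX (F : fieldType) m : ((1 + 'X : {poly F}) ^+ m)`_m = 1.
Proof.
have -> : 1 + 'X = 'X - (-1)%:P :> {poly F} by rewrite polyCN opprK addrC.
have /monicP := monic_exp m (monicXsubC (-1 : F)).
by rewrite lead_coefE size_exp_XsubC.
Qed.

Lemma digits_at0 (p : nat) (p_pr : prime p) (x : padic_int p_pr) : x 0%N = 0%N.
Proof. by have := digits_lt x 0; rewrite expn0; case: (x 0%N). Qed.

Section PolynomialCancel.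
Variables (F : fieldType) (c : nat -> F) (d : nat) (I : finType) (r : I -> nat) (w : I -> F) (s0 : F).
Variables (N2 den Psi : {poly F}).
Hypotheses (numE : num2 c d = N2 * Psi) (denE : 1 - 'X^d = den * Psi).

Definition box_poly (t : I + 'I_1) (l : I) : {poly F} :=
  match t with inl k => if l == k then N2 else den | inr _ => den end.
Definition box_coef (t : I + 'I_1) : F := match t with inl k => w k | inr _ => - s0 end.

(** Multiplying back by the factors [Psi] gives the relation that [no_laurent_comp] excludes, with
    [Z = 0] and the constant [s0] for [D]. *)
Lemma box_absurd : 2%:R != 0 :> F -> (0 < d)%N -> (forall n, c (n + d)%N = c n) -> c 1%N = 1 ->
  I -> (forall k, 0 < r k)%N -> injective r -> (forall k, w k != 0) ->
  \sum_t box_coef t *: \prod_l (box_poly t l \Po 'X^(r l)) = 0 -> False.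
Proof.
move=> two0 d0 per one i0 r0 rinj w0 E.
apply: (no_laurent_comp (Z := 0%N) (D := s0%:P) two0 d0 per one i0 r0 rinj w0).
rewrite expr0 mulr1; apply/eqP; rewrite -subr_eq0; apply/eqP.
have hP (P : pred I) : \prod_(l | P l) ((1 - 'X^d : {poly F}) \Po 'X^(r l)) =
    \prod_(l | P l) ((den \Po 'X^(r l)) * (Psi \Po 'X^(r l))).
  by apply: eq_bigr => l _; rewrite denE comp_polyM.
rewrite hP (eq_bigr (fun k => (w k)%:P * (((N2 \Po 'X^(r k)) * (Psi \Po 'X^(r k))) *
   \prod_(l | l != k) ((den \Po 'X^(r l)) * (Psi \Po 'X^(r l)))))) => [|k _]; last first.
  by rewrite hP numE comp_polyM mul_polyC.
rewrite [s0%:P * _]mulrC cancel_factor (_ : _ - _ = 0) ?mulr0 // -[RHS]E big_sumType /= big_ord1 /=.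
rewrite scaleNr -[s0 *: _]mul_polyC [s0%:P * _]mulrC; congr (_ - _).
apply: eq_bigr => k _; rewrite -mul_polyC -(prod_if k); congr (_ * _).
by apply: eq_bigr => l _; case: eqP => // ->.
Qed.
End PolynomialCancel.

Section LambdaBound.
Variables (p : nat) (p_pr : prime p) (p_odd : odd p).
Variables (d : nat) (d_gt0 : (0 < d)%N) (p_ndvd_d : ~~ (p %| d)%N).
Variables (K : fieldExtType (padic_field p_pr)).
Local Notation Zp := (padic_int p_pr).
Local Notation O := (int_ring K).
Local Notation emb := (@padic_int_emb p p_pr K).
Variables (zeta zeta' : Zp) (delta : nat).
Hypotheses (zz : zeta' * zeta = 1) (prim_zeta : p.-1.-primitive_root zeta).
Hypothesis (prim_resF : p.-1.-primitive_root (resF zeta)).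
Variable c : nat -> O.
Hypotheses (c_per : forall i, c (i + d)%N = c i) (c_mul : forall i, c (p * i)%N = c p * c i).
Hypothesis c1 : c 1%N = 1.
Let C0 := \sum_(l < d) c l.
Hypotheses (HC1 : C0 = 0 \/ ~~ (p.-1 %| delta.+1)%N) (HC2 : C0 = 0 \/ ~~ (p.-1 %| delta)%N).
Variable sg : O.
Hypothesis c_sym : forall i j, (d %| i + j)%N -> c j = sg * c i.
Hypothesis sg_delta : sg * (-1) ^+ delta.+1 = 1.
Hypothesis HR : (3 < p)%N \/ C0 = 0.
Local Notation Beta := (@beta p p_pr d K zeta' delta c).
Local Notation kpow := (@padic_pow p p_pr d).
Variable f : {fps O}.
Variable pi : uniformizer K.
Local Notation F := (residue_field pi).
Local Notation red := (@reduction p p_pr K pi).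
Local Notation X := (onepT_pow pi).
Hypothesis f_level : forall N, eqT (p ^ N) (fps_map red f) (level_fps d zeta' delta c pi N).

Let p_gt0 : (0 < p)%N. Proof. exact: prime_gt0. Qed.
Let p_gt2 : (2 < p)%N. Proof. by have := prime_gt1 p_pr; have := p_odd; case: (p) => [|[|[|]]]. Qed.
Let h := (p.-1)./2.
Let p_h : p.-1 = (h + h)%N.
Proof. by rewrite addnn halfK; have := p_odd; case: (p) p_gt2 => //= n _ /negPf ->; rewrite subn0. Qed.
Let h_gt0 : (0 < h)%N. Proof. by have := p_h; have := p_gt2; lia. Qed.

(** If [z N] were positive, the leading coefficient of [(1 + T)^(z N)], whose index is below [p^N],
    would contradict [X z = 1]. *)
Lemma onepT_pow_eq1 (z : Zp) : X z = 1 -> z = 0.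
Proof.
move=> Xz; apply: padicP => N; rewrite -[0]/(0%:R) digits_nat mod0n.
have := digits_lt z N; case: (posnP (z N)) => // zN zlt.
have e1 := @onepT_pow_digits p p_pr K pi N z (z N) zlt.
have := e1; rewrite Xz fps_polyE.
have -> : (1 : {fps F}) (z N) = 0.
  have -> : (1 : {fps F}) = fps_poly 1 := esym (rmorph1 (@fps_poly F)).
  by rewrite fps_polyE coef1 gtn_eqF.
by rewrite coef_exp_1pX => /esym/eqP; rewrite oner_eq0.
Qed.

(** At level [n - 1] the coefficients of [f] in the basis of powers of [1 + T] are the values of
    [Beta n] at powers of [kappa]; [beta_zeta] carries their vanishing to all units. *)
Lemma unit_vanish n : (0 < n)%N -> eqT (p ^ n.-1) (fps_map red f) 0 ->
  forall x : Zp, x 1%N != 0%N -> red (Beta n x) = 0.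
Proof.
case: n => // n _ /= f0.
have b0 (y : 'I_(p ^ n)) : red (Beta n.+1 (kpow (- (y : nat)%:R))) = 0.
  apply: (@onepT_free_digits p p_pr K pi n (fun y => red (Beta n.+1 (kpow (- (y : nat)%:R)))) (fun y => (y : nat)%:R)).
    by move=> z; rewrite digits_nat modn_small.
  exact: eqTtrans (eqTsym (@f_level n)) f0.
(* The indicator of non-vanishing, counted in [nat]: a zero sum over the units forces every term to
   be zero. *)
pose G (x : Zp) : nat := red (Beta n.+1 x) != 0.
have hG (x y : Zp) : x n.+1 = y n.+1 -> G x = G y by move=> e; rewrite /G (beta_mod d zeta' delta c e).
have := units_reindex p_odd p_ndvd_d prim_resF hG.
rewrite big1 => [|k _]; last first.
  apply: big1 => y _; rewrite /G (beta_zeta p_odd d_gt0 p_ndvd_d zz prim_zeta c_per HC1).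
  by rewrite (rmorphM red) [X in _ * X]b0 mulr0 eqxx.
move=> /esym/eqP; rewrite sum_nat_eq0 => /forallP /= H x x1.
have := H (Ordinal (digits_lt x n.+1)).
rewrite (unit_level x (ltn0Sn n)) (negPf x1) /= /G (beta_mod d zeta' delta c (digits_natE x n.+1)).
by have [->|] := eqVneq (red (Beta n.+1 x)) 0.
Qed.

Lemma beta_step N (x : Zp) : \sum_(j < p) Beta N.+1 (x + p%:R ^+ N * j%:R) = Beta N x.
Proof.
rewrite -(beta_dist p_odd d_gt0 p_ndvd_d zz prim_zeta c_per HC1 HC2 N x (mulr1 1)).
by apply: eq_bigr => j _; rewrite mulr1.
Qed.

Lemma lift_digit1 N (x t : Zp) : (0 < N)%N -> (x + p%:R ^+ N * t) 1%N = x 1%N.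
Proof. by move=> N0; apply: (@digits_le _ _ _ _ _ N) => //; apply/padic_eqP; exists t. Qed.

(** A non-unit that is non-zero modulo [p^n] is [p y], and [beta_p] reduces its mass to that of [y]
    one level lower; vanishing on units descends to that level by summing over lifts. *)
Lemma vanish_off0 n : (forall x : Zp, x 1%N != 0%N -> red (Beta n x) = 0) ->
  forall x : Zp, x n != 0%N -> red (Beta n x) = 0.
Proof.
elim: n => [|n IH] hu x xn; first by rewrite digits_at0 in xn.
have [x1|] := eqVneq (x 1%N) 0%N; last exact: hu.
have /padic_dvdP [y ey] := x1; move: xn; rewrite ey expr1 digits_pM => yn.
rewrite (beta_p d_gt0 p_ndvd_d zz prim_zeta c_per c_mul HC1) (rmorphM red).
case: (posnP n) => [n0|n0]; first by move: yn; rewrite n0 digits_at0 muln0.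
rewrite [X in _ * X]IH ?mulr0 // => [z z1|]; last by move: yn; rewrite muln_eq0 negb_or => /andP[].
rewrite -beta_step rmorph_sum big1 // => j _; apply: hu.
by rewrite lift_digit1.
Qed.

Lemma Tr_step N : eqT (p ^ N) (Tr N.+1 1 (red \o Beta N.+1)) (Tr N 1 (red \o Beta N)).
Proof.
move=> k kN; rewrite /Tr [LHS]fps_sum [RHS]fps_sum expnS.
rewrite [LHS](sum_mul p (p ^ N) (fun x => (fps_poly ((red \o Beta N.+1) x%:R)%:P * X (x%:R * 1)) k)).
rewrite [LHS]exchange_big; apply: eq_bigr => y _.
transitivity (\sum_(l < p) red (Beta N.+1 (y%:R + p%:R ^+ N * l%:R)) * X (y%:R * 1) k).
  apply: eq_bigr => l _; rewrite [LHS]fpsCM.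
  have -> : (l * p ^ N + y)%:R = y%:R + p%:R ^+ N * l%:R :> Zp by rewrite natrD natrM natrX; ring.
  congr (_ * _); apply: (onepT_pow_eqT pi _) kN; rewrite !mulr1.
  by apply/padic_eqP; exists l%:R.
by rewrite -mulr_suml -rmorph_sum beta_step [RHS]fpsCM.
Qed.

(** Only the mass at 0 is left at level [n], and passing to level [N] does not change the transform
    modulo [T^(p^n)]. *)
Lemma Tr_const n N : (n <= N)%N -> (forall x : Zp, x n != 0%N -> red (Beta n x) = 0) ->
  eqT (p ^ n) (Tr N 1 (red \o Beta N)) (fps_poly (red (Beta n 0))%:P).
Proof.
move=> nN h0; apply: (@eqTtrans _ _ _ (Tr n 1 (red \o Beta n))).
  rewrite -(subnK nN); elim: (N - n)%N => [|j IH]; first exact: eqTrefl.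
  rewrite addSn; apply: eqTtrans IH; apply: (@eqT_le _ (p ^ n) (p ^ (j + n))); last exact: Tr_step.
  by rewrite leq_exp2l ?prime_gt1 // leq_addl.
have pn : (0 < p ^ n)%N by rewrite expn_gt0 p_gt0.
have X0 : X (0%:R * 1) = 1 by rewrite mul0r; exact: onepT_pow0.
move=> k kn; transitivity ((fps_poly (red (Beta n 0))%:P * X (0%:R * 1)) k); last first.
  by rewrite X0; congr ((_ : {fps F}) k); exact: mulr1.
rewrite /Tr [LHS]fps_sum.
rewrite (eq_bigr (fun x => if x == Ordinal pn then (fps_poly (red (Beta n 0))%:P * X (0%:R * 1)) k else 0)) => [|x _].
  by rewrite -big_mkcond big_pred1_eq.
case: eqP => [-> //|/eqP x0].
rewrite [LHS]fpsCM [X in X * _](_ : _ = 0) ?mul0r //; apply: h0; rewrite digits_nat modn_small //.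
Qed.

Variables N2 den Psi : {poly F}.
Hypotheses (numE : num2 (red \o c) d = N2 * Psi) (denE : 1 - 'X^d = den * Psi).
Hypotheses (sN2 : (size N2 <= (totient d).+1)%N) (sden : (size den <= (totient d).+1)%N).

Lemma ev_mul (z : Zp) (P Q : {poly F}) : ev z (P * Q) = ev z P * ev z Q.
Proof. exact: (rmorphM (ev z)). Qed.

Lemma zeta_neq (k l : 'I_h) : k != l ->
  zeta ^+ k - zeta ^+ l != 0 /\ zeta ^+ k + zeta ^+ l != 0.
Proof.
move=> kl; have inj : injective (fun _ : 'I_1 => 0 : Zp) by move=> i j _; rewrite [i]ord1 [j]ord1.
have := @zeta_u_neq p p_pr p_odd d d_gt0 p_ndvd_d K zeta delta prim_zeta prim_resF c HC1 HC2 HR 1 _ inj ord0 ord0 k l.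
have zE (m : nat) : zeta ^+ m * kpow (- 0) = zeta ^+ m.
  by rewrite oppr0 (_ : kpow 0 = 1) ?mulr1 //; exact: padic_pow0.
by rewrite !zE; apply; rewrite xpair_eqE eqxx.
Qed.

(** The difference of two box points has [h] coordinates of size at most [totient d], so
    [norm_bound] applies; this is where the constant of the theorem arises. *)
Lemma box_separation n (rho : 'I_h -> Zp) (sgn : 'I_h -> bool) (j j' : 'I_h -> 'I_(totient d).+1) :
  (forall k, rho k = (-1) ^+ sgn k * zeta ^+ k) ->
  ((h * totient d) ^ totient p.-1 < p ^ n)%N ->
  (\sum_k rho k *+ j k) n = (\sum_k rho k *+ j' k) n -> \sum_k rho k *+ j k = \sum_k rho k *+ j' k.
Proof.
move=> rhoE bnd e; pose D k : int := (-1) ^+ sgn k * ((j k : nat)%:Z - (j' k : nat)%:Z).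
have DE : \sum_k rho k *+ j k - \sum_k rho k *+ j' k = \sum_(k < h) zeta ^+ k *~ D k.
  rewrite -sumrB; apply: eq_bigr => k _; rewrite rhoE /D.
  case: (sgn k); rewrite ?expr0 ?expr1 ?mul1r ?mulN1r ?mulrNz mulrzBr -?pmulrn //.
  by rewrite !mulNrn opprB opprK addrC.
have D0 : (\sum_(k < h) zeta ^+ k *~ D k) n = 0%N by rewrite -DE; apply/eqP; rewrite digits_sub0 e.
apply/eqP; rewrite -subr_eq0 DE; apply/eqP.
apply: (norm_bound prim_zeta (B := totient d) _ bnd D0) => k.
rewrite /D normrM normrX normrN1 expr1n mul1r.
by have := ltn_ord (j k); have := ltn_ord (j' k); lia.
Qed.

(** The whole measure on [Z_p] is now under control, so [c] itself is used, with period [d] in place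
    of the [p d] of [cstar]; the period determines the size of the box. *)
Lemma Tr_beta_d N (sgn : 'I_h -> bool) : eqT (p ^ N)
  (\prod_k (1 - X (d%:R * ((-1) ^+ sgn k * zeta ^+ k) * 1)) * Tr N 1 (red \o Beta N))
  (\sum_k fps_poly (coefw zeta' delta pi sgn k)%:P *
     (ev ((-1) ^+ sgn k * zeta ^+ k * 1) (num2 (red \o c) d) *
      \prod_(l | l != k) (1 - X (d%:R * ((-1) ^+ sgn l * zeta ^+ l) * 1)))).
Proof.
apply: (@Tr_beta p p_pr d K zeta zeta' delta c d N zz c_per _ sg _ sg_delta h p_h (@zetaV_half p p_pr p_odd d d_gt0 p_ndvd_d K zeta zeta' delta zz prim_zeta prim_resF c HC1 HC2 HR) sgn).
- exact: dvdn_mulr.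
- by move=> i id; apply: c_sym; rewrite subnKC.
- case: HR => [p3|C00]; first by left; have := p_h; lia.
  by right=> x; rewrite (CsumE d_gt0 p_ndvd_d c_per) // -/C0 C00.
- exact: (betaE d_gt0 p_ndvd_d zz prim_zeta c_per HC1).
- by rewrite muln_gt0 d_gt0 expn_gt0 p_gt0.
- by move=> x y; apply: beta_mod.
Qed.

Theorem level_absurd n : (0 < n)%N -> ((h * totient d) ^ totient p.-1 < p ^ n)%N ->
  eqT (p ^ n.-1) (fps_map red f) 0 -> False.
Proof.
move=> n0 bnd f0; have off0 := vanish_off0 (unit_vanish n0 f0).
have g0 (k : 'I_h) : zeta ^+ k != 0.
  rewrite expf_neq0 //; apply/eqP => z0; have := zz; rewrite z0 mulr0 => /esym/eqP.
  by rewrite oner_eq0.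
have [A [ff [sgn [sA addf Ag _ [fpos f_inj]]]]] := form_signs [::] g0 zeta_neq.
pose rho k := (-1) ^+ sgn k * zeta ^+ k; pose w := coefw zeta' delta pi sgn.
pose s0 := red (Beta n 0).
have Arho k : A (rho k).
  by rewrite /rho; case: (sgn k); rewrite ?mul1r // expr1 mulN1r; apply: subgroupN.
have d_rho k : ev (rho k) den * ev (rho k) Psi = 1 - X (rho k *+ d).
  by rewrite -ev_mul -denE ev_one_sub.
have Psi0 k : ev (rho k) Psi != 0.
  apply/eqP => E0; have := d_rho k; rewrite E0 mulr0 => /esym/eqP.
  rewrite subr_eq0 => /eqP/esym/onepT_pow_eq1/eqP; rewrite -mulr_natl mulf_eq0.
  rewrite padic_natr_eq0 gtn_eqF //= mulf_eq0 (negPf (g0 k)) orbF signr_eq0 //.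
have Pn0 : \prod_l ev (rho l) Psi != 0 by apply: fps_prod_neq0 => l _; exact: Psi0.
have [v [v0 vlt]] := fps_order Pn0.
(* Cancelling the product of the [Psi] costs its order [v]; level [n + v] is high enough for
   precision [p^n] to remain. *)
pose N := (n + v)%N.
have pv : (p ^ n + v <= p ^ N)%N.
  rewrite expnD; have := ltn_expl v (prime_gt1 p_pr); have : (0 < p ^ n)%N by rewrite expn_gt0 p_gt0.
  by move: (p ^ n)%N (p ^ v)%N => a b; nia.
pose S := Tr N 1 (red \o Beta N).
pose body := \sum_k fps_poly (w k)%:P * (ev (rho k) N2 * \prod_(l | l != k) ev (rho l) den).
have yE k : 1 - X (d%:R * rho k * 1) = ev (rho k) den * ev (rho k) Psi.
  by rewrite d_rho mulr1 mulr_natl.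
have rel : eqT (p ^ N) ((\prod_l ev (rho l) Psi) * (body - \prod_l ev (rho l) den * S)) 0.
  rewrite -cancel_factor; apply: eqT_subr0'.
  apply: (@eqTtrans _ _ _ (\prod_k (1 - X (d%:R * rho k * 1)) * S)); last first.
    by apply: eqTMr; apply: eqT_prod => l _; rewrite yE.
  apply: eqTtrans (eqTsym (@Tr_beta_d N sgn)).
  apply: eqT_sum => k _; apply: eqTMl; rewrite -/(rho k) mulr1 numE -ev_mul.
  by apply: eqTMl; apply: eqT_prod => l _; rewrite -yE.
have rel2 : eqT (p ^ n) (body - \prod_l ev (rho l) den * S) 0.
  by apply: (@eqT_le _ (p ^ n) (p ^ N - v)); [move: pv; clear; lia|exact: (eqT_cancel v0 vlt rel)].
have relC : eqT (p ^ n) (\sum_t fps_poly (box_coef w s0 t)%:P * \prod_l ev (rho l) (box_poly N2 den t l)) 0.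
  rewrite big_sumType big_ord1 /=; apply: eqTtrans rel2; apply: eqTD.
    apply: eqT_sum => k _; apply: eqTMl; rewrite (bigD1 k) //= eqxx; apply: eqTMl.
    by apply: eqT_prod => l /negPf ->.
  rewrite (rmorphN (@polyC F)) (rmorphN (@fps_poly F)) mulNr [X in eqT _ _ (- X)]mulrC; apply: eqTN; apply: eqTMr.
  by apply: eqTsym; apply: (Tr_const (leq_addr v n) off0).
pose r k := `|ff (rho k)|%N.
have rE k : ff (rho k) = r k by rewrite /r gez0_abs // ltW //; exact: fpos.
have E : \sum_t box_coef w s0 t *: \prod_l (box_poly N2 den t l \Po 'X^(r l)) = 0.
  apply: (@transfer p p_pr K pi _ _ rho r _ _ (totient d) n _ _ relC) => [[k|i] l|j j'] /=.
  - by case: ifP.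
  - exact: sden.
  move=> /(box_separation (fun _ => erefl) bnd)/(congr1 ff).
  have fM (u : {ffun 'I_h -> 'I_(totient d).+1}) : ff (\sum_k rho k *+ u k) = (\sum_g r g * u g)%N%:R.
    rewrite (additive_on_sum sA addf) => [|i _]; last exact: subgroupMn.
    rewrite natr_sum; apply: eq_bigr => i _.
    by apply: etrans (additive_onMn sA addf (u i) (Arho i)) _; rewrite rE natrM natz mulr_natr.
  by rewrite !fM => /eqP; rewrite eqr_nat => /eqP.
apply: (box_absurd numE denE (@two_neq0 p p_pr p_odd d d_gt0 p_ndvd_d K zeta delta prim_zeta prim_resF c HC1 HC2 HR pi) d_gt0 _ _ (Ordinal h_gt0) _ _ _ E).
- by move=> i; rewrite /= c_per.
- by rewrite /= c1 rmorph1.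
- by move=> k; have := fpos k; rewrite -/(rho k) rE.
- by move=> k l e; apply: f_inj; rewrite -/(rho k) -/(rho l) !rE e.
- by move=> k; exact: (@coefw_neq0 p p_pr K zeta zeta' delta zz pi sgn k).
Qed.
End LambdaBound.

(** * Cyclotomic factors and character sums *)

Section CyclotomicFactor.
Variables (F : fieldType) (d : nat) (d_neq0 : d%:R != 0 :> F).
Local Notation Phi n := (map_poly (intr : int -> F) 'Phi_n).

Let d_gt0 : (0 < d)%N.
Proof. by case: d d_neq0; rewrite ?eqxx. Qed.

Lemma prod_Phi n : (0 < n)%N -> \prod_(m <- divisors n) Phi m = 'X^n - 1.
Proof.
move=> n0; rewrite -rmorph_prod /= prod_Cyclotomic //.
by rewrite rmorphB rmorph1 /= map_polyXn.
Qed.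

Lemma size_Phi n : size (Phi n) = (totient n).+1.
Proof.
by rewrite size_map_poly_id0 ?size_Cyclotomic // (monicP (Cyclotomic_monic n)) rmorph1 oner_eq0.
Qed.

Lemma separable_prod_dvdp (s : seq nat) (P : nat -> {poly F}) (f : {poly F}) :
  separable_poly (\prod_(m <- s) P m) -> (forall m, m \in s -> P m %| f) ->
  \prod_(m <- s) P m %| f.
Proof.
elim: s => [|m s IH]; first by rewrite big_nil dvd1p.
rewrite big_cons separable_mul => /and3P[_ sep cop] h.
rewrite Gauss_dvdp // h ?mem_head //= IH // => m' m's.
by apply: h; rewrite inE m's orbT.
Qed.

Lemma Xn_sub1_dvd n a : ('X^n - 1 : {poly F}) %| 'X^a - 'X^(a %% n).
Proof.
have -> : 'X^a - 'X^(a %% n) = ('X^(a %/ n * n) - 1) * 'X^(a %% n) :> {poly F}.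
  by rewrite mulrBl mul1r -exprD -divn_eq.
by apply: dvdp_mulr; rewrite mulnC exprM [X in _ %| X]subrX1 dvdp_mulIl.
Qed.

(** Modulo ['X^n - 1] the monomial ['X^i] becomes ['X^(i %% n)], so the sums over residue classes
    are the coefficients of the remainder. *)
Lemma residues_dvd (c : nat -> F) n : (0 < n)%N ->
  (forall r, \sum_(i < d | (i %% n == r)%N) c i = 0) -> ('X^n - 1 : {poly F}) %| \poly_(i < d) c i.
Proof.
move=> n0 hc; rewrite poly_def.
have -> : \sum_(i < d) c i *: 'X^i = \sum_(i < d) c i *: ('X^i - 'X^(i %% n)) :> {poly F}.
  under [RHS]eq_bigr do rewrite scalerBr.
  rewrite sumrB [X in _ - X](_ : _ = 0) ?subr0 //.
  have E (i : nat) : c i *: 'X^(i %% n) = \sum_(r < n) (if (i %% n == r)%N then c i *: 'X^r else 0) :> {poly F}.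
    rewrite (bigD1 (Ordinal (ltn_pmod i n0))) //= eqxx big1 ?addr0 // => r.
    by rewrite -val_eqE /= eq_sym => /negPf ->.
  under eq_bigr do rewrite E.
  rewrite exchange_big big1 //= => r _; rewrite -big_mkcond -scaler_suml.
  by rewrite (hc r) scale0r.
apply: (big_ind (fun P => ('X^n - 1 : {poly F}) %| P)) => [|P Q|i _]; first exact: dvdp0.
  exact: dvdp_add.
by rewrite -mul_polyC dvdp_mull // Xn_sub1_dvd.
Qed.

(** [Psi] is the product of the [Phi m] over the proper divisors of [d]. Vanishing residue sums make
    each of them divide the numerator, and since [d] is non-zero in [F], ['X^d - 1] is separable and
    so their product divides it; degree [totient d] remains. *)
Lemma num2_factor (c : nat -> F) : (forall i, c (i + d)%N = c i) -> c 1%N = 1 ->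
  ((1 < d)%N -> c 0%N = 0) ->
  (forall n, (n %| d)%N -> (n < d)%N -> forall r, \sum_(i < d | (i %% n == r)%N) c i = 0) ->
  exists N2 den Psi : {poly F}, [/\ num2 c d = N2 * Psi, 1 - 'X^d = den * Psi,
    (size N2 <= (totient d).+1)%N & (size den <= (totient d).+1)%N].
Proof.
move=> per c1 c0 hc; have dd : d \in divisors d by rewrite -dvdn_divisors.
pose Psi := \prod_(m <- rem d (divisors d)) Phi m.
have PhiPsi : Phi d * Psi = 'X^d - 1 by rewrite -prod_Phi // (big_rem d).
have denE : 1 - 'X^d = - Phi d * Psi by rewrite mulNr PhiPsi opprB.
have sden : (size (- Phi d) <= (totient d).+1)%N by rewrite size_polyN size_Phi.
(* For [d = 1] there is nothing to cancel: numerator and denominator already have degree at most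
   [totient 1]. *)
have [d1|d1] := leqP d 1.
  have d1' : d = 1%N by apply/eqP; rewrite eqn_leq d1.
  exists (num2 c d), (1 - 'X^d), 1; rewrite !mulr1; split=> //; rewrite d1'.
    rewrite (leq_trans (size_polyD _ _)) // geq_max.
    by rewrite !(leq_trans (size_poly _ _)).
  by rewrite expr1 -opprB size_polyN size_XsubC.
have nzPhi : Phi d != 0 by rewrite -size_poly_gt0 size_Phi.
have nzPsi : Psi != 0.
  by apply: contraTneq isT => P0; move: (size_XnsubC (1 : F) d_gt0); rewrite -PhiPsi P0 mulr0 size_poly0.
have sPsi : (size Psi + totient d = d.+1)%N.
  have := size_mul nzPhi nzPsi; rewrite PhiPsi size_XnsubC // size_Phi => ->.
  by rewrite addSn addnC.
(* As [c 0 = c d = 0], the two halves of [num2] coincide. *)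
have fE : num2 c d = 2%:R *: \poly_(i < d) c i.
  apply/polyP => i; rewrite coefD coefZ !coef_poly ltnS mulr_natl mulr2n.
  have cd : c d = 0 by rewrite -[d]add0n per c0.
  have [->|i0] := eqVneq i 0%N; first by rewrite d_gt0 leq0n c0 ?addr0.
  by case: (ltngtP i d) => [||->]; rewrite ?cd ?addr0 ?ltnn.
have dvd : Psi %| \poly_(i < d) c i.
  apply: separable_prod_dvdp => [|m].
    have sepX : separable_poly ('X^d - 1 : {poly F}) by apply: separable_Xn_sub_1.
    by move: sepX; rewrite -PhiPsi separable_mul => /and3P[].
  rewrite mem_rem_uniq ?divisors_uniq // inE -dvdn_divisors // => /andP[md mdd].
  have m0 : (0 < m)%N by apply: dvdn_gt0 mdd.
  apply: (@dvdp_trans _ ('X^m - 1)).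
    by rewrite -prod_Phi // (big_rem m) ?dvdp_mulIl // -dvdn_divisors.
  by apply: residues_dvd => // r; apply: hc => //; rewrite ltn_neqAle md dvdn_leq.
have [g ge] := dvdpP _ _ dvd.
exists (2%:R *: g), (- Phi d), Psi; split=> //; first by rewrite fE ge scalerAl.
rewrite (leq_trans (size_scale_leq _ _)) //.
have [->|g0] := eqVneq g 0; first by rewrite size_poly0.
have := size_poly d c; rewrite ge (size_mul g0 nzPsi) => le; move: sPsi le.
by move: (size Psi) (size g) (totient d) => a b t; clear; lia.
Qed.
End CyclotomicFactor.

Section CharacterSums.
Variables (K : fieldType) (d : nat) (chi : int -> K) (chi_prim : primitive_char d chi).

Let dir : dirichlet_char d chi. Proof. by case: chi_prim. Qed.
Let d_gt0 : (0 < d)%N. Proof. by case: dir. Qed.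
Let chiM a b : chi (a * b) = chi a * chi b. Proof. by case: dir. Qed.
Let chi_unit a : (chi a != 0) = coprimez a d. Proof. by case: dir. Qed.

(* A primitive character is nontrivial on the kernel of (Z/d)^* -> (Z/n)^*. *)
Lemma primitive_kernel n : (n %| d)%N -> (n < d)%N ->
  exists b : nat, [/\ coprime b d, b = 1 %[mod n] & chi b%:Z != 1].
Proof.
move=> nd nlt; apply: contrapT => H.
suff fac : factors_through d chi n.
  by have := dvdn_leq (dvdn_gt0 d_gt0 nd) (primitive_factors chi_prim fac); rewrite leqNgt nlt.
move=> a a' ca ca' e.
have [[u v] /= buv] : exists uv : int * int, uv.1 * a' + uv.2 * d%:Z = 1.
  have [u [v e1]] := Bezoutz a' d%:Z; exists (u, v); rewrite e1; exact/eqP.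
(* [u] is an inverse of [a'] modulo [d], so [b] represents the quotient of [a] by [a']. *)
pose b := `|((u * a) %% d)%Z|%N.
have d0 : d%:Z != 0 by rewrite eqz_nat -lt0n.
have bE : b%:Z = ((u * a) %% d)%Z by rewrite gez0_abs ?modz_ge0.
have chib : chi b%:Z = chi (u * a).
  by apply: (dirichlet_mod dir); rewrite bE modz_mod.
have chiu : chi u * chi a' = 1.
  rewrite -chiM -(dirichlet1 dir); apply: (dirichlet_mod dir).
  by rewrite -buv [_ + v * _]addrC modzMDl.
have b1 : chi b%:Z = 1.
  apply: contrapT => bn1; apply: H; exists b; split; last exact/eqP.
    have : coprimez b%:Z d by rewrite -chi_unit chib chiM mulf_neq0 // chi_unit //;
      rewrite -chi_unit; apply/eqP => u0; move: chiu; rewrite u0 mul0r => /esym/eqP; rewrite oner_eq0.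
    by rewrite coprimezE.
  have : (b%:Z = 1 %[mod n])%Z.
    have nd' : (n%:Z %| d%:Z)%Z by rewrite dvdzE.
    have bua : (b%:Z = u * a %[mod n])%Z.
      apply/eqP; rewrite eqz_mod_dvd; apply: dvdz_trans nd' _.
      by rewrite -eqz_mod_dvd bE modz_mod eqxx.
    rewrite bua -buv; apply/eqP; rewrite eqz_mod_dvd.
    rewrite (_ : u * a - (u * a' + v * d%:Z) = u * (a - a') - v * d%:Z); last by ring.
    by apply: rpredB; apply: dvdz_mull => //; rewrite -eqz_mod_dvd e eqxx.
  by rewrite !modz_nat => -[].
have chia' : chi a' != 0 by rewrite chi_unit.
apply: (mulfI (_ : chi u != 0)).
  by apply/eqP => u0; move: chiu; rewrite u0 mul0r => /esym/eqP; rewrite oner_eq0.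
by rewrite chiu -chiM -chib.
Qed.

(** Multiplication by some [b] in the kernel with [chi b] different from 1 permutes the class and
    scales the sum by [chi b]. *)
Lemma residue_sum n r : (n %| d)%N -> (n < d)%N ->
  \sum_(i < d | (i %% n == r)%N) chi i%:Z = 0.
Proof.
move=> nd nlt; have [b [cb b1 chib]] := primitive_kernel nd nlt.
set S := \sum_(_ < _ | _) _; suff e : chi b%:Z * S = S.
  have : (chi b%:Z - 1) * S = 0 by rewrite mulrBl mul1r e subrr.
  by move/eqP; rewrite mulf_eq0 subr_eq0 (negPf chib) => /eqP.
have lt i : (b * i %% d < d)%N by rewrite ltn_pmod.
pose g (i : 'I_d) : 'I_d := Ordinal (lt i).
have g_inj : injective g.
  have E (k : nat) : k = b ^ (totient d).-1 * (b * k) %[mod d].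
    rewrite mulnA -expnSr prednK ?totient_gt0 //.
    by rewrite -modnMml cyclic.Euler_exp_totient // modnMml mul1n.
  move=> i j [e]; apply: val_inj; rewrite /= -(modn_small (ltn_ord i)) -(modn_small (ltn_ord j)).
  by rewrite E [RHS]E -modnMmr e modnMmr.
rewrite {2}/S (reindex_inj g_inj) /= mulr_sumr; apply: eq_big => [i|i _].
  by rewrite modn_dvdm // -modnMml b1 modnMml mul1n.
rewrite -chiM; apply: (dirichlet_mod dir).
by rewrite -modz_nat -PoszM modz_mod.
Qed.

Lemma chi_root a : chi a = 0 \/ chi a ^+ totient d = 1.
Proof.
have [ca|nca] := boolP (coprimez a d); last by left; apply/eqP; rewrite -[_ == _]negbK chi_unit.
right; pose b := `|(a %% d)%Z|%N.
have d0 : d%:Z != 0 by rewrite eqz_nat -lt0n.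
have bE : b%:Z = (a %% d)%Z by rewrite gez0_abs ?modz_ge0.
have ab : chi a = chi b%:Z by apply: (dirichlet_mod dir); rewrite bE modz_mod.
have cb : coprime b d by have : coprimez b%:Z d by rewrite -chi_unit -ab chi_unit.
have chiX k : chi b%:Z ^+ k = chi (b ^ k)%N%:Z.
  elim: k => [|k IH]; first by rewrite expr0 expn0 (dirichlet1 dir).
  by rewrite exprS IH -chiM expnS PoszM.
rewrite ab chiX -(dirichlet1 dir); apply: (dirichlet_mod dir).
by rewrite !modz_nat cyclic.Euler_exp_totient.
Qed.
End CharacterSums.

(** * Integral character values and the reduction of a Weierstrass factorization *)

Section Integral.
Variables (p : nat) (p_pr : prime p) (K : fieldExtType (padic_field p_pr)).

Lemma root_integral (x : K) m : (0 < m)%N -> x = 0 \/ x ^+ m = 1 -> x \in @integral_pred p p_pr K.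
Proof.
move=> m0 [->|xm]; first exact: rpred0.
apply/asboolP; exists ('X^m - 1); first by rewrite monicXnsubC.
by rewrite rmorphB rmorph1 /= map_polyXn /root !hornerE xm subrr.
Qed.

Lemma integral_lift (c : nat -> K) m : (0 < m)%N -> (forall i, c i = 0 \/ c i ^+ m = 1) ->
  exists cO : nat -> int_ring K, forall i, int_val (cO i) = c i.
Proof.
move=> m0 hc; exists (fun i => IntRing (root_integral m0 (hc i))) => i.
by [].
Qed.
End Integral.

Section Reduction.
Variables (p : nat) (p_pr : prime p) (K : fieldExtType (padic_field p_pr)).
Variable pi : uniformizer K.
Local Notation O := (int_ring K).
Local Notation F := (residue_field pi).
Local Notation red := (@reduction p p_pr K pi).

Lemma fps_map_mul (A B : {fps O}) : fps_map red (A * B) = fps_map red A * fps_map red B.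
Proof.
apply: eqT_all => n k _; apply: (@etrans _ _ (red (\sum_(i < k.+1) A i * B (k - i)%N))).
  by congr red; exact: fpsM.
rewrite (rmorph_sum red) [RHS]fpsM; apply: eq_bigr => i _; exact: (rmorphM red).
Qed.

Lemma fps_map_poly (P : {poly O}) : fps_map red (fps_poly P) = fps_poly (map_poly red P).
Proof. by apply: eqT_all => n k _; rewrite /fps_map !fps_polyE coef_map. Qed.

(** [P] reduces to ['X^lam], so the reduction of [f] is a multiple of [T^lam] for every [mu]; it is
    0 when [mu] is positive. *)
Lemma weierstrass_vanish (f : {fps O}) mu lam P U : weierstrass_factorization pi f mu lam P U ->
  eqT lam (fps_map red f) 0.
Proof.
move=> [-> _ _ PX] k klt; rewrite !fps_map_mul !fps_map_poly PX -mulrA map_polyC fpsCM fpsXnM klt.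
by rewrite mulr0 fps0.
Qed.
End Reduction.

Theorem theorem4p5 (p : nat) (p_pr : prime p) (p_odd : odd p)
    (d : nat) (d_gt0 : (0 < d)%N) (p_ndvd_d : ~~ (p %| d)%N)
    (K : fieldExtType (padic_field p_pr))
    (chi : int -> K) (chi_prim : primitive_char d chi)
    (K_chi : <<1 & [seq chi a%:Z | a <- iota 0 d]>>%VS = {:K}%VS)
    (delta : 'Z_(p.-1))
    (m : nat) (theta : int -> K) (theta_prim : primitive_char m theta)
    (theta_first_kind : ~~ (p ^ 2 %| m)%N)
    (theta_nontrivial : exists a : int, coprimez a m /\ theta a <> 1)
    (theta_even : theta (-1) = 1)
    (theta_chi : forall a : int,
      theta a = primitive_of (d * p) (twist chi (delta.+1)%:Z) a)
    (pi : uniformizer K)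
    (L : padic_int p_pr -> K) (L_theta : kubota_leopoldt m theta L)
    (f : {fps int_ring K}) (f_theta : iwasawa_series d L f) :
  ~ pseudo_rational (fps_map (reduction pi) f) /\
  (lambda_invariant pi f < ((p - 1) %/ 2 * totient d) ^ totient (p - 1))%N.
Proof.
have dir : dirichlet_char d chi by case: chi_prim.
have [_ chiM chi_per chi_unit] := dir.
have p_gt1 := prime_gt1 p_pr.
have p_gt2 : (2 < p)%N by case: (p) p_odd p_gt1 => [|[|[|]]].
have td : (0 < totient d)%N by rewrite totient_gt0.
have [c cE] := integral_lift (c := fun i : nat => chi i%:Z) td (fun i => chi_root chi_prim i%:Z).
have inj := @int_val_inj p p_pr K.
have c_per i : c (i + d)%N = c i by apply: inj; rewrite !cE PoszD; exact: chi_per.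
have c_mul i : c (p * i)%N = c p * c i.
  by apply: inj; rewrite (rmorphM (@int_val _ _ K)) /= !cE PoszM; exact: chiM.
have c1 : c 1%N = 1 by apply: inj; rewrite cE (dirichlet1 dir) (rmorph1 (@int_val _ _ K)).
(* The sign [chi(-1)] is represented in [O_K] by [c d.-1], because [d - 1 = -1] modulo [d]. *)
have sgE : int_val (c d.-1) = chi (-1).
  rewrite cE; apply: (dirichlet_mod dir); apply/eqP; rewrite eqz_mod_dvd opprK.
  by rewrite -(PoszD _ 1) addn1 prednK ?dvdzz.
have c_sym i j : (d %| i + j)%N -> c j = c d.-1 * c i.
  move=> ij; apply: inj; rewrite (rmorphM (@int_val _ _ K)) /= sgE !cE -chiM.
  apply: (dirichlet_mod dir); apply/eqP; rewrite eqz_mod_dvd mulN1r opprK.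
  by rewrite addrC -PoszD dvdzE.
have sign := chi_sign p_odd d_gt0 chi_prim theta_chi theta_even.
have sg_delta : c d.-1 * (-1) ^+ (delta : nat).+1 = 1.
  apply: inj; rewrite (rmorphM (@int_val _ _ K)) /= sgE (rmorphXn (@int_val _ _ K)).
  by rewrite (rmorphN (@int_val _ _ K)) (rmorph1 (@int_val _ _ K)).
have C0 : (1 < d)%N -> \sum_(l < d) c l = 0.
  move=> d1; apply: inj; rewrite (rmorph_sum (@int_val _ _ K)) (rmorph0 (@int_val _ _ K)).
  have := residue_sum chi_prim 0 (dvd1n d) d1; rewrite (eq_bigl xpredT) => [|i].
    by move=> e; rewrite -[RHS]e; apply: eq_bigr => i _; exact: cE.
  by rewrite modn1 eqxx.
have d1P : (1 < d)%N \/ d = 1%N by move: (d) d_gt0; clear; lia.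
have delta_odd : d = 1%N -> odd delta.
  move=> d1; have chi1 : chi (-1) = 1.
    by rewrite -(dirichlet1 dir); apply: (dirichlet_mod dir); rewrite d1 !modz1.
  apply: contraT => de; move: sign; rewrite chi1 mul1r -signr_odd /= de expr1 => /eqP.
  by rewrite eq_sym -subr_eq0 opprK -[1 + 1]/(2%:R) (natrK_eq0 K 2).
(* For [d > 1] the sum of [chi] over a period vanishes; for [d = 1] the divisibility would make
   [theta] trivial. *)
have HC1 : \sum_(l < d) c l = 0 \/ ~~ (p.-1 %| (delta : nat).+1)%N.
  case: d1P => [/C0|d1]; [by left|right; apply/negP => dvd].
  have [a [ca]] := theta_nontrivial; apply.
  exact: (trivial_character p_odd d_gt0 p_ndvd_d chi_prim theta_prim theta_chi d1 dvd).
have p1_even : ~~ odd p.-1 by move: p_odd p_gt1; case: (p) => //= n; rewrite negbK.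
have HC2 : \sum_(l < d) c l = 0 \/ ~~ (p.-1 %| (delta : nat))%N.
  case: d1P => [/C0|/delta_odd dod]; [by left|right; apply/negP => /dvdnP [l el]].
  by move: dod; rewrite el oddM (negPf p1_even) andbF.
(* The case [d = 1], [p = 3] cannot occur: [delta] would be odd, hence [p - 1 = 2] would divide
   [delta + 1], against [HC1]. *)
have HR : (3 < p)%N \/ \sum_(l < d) c l = 0.
  case: d1P => [/C0|d1]; [by right|left].
  rewrite ltn_neqAle p_gt2 andbT; apply/eqP => p3.
  have odd_dvd (D : nat) : odd D -> (p.-1 %| D.+1)%N by rewrite -p3 dvdn2 /= negbK.
  case: HC1 => [C00|]; last by rewrite odd_dvd // delta_odd.
  have := c1; rewrite -[1%N]/(0 + 1)%N -{1}d1 c_per => c01.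
  move: C00; rewrite -(big_mkord xpredT c) d1 big_nat1 c01 => /eqP.
  by rewrite oner_eq0.
have [zeta [prim_zeta prim_resF]] := padic_primitive_root p_pr.
have zz : zeta ^+ p.-2 * zeta = 1.
  by rewrite -exprSr prednK ?(prim_expr_order prim_zeta) //; move: p_gt2; clear; lia.
have L_val n : n = delta %[mod p.-1] ->
    L (1 - n.+1%:R) = - (1 - chi p%:Z * p%:R ^+ n) * (gen_bernoulli d chi n.+1 / n.+1%:R).
  move=> nd; have kn : (delta : nat).+1 = n.+1 %[mod p.-1] by rewrite -addn1 -modnDml -nd modnDml addn1.
  have := L_theta.2 n.+1 (ltn0Sn n); rewrite /=.
  rewrite (conductor_twist p_odd d_gt0 p_ndvd_d chi_prim theta_prim theta_chi kn).
  have -> : primitive_of (m * p) (twist theta (- n.+1%:Z)) = chi.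
    apply: funext; exact: (primitive_of_twist p_odd d_gt0 p_ndvd_d chi_prim theta_prim theta_chi kn).
  by [].
have f_level N := @fbar_level p p_pr p_odd d d_gt0 p_ndvd_d K zeta (zeta ^+ p.-2) delta zz prim_zeta
  prim_resF c c_per c_mul HC1 HC2 chi cE chi_per L f L_val f_theta pi N.
split; first exact: (not_pseudo_rational p_odd d_gt0 p_ndvd_d zz prim_zeta prim_resF c_per c1 HC1 HC2 c_sym sg_delta HR f_level).
pose F := residue_field pi; pose red := @reduction p p_pr K pi.
have [N2 [den [Psi [numE denE sN2 sden]]]] : exists N2 den Psi : {poly F}, [/\ num2 (red \o c) d = N2 * Psi,
    1 - 'X^d = den * Psi, (size N2 <= (totient d).+1)%N & (size den <= (totient d).+1)%N].
  apply: num2_factor.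
  - by rewrite natrF_eq0.
  - by move=> i /=; rewrite c_per.
  - by rewrite /= c1; exact: (rmorph1 (@reduction p p_pr K pi)).
  - move=> d1 /=; suff -> : c 0%N = 0 by exact: (rmorph0 (@reduction p p_pr K pi)).
    apply: inj; rewrite cE (rmorph0 (@int_val _ _ K)); apply/eqP; rewrite -[_ == _]negbK chi_unit.
    by rewrite coprimezE /= /coprime gcd0n gtn_eqF.
  - move=> n nd nlt r; have e0 : \sum_(i < d | (i %% n == r)%N) c i = 0.
      apply: inj; rewrite (rmorph_sum (@int_val _ _ K)) (rmorph0 (@int_val _ _ K)).
      by rewrite -[RHS](residue_sum chi_prim r nd nlt); apply: eq_bigr => i _; exact: cE.
    transitivity (red (\sum_(i < d | (i %% n == r)%N) c i)).
      exact/esym/(rmorph_sum (@reduction p p_pr K pi)).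
    by rewrite e0; exact: (rmorph0 (@reduction p p_pr K pi)).
have bound_gt0 : (0 < ((p - 1) %/ 2 * totient d) ^ totient (p - 1))%N.
  by rewrite expn_gt0 muln_gt0 td divn_gt0 // andbT; apply/orP; left; move: p_gt2; clear; lia.
rewrite /lambda_invariant; set S := (X in xget _ X).
(* Without a factorization the invariant takes its default value 0, and the bound is positive. *)
have [[lam0 hl]|hN] := pselect (exists lam, S lam); last first.
  by rewrite xgetPN // => lam hS; apply: hN; exists lam.
have [mu [P [U fact]]] : S (xget 0%N S) := xgetPex 0%N (ex_intro _ lam0 hl).
set lam := xget _ _ in fact *; rewrite ltnNge; apply/negP => le.
have ex : exists n, (((p - 1) %/ 2 * totient d) ^ totient (p - 1) < p ^ n)%N.
  by exists (((p - 1) %/ 2 * totient d) ^ totient (p - 1))%N; rewrite ltn_expl.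
(* [n] is least with the bound below [p^n], so [p^(n-1)] is at most the bound, hence at most
   [lam]. *)
case: (ex_minnP ex) => n bnd nmin.
have n0 : (0 < n)%N by case: n bnd {nmin} => // bnd; move: bound_gt0; rewrite expn0 in bnd; move: bnd; case: (_ ^ _)%N.
have nle : (p ^ n.-1 <= lam)%N.
  apply: leq_trans le; rewrite leqNgt; apply/negP => /nmin.
  by case: n n0 {bnd nmin} => // n _; rewrite ltnn.
rewrite subn1 divn2 in bnd.
apply: (@level_absurd p p_pr p_odd d d_gt0 p_ndvd_d K zeta (zeta ^+ p.-2) delta zz prim_zeta prim_resF c c_per c_mul
  c1 HC1 HC2 (c d.-1) c_sym sg_delta HR f pi f_level N2 den Psi numE denE sN2 sden n n0 bnd).
exact: eqT_le nle (weierstrass_vanish fact).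
Qed.
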